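(* Let $k$ be an algebraically closed field of characteristic different from $2$. The following $73$ algebras $\mathcal{J}_1,\dots,\mathcal{J}_{73}$ are four-dimensional Jordan $k$-algebras, they are pairwise non-isomorphic, and every four-dimensional Jordan $k$-algebra is isomorphic to one of them (so there are exactly $73$ isomorphism classes of four-dimensional Jordan algebras over $k$). The algebras $\mathcal{B}_i$, $\mathcal{T}_i$ and $ke_i$, $kn_i$ used in direct sums are defined in the context; $\oplus$ is the direct sum of algebras. When an algebra is given by a multiplication table, its basis is the listed one, the product is commutative, and all products of basis elements not determined by the listed ones and commutativity are zero. (Semisimple.) $\mathcal{J}_1=\mathcal{T}_5\oplus ke_4$; $\mathcal{J}_2$, basis $e_1,e_2,e_3,e_4$: $e_1^2=e_1,\ e_2^2=e_2,\ e_1e_3=\frac12e_3,\ e_1e_4=\frac12e_4,\ e_2e_3=\frac12e_3,\ e_2e_4=\frac12e_4,\ e_3e_4=\frac12(e_1+e_2)$; $\mathcal{J}_3=ke_1\oplus ke_2\oplus ke_3\oplus ke_4$. (One-dimensional radical.) $\mathcal{J}_4=\mathcal{B}_1\oplus ke_2\oplus ke_3$; $\mathcal{J}_5=ke_1\oplus ke_2\oplus ke_3\oplus kn_1$; $\mathcal{J}_6=\mathcal{B}_2\oplus ke_2\oplus ke_3$; $\mathcal{J}_7=\mathcal{T}_{10}\oplus ke_3$; $\mathcal{J}_8=\mathcal{T}_5\oplus kn_1$; $\mathcal{J}_9$, basis $e_1,e_2,e_3,n_1$: $e_1^2=e_1,\ e_2^2=e_2,\ e_3^2=e_1+e_2,\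 e_1e_3=\frac12e_3,\ e_1n_1=\frac12n_1,\ e_2e_3=\frac12e_3,\ e_2n_1=\frac12n_1$. (Two-dimensional radical; tables in basis $e_1,e_2,n_1,n_2$.) $\mathcal{J}_{10}=\mathcal{B}_2\oplus ke_2\oplus kn_2$; $\mathcal{J}_{11}=\mathcal{T}_{10}\oplus kn_2$; $\mathcal{J}_{12}=\mathcal{T}_7\oplus ke_2$; $\mathcal{J}_{13}=\mathcal{B}_2\oplus\mathcal{B}_2$; $\mathcal{J}_{14}=\mathcal{T}_6\oplus ke_2$; $\mathcal{J}_{15}=\mathcal{B}_2\oplus\mathcal{B}_1$; $\mathcal{J}_{16}$: $e_1^2=e_1,\ e_2^2=e_2,\ e_1n_1=\frac12n_1,\ e_1n_2=\frac12n_2,\ e_2n_1=\frac12n_1$; $\mathcal{J}_{17}$: $e_1^2=e_1,\ e_2^2=e_2,\ e_1n_1=\frac12n_1,\ e_1n_2=n_2,\ e_2n_1=\frac12n_1$; $\mathcal{J}_{18}$: $e_1^2=e_1,\ e_2^2=e_2,\ e_1n_1=\frac12n_1,\ e_1n_2=\frac12n_2,\ e_2n_1=\frac12n_1,\ e_2n_2=\frac12n_2$; $\mathcal{J}_{19}=ke_1\oplus kn_1\oplus ke_2\oplus kn_2$; $\mathcal{J}_{20}=\mathcal{B}_1\oplus ke_2\oplus kn_2$; $\mathcal{J}_{21}=\mathcal{T}_2\oplus ke_2$; $\mathcal{J}_{22}=\mathcal{B}_1\oplus\mathcal{B}_1$; $\mathcal{J}_{23}=\mathcal{T}_8\oplus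 ke_2$; $\mathcal{J}_{24}=\mathcal{T}_9\oplus ke_2$; $\mathcal{J}_{25}$: $e_1^2=e_1,\ e_2^2=e_2,\ e_1n_2=n_2,\ e_1n_1=\frac12n_1,\ e_2n_1=\frac12n_1,\ n_1^2=n_2$; $\mathcal{J}_{26}=\mathcal{B}_3\oplus ke_1\oplus ke_2$; $\mathcal{J}_{27}=\mathcal{T}_1\oplus ke_2$. (Three-dimensional radical; tables in basis $e_1,n_1,n_2,n_3$, always with $e_1^2=e_1$.) $\mathcal{J}_{28}=\mathcal{B}_2\oplus kn_2\oplus kn_3$; $\mathcal{J}_{29}=\mathcal{T}_6\oplus kn_3$; $\mathcal{J}_{30}=\mathcal{T}_7\oplus kn_3$; $\mathcal{J}_{31}$: $e_1n_1=n_1,\ e_1n_2=n_2,\ e_1n_3=\frac12n_3$; $\mathcal{J}_{32}$: $e_1n_1=\frac12n_1,\ e_1n_2=\frac12n_2,\ e_1n_3=n_3$; $\mathcal{J}_{33}$: $e_1n_1=\frac12n_1,\ e_1n_2=\frac12n_2,\ e_1n_3=\frac12n_3$; $\mathcal{J}_{34}=ke_1\oplus kn_1\oplus kn_2\oplus kn_3$; $\mathcal{J}_{35}=\mathcal{B}_1\oplus kn_2\oplus kn_3$; $\mathcal{J}_{36}$: $e_1n_1=n_1,\ e_1n_2=n_2,\ e_1n_3=n_3$; $\mathcal{J}_{37}=\mathcal{T}_2\oplus kn_3$; $\mathcal{J}_{38}=\mathcal{T}_3\oplus ke_1$; $\mathcal{J}_{39}$: $n_1^2=n_2,\ e_1n_1=n_1,\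 e_1n_2=n_2,\ e_1n_3=n_3,\ n_1n_2=n_3$; $\mathcal{J}_{40}=\mathcal{B}_3\oplus ke_1\oplus kn_3$; $\mathcal{J}_{41}=\mathcal{T}_4\oplus ke_1$; $\mathcal{J}_{42}$: $n_1^2=n_2,\ e_1n_1=n_1,\ e_1n_2=n_2,\ e_1n_3=n_3$; $\mathcal{J}_{43}$: $n_1^2=n_2,\ e_1n_1=n_1,\ e_1n_2=n_2,\ e_1n_3=n_3,\ n_1n_3=n_2$; $\mathcal{J}_{44}=\mathcal{T}_8\oplus kn_3$; $\mathcal{J}_{45}$: $n_1^2=n_2,\ n_3^2=n_2,\ e_1n_1=\frac12n_1$; $\mathcal{J}_{46}=\mathcal{B}_2\oplus\mathcal{B}_3$; $\mathcal{J}_{47}=\mathcal{B}_1\oplus\mathcal{B}_3$; $\mathcal{J}_{48}$: $n_3^2=n_1,\ e_1n_2=\frac12n_2,\ e_1n_3=\frac12n_3$; $\mathcal{J}_{49}$: $n_3^2=n_1,\ e_1n_2=\frac12n_2,\ e_1n_3=\frac12n_3,\ n_2n_3=n_1$; $\mathcal{J}_{50}$: $e_1n_2=\frac12n_2,\ e_1n_3=\frac12n_3,\ n_1n_2=n_3$; $\mathcal{J}_{51}=\mathcal{T}_9\oplus kn_3$; $\mathcal{J}_{52}$: $n_1^2=n_3,\ e_1n_2=n_2,\ e_1n_1=\frac12n_1$; $\mathcal{J}_{53}$: $n_1^2=n_3+n_2,\ e_1n_2=n_2,\ e_1n_1=\frac12n_1$; $\mathcal{J}_{54}=\mathcal{T}_1\oplus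 kn_3$; $\mathcal{J}_{55}$: $n_3^2=n_2,\ e_1n_1=n_1,\ e_1n_2=n_2,\ e_1n_3=\frac12n_3$; $\mathcal{J}_{56}$: $n_1^2=n_2,\ e_1n_1=n_1,\ e_1n_2=n_2,\ e_1n_3=\frac12n_3$; $\mathcal{J}_{57}$: $n_1^2=n_2,\ n_3^2=n_2,\ e_1n_1=n_1,\ e_1n_2=n_2,\ e_1n_3=\frac12n_3$; $\mathcal{J}_{58}$: $n_3^2=n_1,\ e_1n_1=n_1,\ e_1n_2=\frac12n_2,\ e_1n_3=\frac12n_3$; $\mathcal{J}_{59}$: $n_3^2=n_1,\ e_1n_1=n_1,\ e_1n_2=\frac12n_2,\ e_1n_3=\frac12n_3,\ n_2n_3=n_1$; $\mathcal{J}_{60}$: $e_1n_1=n_1,\ e_1n_2=\frac12n_2,\ e_1n_3=\frac12n_3,\ n_1n_2=n_3$. (Nilpotent; tables in basis $n_1,n_2,n_3,n_4$.) $\mathcal{J}_{61}$: $n_1^2=n_2,\ n_2^2=n_4,\ n_1n_2=n_3,\ n_1n_3=n_4$; $\mathcal{J}_{62}$: $n_1^2=n_2,\ n_4^2=n_2,\ n_1n_2=n_3$; $\mathcal{J}_{63}$: $n_1^2=n_2,\ n_4^2=-n_2-n_3,\ n_1n_2=n_3,\ n_2n_4=n_3$; $\mathcal{J}_{64}$: $n_1^2=n_2,\ n_4^2=-n_2,\ n_1n_2=n_3,\ n_2n_4=n_3$; $\mathcal{J}_{65}$: $n_1^2=n_2,\ n_1n_2=n_3,\ n_2n_4=n_3$;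 $\mathcal{J}_{66}$: $n_1^2=n_2,\ n_4^2=n_3,\ n_1n_2=n_3$; $\mathcal{J}_{67}=\mathcal{T}_3\oplus kn_4$; $\mathcal{J}_{68}=\mathcal{B}_3\oplus\mathcal{B}_3$; $\mathcal{J}_{69}$: $n_1^2=n_2,\ n_1n_3=n_4$; $\mathcal{J}_{70}$: $n_1^2=n_2,\ n_3n_4=n_2$; $\mathcal{J}_{71}=\mathcal{T}_4\oplus kn_4$; $\mathcal{J}_{72}=\mathcal{B}_3\oplus kn_3\oplus kn_4$; $\mathcal{J}_{73}=kn_1\oplus kn_2\oplus kn_3\oplus kn_4$.
   Context: A Jordan $k$-algebra is a $k$-vector space $\mathcal{J}$ with a bilinear product satisfying $xy=yx$ and $((xx)y)x=(xx)(yx)$ for all $x,y\in\mathcal{J}$. It is not assumed to be associative or to have an identity element. Isomorphism means isomorphism of $k$-algebras. Building blocks (the product is commutative, and all products of basis elements not determined by the listed ones and commutativity are zero). In a direct sum of algebras the basis elements of different summands multiply to zero, and repeated names of basis elements in different summands denote different elements. One-dimensional: $ke_i$ denotes the one-dimensional algebra with basis $e_i$ and $e_i^2=e_i$; $kn_i$ denotes the one-dimensional algebra with basis $n_i$ and $n_i^2=0$. Two-dimensional: $\mathcal{B}_1$, basis $e_1,n_1$: $e_1^2=e_1,\ e_1n_1=n_1$. $\mathcal{B}_2$, basis $e_1,n_1$: $e_1^2=e_1,\ e_1n_1=\frac12n_1$. $\mathcal{B}_3$, basis $n_1,n_2$: $n_1^2=n_2$. Three-dimensional: $\mathcal{T}_1$,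 basis $e_1,n_1,n_2$: $e_1^2=e_1,\ n_1^2=n_2,\ e_1n_1=n_1,\ e_1n_2=n_2$. $\mathcal{T}_2$, basis $e_1,n_1,n_2$: $e_1^2=e_1,\ e_1n_1=n_1,\ e_1n_2=n_2$. $\mathcal{T}_3$, basis $n_1,n_2,n_3$: $n_1^2=n_2,\ n_1n_2=n_3$. $\mathcal{T}_4$, basis $n_1,n_2,n_3$: $n_1^2=n_2,\ n_1n_3=n_2$. $\mathcal{T}_5$, basis $e_1,e_2,e_3$: $e_1^2=e_1,\ e_2^2=e_2,\ e_3^2=e_1+e_2,\ e_1e_3=\frac12e_3,\ e_2e_3=\frac12e_3$. $\mathcal{T}_6$, basis $e_1,n_1,n_2$: $e_1^2=e_1,\ e_1n_1=\frac12n_1,\ e_1n_2=n_2$. $\mathcal{T}_7$, basis $e_1,n_1,n_2$: $e_1^2=e_1,\ e_1n_1=\frac12n_1,\ e_1n_2=\frac12n_2$. $\mathcal{T}_8$, basis $e_1,n_1,n_2$: $e_1^2=e_1,\ n_1^2=n_2,\ e_1n_1=\frac12n_1$. $\mathcal{T}_9$, basis $e_1,n_1,n_2$: $e_1^2=e_1,\ n_1^2=n_2,\ e_1n_1=\frac12n_1,\ e_1n_2=n_2$. $\mathcal{T}_{10}$, basis $e_1,e_2,n_1$: $e_1^2=e_1,\ e_2^2=e_2,\ e_1n_1=\frac12n_1,\ e_2n_1=\frac12n_1$. The radical of a finite-dimensional Jordan algebra is its unique maximal nilpotent ideal; the group headings in the list indicate the dimension of the radical and are only organizational. *)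

(* Defs.v *)
From HB Require Import structures.
From mathcomp Require Import all_boot all_order all_algebra.

Set Implicit Arguments.
Unset Strict Implicit.
Unset Printing Implicit Defensive.

Import GRing.Theory.
Local Open Scope ring_scope.

Section Algebras.
Variable k : fieldType.

(* A finite-dimensional k-algebra; the product need be neither associative nor
   commutative nor unital. *)
Record algebra := Algebra {
  carrier :> vectType k;
  amul : {bilinear carrier -> carrier -> carrier} }.
Arguments amul {a}.

Definition adim (A : algebra) : nat := \dim {: A}.

Definition jordan (A : algebra) : Prop :=
  (forall x y : A, amul x y = amul y x) /\
  (forall x y : A,
     amul (amul (amul x x) y) x = amul (amul x x) (amul y x)).

Definition alg_iso (A B : algebra) : Prop :=
  exists f : {linear A -> B},
    bijective f /\ forall x y : A, f (amul x y) = amul (f x) (f y).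

Section DirectSum.
Variables A B : algebra.

Definition dsum_mul (x y : A * B) : A * B := (amul x.1 y.1, amul x.2 y.2).

Fact dsum_bilinear :
  bilinear_for (GRing.Scale.Law.clone k (A * B)%type *:%R _)
    (GRing.Scale.Law.clone k (A * B)%type *:%R _) dsum_mul.
Proof.
split=> [u' a u v|u a v w]; congr pair.
- exact: linearPl.
- exact: linearPl.
- exact: linearPr.
- exact: linearPr.
Qed.

HB.instance Definition _ :=
  bilinear_isBilinear.Build k (A * B)%type (A * B)%type (A * B)%type
    *:%R *:%R dsum_mul dsum_bilinear.

Definition dsum : algebra := @Algebra (A * B)%type dsum_mul.

End DirectSum.

(* Formal names of basis vectors: (false, i) stands for e_i and (true, i) for
   n_i. *)
Definition name : eqType := (bool * nat)%type.

Definition lincomb : Type := seq (k * name).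

Definition once (x : name) : lincomb := [:: (1, x)].
Definition halved (x : name) : lincomb := [:: (2^-1, x)].

(* ((x, y), v) records the two products xy = yx = v. *)
Definition entry : Type := (name * name * lincomb)%type.

Fixpoint lookup (t : seq entry) (x y : name) : lincomb :=
  if t is (p, v) :: t' then
    if (p == (x, y)) || (p == (y, x)) then v else lookup t' x y
  else [::].

Section Table.
Variables (b : seq name) (t : seq entry).

(* The i-th unit vector of k^(size b) is the basis vector named b_i. *)
Definition eval (v : lincomb) : 'rV[k]_(size b) :=
  \row_(l < size b) \sum_(q <- v | q.2 == tnth (in_tuple b) l) q.1.

Definition table_mul (x y : 'rV[k]_(size b)) : 'rV[k]_(size b) :=
  \sum_(i < size b) \sum_(j < size b)
    (x 0 i * y 0 j) *:
      eval (lookup t (tnth (in_tuple b) i) (tnth (in_tuple b) j)).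

Fact table_bilinear :
  bilinear_for (GRing.Scale.Law.clone k 'rV[k]_(size b) *:%R _)
    (GRing.Scale.Law.clone k 'rV[k]_(size b) *:%R _) table_mul.
Proof.
split=> [u' a u v|u a v w]; rewrite /table_mul /= scaler_sumr -big_split /=;
  apply: eq_bigr => i _; rewrite scaler_sumr -big_split /=;
  apply: eq_bigr => j _; rewrite scalerA -scalerDl !mxE; congr (_ *: _).
- by rewrite mulrDl mulrA.
- by rewrite mulrDr mulrCA.
Qed.

HB.instance Definition _ :=
  bilinear_isBilinear.Build k 'rV[k]_(size b) 'rV[k]_(size b) 'rV[k]_(size b)
    *:%R *:%R table_mul table_bilinear.

Definition table : algebra := @Algebra 'rV[k]_(size b) table_mul.

End Table.
End Algebras.

Section List.
Variable k : fieldType.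

Local Notation table := (@table k).
Local Notation once := (@once k).
Local Notation halved := (@halved k).
Local Notation "A (+) B" := (dsum A B) (at level 50, left associativity).
Local Notation "x ** y ~> v" := (x, y, v)
  (at level 70, y at next level, v at level 69).

Local Notation e1 := (false, 1%N).
Local Notation e2 := (false, 2%N).
Local Notation e3 := (false, 3%N).
Local Notation e4 := (false, 4%N).
Local Notation n1 := (true, 1%N).
Local Notation n2 := (true, 2%N).
Local Notation n3 := (true, 3%N).
Local Notation n4 := (true, 4%N).

Definition kE := table [:: e1]
  [:: e1 ** e1 ~> once e1].
Definition kN := table [:: n1]
  [::].

Definition B1 := table [:: e1; n1]
  [:: e1 ** e1 ~> once e1; e1 ** n1 ~> once n1].
Definition B2 := table [:: e1; n1]
  [:: e1 ** e1 ~> once e1; e1 ** n1 ~> halved n1].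
Definition B3 := table [:: n1; n2]
  [:: n1 ** n1 ~> once n2].

Definition T1 := table [:: e1; n1; n2]
  [:: e1 ** e1 ~> once e1; n1 ** n1 ~> once n2; e1 ** n1 ~> once n1;
      e1 ** n2 ~> once n2].
Definition T2 := table [:: e1; n1; n2]
  [:: e1 ** e1 ~> once e1; e1 ** n1 ~> once n1; e1 ** n2 ~> once n2].
Definition T3 := table [:: n1; n2; n3]
  [:: n1 ** n1 ~> once n2; n1 ** n2 ~> once n3].
Definition T4 := table [:: n1; n2; n3]
  [:: n1 ** n1 ~> once n2; n1 ** n3 ~> once n2].
Definition T5 := table [:: e1; e2; e3]
  [:: e1 ** e1 ~> once e1; e2 ** e2 ~> once e2;
      e3 ** e3 ~> [:: (1, e1); (1, e2)]; e1 ** e3 ~> halved e3;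
      e2 ** e3 ~> halved e3].
Definition T6 := table [:: e1; n1; n2]
  [:: e1 ** e1 ~> once e1; e1 ** n1 ~> halved n1; e1 ** n2 ~> once n2].
Definition T7 := table [:: e1; n1; n2]
  [:: e1 ** e1 ~> once e1; e1 ** n1 ~> halved n1; e1 ** n2 ~> halved n2].
Definition T8 := table [:: e1; n1; n2]
  [:: e1 ** e1 ~> once e1; n1 ** n1 ~> once n2; e1 ** n1 ~> halved n1].
Definition T9 := table [:: e1; n1; n2]
  [:: e1 ** e1 ~> once e1; n1 ** n1 ~> once n2; e1 ** n1 ~> halved n1;
      e1 ** n2 ~> once n2].
Definition T10 := table [:: e1; e2; n1]
  [:: e1 ** e1 ~> once e1; e2 ** e2 ~> once e2; e1 ** n1 ~> halved n1;
      e2 ** n1 ~> halved n1].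

Definition J1 := T5 (+) kE.
Definition J2 := table [:: e1; e2; e3; e4]
  [:: e1 ** e1 ~> once e1; e2 ** e2 ~> once e2; e1 ** e3 ~> halved e3;
      e1 ** e4 ~> halved e4; e2 ** e3 ~> halved e3; e2 ** e4 ~> halved e4;
      e3 ** e4 ~> [:: (2^-1, e1); (2^-1, e2)]].
Definition J3 := kE (+) kE (+) kE (+) kE.

Definition J4 := B1 (+) kE (+) kE.
Definition J5 := kE (+) kE (+) kE (+) kN.
Definition J6 := B2 (+) kE (+) kE.
Definition J7 := T10 (+) kE.
Definition J8 := T5 (+) kN.
Definition J9 := table [:: e1; e2; e3; n1]
  [:: e1 ** e1 ~> once e1; e2 ** e2 ~> once e2;
      e3 ** e3 ~> [:: (1, e1); (1, e2)]; e1 ** e3 ~> halved e3;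
      e1 ** n1 ~> halved n1; e2 ** e3 ~> halved e3; e2 ** n1 ~> halved n1].

Definition J10 := B2 (+) kE (+) kN.
Definition J11 := T10 (+) kN.
Definition J12 := T7 (+) kE.
Definition J13 := B2 (+) B2.
Definition J14 := T6 (+) kE.
Definition J15 := B2 (+) B1.
Definition J16 := table [:: e1; e2; n1; n2]
  [:: e1 ** e1 ~> once e1; e2 ** e2 ~> once e2; e1 ** n1 ~> halved n1;
      e1 ** n2 ~> halved n2; e2 ** n1 ~> halved n1].
Definition J17 := table [:: e1; e2; n1; n2]
  [:: e1 ** e1 ~> once e1; e2 ** e2 ~> once e2; e1 ** n1 ~> halved n1;
      e1 ** n2 ~> once n2; e2 ** n1 ~> halved n1].
Definition J18 := table [:: e1; e2; n1; n2]
  [:: e1 ** e1 ~> once e1; e2 ** e2 ~> once e2; e1 ** n1 ~> halved n1;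
      e1 ** n2 ~> halved n2; e2 ** n1 ~> halved n1; e2 ** n2 ~> halved n2].
Definition J19 := kE (+) kN (+) kE (+) kN.
Definition J20 := B1 (+) kE (+) kN.
Definition J21 := T2 (+) kE.
Definition J22 := B1 (+) B1.
Definition J23 := T8 (+) kE.
Definition J24 := T9 (+) kE.
Definition J25 := table [:: e1; e2; n1; n2]
  [:: e1 ** e1 ~> once e1; e2 ** e2 ~> once e2; e1 ** n2 ~> once n2;
      e1 ** n1 ~> halved n1; e2 ** n1 ~> halved n1; n1 ** n1 ~> once n2].
Definition J26 := B3 (+) kE (+) kE.
Definition J27 := T1 (+) kE.

Definition J28 := B2 (+) kN (+) kN.
Definition J29 := T6 (+) kN.
Definition J30 := T7 (+) kN.
Definition J31 := table [:: e1; n1; n2; n3]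
  [:: e1 ** e1 ~> once e1; e1 ** n1 ~> once n1; e1 ** n2 ~> once n2;
      e1 ** n3 ~> halved n3].
Definition J32 := table [:: e1; n1; n2; n3]
  [:: e1 ** e1 ~> once e1; e1 ** n1 ~> halved n1; e1 ** n2 ~> halved n2;
      e1 ** n3 ~> once n3].
Definition J33 := table [:: e1; n1; n2; n3]
  [:: e1 ** e1 ~> once e1; e1 ** n1 ~> halved n1; e1 ** n2 ~> halved n2;
      e1 ** n3 ~> halved n3].
Definition J34 := kE (+) kN (+) kN (+) kN.
Definition J35 := B1 (+) kN (+) kN.
Definition J36 := table [:: e1; n1; n2; n3]
  [:: e1 ** e1 ~> once e1; e1 ** n1 ~> once n1; e1 ** n2 ~> once n2;
      e1 ** n3 ~> once n3].
Definition J37 := T2 (+) kN.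
Definition J38 := T3 (+) kE.
Definition J39 := table [:: e1; n1; n2; n3]
  [:: e1 ** e1 ~> once e1; n1 ** n1 ~> once n2; e1 ** n1 ~> once n1;
      e1 ** n2 ~> once n2; e1 ** n3 ~> once n3; n1 ** n2 ~> once n3].
Definition J40 := B3 (+) kE (+) kN.
Definition J41 := T4 (+) kE.
Definition J42 := table [:: e1; n1; n2; n3]
  [:: e1 ** e1 ~> once e1; n1 ** n1 ~> once n2; e1 ** n1 ~> once n1;
      e1 ** n2 ~> once n2; e1 ** n3 ~> once n3].
Definition J43 := table [:: e1; n1; n2; n3]
  [:: e1 ** e1 ~> once e1; n1 ** n1 ~> once n2; e1 ** n1 ~> once n1;
      e1 ** n2 ~> once n2; e1 ** n3 ~> once n3; n1 ** n3 ~> once n2].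
Definition J44 := T8 (+) kN.
Definition J45 := table [:: e1; n1; n2; n3]
  [:: e1 ** e1 ~> once e1; n1 ** n1 ~> once n2; n3 ** n3 ~> once n2;
      e1 ** n1 ~> halved n1].
Definition J46 := B2 (+) B3.
Definition J47 := B1 (+) B3.
Definition J48 := table [:: e1; n1; n2; n3]
  [:: e1 ** e1 ~> once e1; n3 ** n3 ~> once n1; e1 ** n2 ~> halved n2;
      e1 ** n3 ~> halved n3].
Definition J49 := table [:: e1; n1; n2; n3]
  [:: e1 ** e1 ~> once e1; n3 ** n3 ~> once n1; e1 ** n2 ~> halved n2;
      e1 ** n3 ~> halved n3; n2 ** n3 ~> once n1].
Definition J50 := table [:: e1; n1; n2; n3]
  [:: e1 ** e1 ~> once e1; e1 ** n2 ~> halved n2; e1 ** n3 ~> halved n3;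
      n1 ** n2 ~> once n3].
Definition J51 := T9 (+) kN.
Definition J52 := table [:: e1; n1; n2; n3]
  [:: e1 ** e1 ~> once e1; n1 ** n1 ~> once n3; e1 ** n2 ~> once n2;
      e1 ** n1 ~> halved n1].
Definition J53 := table [:: e1; n1; n2; n3]
  [:: e1 ** e1 ~> once e1; n1 ** n1 ~> [:: (1, n3); (1, n2)];
      e1 ** n2 ~> once n2; e1 ** n1 ~> halved n1].
Definition J54 := T1 (+) kN.
Definition J55 := table [:: e1; n1; n2; n3]
  [:: e1 ** e1 ~> once e1; n3 ** n3 ~> once n2; e1 ** n1 ~> once n1;
      e1 ** n2 ~> once n2; e1 ** n3 ~> halved n3].
Definition J56 := table [:: e1; n1; n2; n3]
  [:: e1 ** e1 ~> once e1; n1 ** n1 ~> once n2; e1 ** n1 ~> once n1;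
      e1 ** n2 ~> once n2; e1 ** n3 ~> halved n3].
Definition J57 := table [:: e1; n1; n2; n3]
  [:: e1 ** e1 ~> once e1; n1 ** n1 ~> once n2; n3 ** n3 ~> once n2;
      e1 ** n1 ~> once n1; e1 ** n2 ~> once n2; e1 ** n3 ~> halved n3].
Definition J58 := table [:: e1; n1; n2; n3]
  [:: e1 ** e1 ~> once e1; n3 ** n3 ~> once n1; e1 ** n1 ~> once n1;
      e1 ** n2 ~> halved n2; e1 ** n3 ~> halved n3].
Definition J59 := table [:: e1; n1; n2; n3]
  [:: e1 ** e1 ~> once e1; n3 ** n3 ~> once n1; e1 ** n1 ~> once n1;
      e1 ** n2 ~> halved n2; e1 ** n3 ~> halved n3; n2 ** n3 ~> once n1].
Definition J60 := table [:: e1; n1; n2; n3]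
  [:: e1 ** e1 ~> once e1; e1 ** n1 ~> once n1; e1 ** n2 ~> halved n2;
      e1 ** n3 ~> halved n3; n1 ** n2 ~> once n3].

Definition J61 := table [:: n1; n2; n3; n4]
  [:: n1 ** n1 ~> once n2; n2 ** n2 ~> once n4; n1 ** n2 ~> once n3;
      n1 ** n3 ~> once n4].
Definition J62 := table [:: n1; n2; n3; n4]
  [:: n1 ** n1 ~> once n2; n4 ** n4 ~> once n2; n1 ** n2 ~> once n3].
Definition J63 := table [:: n1; n2; n3; n4]
  [:: n1 ** n1 ~> once n2; n4 ** n4 ~> [:: (-1, n2); (-1, n3)];
      n1 ** n2 ~> once n3; n2 ** n4 ~> once n3].
Definition J64 := table [:: n1; n2; n3; n4]
  [:: n1 ** n1 ~> once n2; n4 ** n4 ~> [:: (-1, n2)]; n1 ** n2 ~> once n3;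
      n2 ** n4 ~> once n3].
Definition J65 := table [:: n1; n2; n3; n4]
  [:: n1 ** n1 ~> once n2; n1 ** n2 ~> once n3; n2 ** n4 ~> once n3].
Definition J66 := table [:: n1; n2; n3; n4]
  [:: n1 ** n1 ~> once n2; n4 ** n4 ~> once n3; n1 ** n2 ~> once n3].
Definition J67 := T3 (+) kN.
Definition J68 := B3 (+) B3.
Definition J69 := table [:: n1; n2; n3; n4]
  [:: n1 ** n1 ~> once n2; n1 ** n3 ~> once n4].
Definition J70 := table [:: n1; n2; n3; n4]
  [:: n1 ** n1 ~> once n2; n3 ** n4 ~> once n2].
Definition J71 := T4 (+) kN.
Definition J72 := B3 (+) kN (+) kN.
Definition J73 := kN (+) kN (+) kN (+) kN.

Definition Jlist : seq (algebra k) :=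
  [:: J1; J2; J3; J4; J5; J6; J7; J8; J9;
      J10; J11; J12; J13; J14; J15; J16; J17; J18;
      J19; J20; J21; J22; J23; J24; J25; J26; J27;
      J28; J29; J30; J31; J32; J33; J34; J35; J36;
      J37; J38; J39; J40; J41; J42; J43; J44; J45;
      J46; J47; J48; J49; J50; J51; J52; J53; J54;
      J55; J56; J57; J58; J59; J60; J61; J62; J63;
      J64; J65; J66; J67; J68; J69; J70; J71; J72;
      J73].

Fact size_Jlist : size Jlist = 73.
Proof. by []. Qed.

(* [J i] is J_(i+1), since ordinals start at 0. *)
Definition J (i : 'I_73) : algebra k := nth J1 Jlist i.

End List.

(* Main.v *)
(** Two of the algebras are told apart by the dimension of the space of linear
    maps [F] with [a F(x y) + b F(x) y + c x F(y) = 0], for suitable integers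
    [a], [b], [c]. It is the nullity of a linear system over the integers; the
    elimination divides by powers of 2 and 3 only and is done separately in
    characteristic 3. The six pairs for which these dimensions may agree differ in
    the maps [F] that vanish on associators or in the existence of an element
    of a given nilpotency index.

    For the classification, take a maximal family of orthogonal idempotents [e_i]
    and complete it to a basis of common eigenvectors of the multiplications by
    the [e_i]. By maximality and power-associativity, each Peirce space [A_ii] is
    [k e_i] plus nilpotent elements, and the elements of [A_00] are nilpotent.
    An element nilpotent enough acts without nonzero eigenvalues, which replaces
    Engel's theorem and gives the few possible products on [A_ii], on [A_00],
    and on the whole algebra when there is no idempotent. The Peirce rules and
    [b (b h) = b^2 h / 2] for [b] in [A_ii] or [A_00] and [h] in a half-space
    leave families of tables with a few parameters, which are brought to normal
    form by explicit changes of basis. *)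

From Stdlib Require Import BinInt Classical.
Require Import Defs.
From HB Require Import structures.
From mathcomp Require Import all_boot all_order all_algebra.
From mathcomp Require Import ring zify ssrZ.

Set Implicit Arguments.
Unset Strict Implicit.
Unset Printing Implicit Defensive.

Import GRing.Theory.
Local Open Scope ring_scope.

(** * Structure constants *)

(** Neither the radical nor a Wedderburn splitting is used: nilpotency enters only through powers
    and Peirce spaces. Two obstacles shape the arguments. The first is characteristic 3, where
    factors 3 and 6 cannot be cancelled. Linearizations therefore take the odd part in one variable,
    which costs only a division by 2, and the eigenvalue argument for nilpotent elements is arranged
    so that its last coefficient is a power of 2. The second is the missing unit: polynomials in an
    element are applied to a vector instead of being evaluated, and A_ii and A_00 are treated
    together as subalgebras whose unit may be zero. The tables contain halves; doubling the product
    makes them integral, so that one computation over the integers serves all fields in which its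
    pivots are nonzero. Algebraic closedness gives the eigenvalue that is subtracted to make an
    element of A_ii nilpotent, and the roots that normalize the quadratic forms to which most
    families of tables reduce. *)

Section StructureConstants.
Variable k : fieldType.
Implicit Types A B : algebra k.
Local Notation amul := (@amul k _).

Definition has_constants A n (c : nat -> nat -> nat -> k) : Prop :=
  exists2 b : n.-tuple A, basis_of fullv b &
    forall i j : 'I_n, amul b`_i b`_j = \sum_(l < n) c i j l *: b`_l.

Lemma has_constants_dim A n c : has_constants A n c -> adim A = n.
Proof. by case=> b bB _; rewrite /adim (size_basis bB). Qed.

Lemma eq_has_constants A n c c' :
  (forall i j l, (i < n)%N -> (j < n)%N -> (l < n)%N -> c i j l = c' i j l) ->
  has_constants A n c -> has_constants A n c'.
Proof.
move=> e [b bB bM]; exists b => // i j; rewrite bM.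
by apply: eq_bigr => l _; rewrite e.
Qed.

Section BasisMap.
Variables (U V : vectType k) (n : nat) (u : n.-tuple U) (v : n.-tuple V).

Definition basis_map (x : U) : V := \sum_i coord u i x *: v`_i.

Fact basis_map_linear : linear basis_map.
Proof.
move=> a x y; rewrite /basis_map scaler_sumr -big_split.
by apply: eq_bigr => i _ /=; rewrite linearP scalerDl scalerA.
Qed.

HB.instance Definition _ :=
  GRing.isLinear.Build k U V *:%R basis_map basis_map_linear.

Lemma basis_map_lincomb (a : 'I_n -> k) : free u ->
  basis_map (\sum_i a i *: u`_i) = \sum_i a i *: v`_i.
Proof. by move=> fu; apply: eq_bigr => i _; rewrite coord_sum_free. Qed.

End BasisMap.

Lemma basis_mapK (U V : vectType k) n (u : n.-tuple U) (v : n.-tuple V) :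
  basis_of fullv u -> free v -> cancel (basis_map u v) (basis_map v u).
Proof.
move=> uB fv x; rewrite {2}(coord_basis uB (memvf x)) /basis_map.
by apply: eq_bigr => i _; rewrite coord_sum_free.
Qed.

Lemma amul_lincomb A n m (a : 'I_n -> k) (b : 'I_m -> k) (u : 'I_n -> A)
    (v : 'I_m -> A) :
  amul (\sum_i a i *: u i) (\sum_j b j *: v j) =
    \sum_i \sum_j (a i * b j) *: amul (u i) (v j).
Proof.
rewrite linear_sumlz; apply: eq_bigr => i _.
rewrite linear_sumr; apply: eq_bigr => j _.
by rewrite linearZr_LR linearZl_LR scalerA mulrC.
Qed.

Lemma alg_iso_of_constants A B n c :
  has_constants A n c -> has_constants B n c -> alg_iso A B.
Proof.
move=> [b bB bM] [d dB dM]; have fb := basis_free bB; have fd := basis_free dB.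
exists (basis_map b d : {linear A -> B}); split.
  by exists (basis_map d b); apply: basis_mapK.
move=> x y; rewrite {1}(coord_basis bB (memvf x)) {1}(coord_basis bB (memvf y)).
pose f : {linear A -> B} := basis_map b d.
rewrite amul_lincomb -/f [RHS]amul_lincomb [LHS]linear_sum.
apply: eq_bigr => i _; rewrite [LHS]linear_sum; apply: eq_bigr => j _.
by rewrite [LHS]linearZ bM dM /f /= basis_map_lincomb.
Qed.

(** A name for the addition of [k] that [lazy] can be told to leave alone while the tables are
    reduced. *)
Definition kadd (x y : k) : k := x + y.

(** The zero is an argument so that it can be rewritten before the recursion is reduced. *)
Fixpoint coef_at (zero : k) (v : lincomb k) (x : name) : k :=
  if v is (a, y) :: v' then
    if y == x then kadd a (coef_at zero v' x) else coef_at zero v' x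
  else zero.

Lemma coef_atE v x : coef_at 0 v x = \sum_(q <- v | q.2 == x) q.1.
Proof. by elim: v => [|[a y] v IH] /=; rewrite ?big_nil // big_cons /= IH. Qed.

Definition table_constants (b : seq name) (t : seq (entry k)) i j l : k :=
  coef_at 0 (lookup t (nth (false, 0%N) b i) (nth (false, 0%N) b j))
    (nth (false, 0%N) b l).

Lemma table_has_constants b t :
  has_constants (table b t) (size b) (table_constants b t).
Proof.
pose d : (size b).-tuple 'rV[k]_(size b) :=
  [tuple delta_mx 0 i | i < size b].
have dE (i : 'I_(size b)) : d`_i = delta_mx 0 i.
  by rewrite (nth_mktuple _ _ i).
have dfree : free d.
  apply/freeP => c /rowP c0 i; move: (c0 i).
  rewrite summxE (bigD1 i) //= dE !mxE !eqxx mulr1 big1 ?addr0 //.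
  by move=> j ji; rewrite dE !mxE eqxx [i == j]eq_sym (negPf ji) mulr0.
exists d.
  by rewrite basisEfree dfree subvf size_tuple dimvf /dim /= mul1n.
have row_d (v : 'rV[k]_(size b)) : v = \sum_l v 0 l *: d`_l.
  by rewrite [LHS]row_sum_delta; apply: eq_bigr => l _; rewrite dE.
move=> i j; rewrite !dE [LHS]row_d; apply: eq_bigr => l _; congr (_ *: _).
rewrite /amul /= /table_mul summxE (bigD1 i) //= [X in _ + X]big1 => [|i' ii].
  rewrite addr0 summxE (bigD1 j) //= [X in _ + X]big1 => [|j' jj].
    rewrite !mxE !eqxx mulr1 mul1r addr0 -coef_atE /table_constants.
    by rewrite !(tnth_nth (false, 0%N)).
  by rewrite !mxE !eqxx (negPf jj) mulr0 mul0r.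
rewrite summxE big1 // => j' _.
by rewrite !mxE !eqxx (negPf ii) !mul0r.
Qed.

Definition dsum_constants n (zero : k) (c c' : nat -> nat -> nat -> k) i j l : k :=
  if (i < n)%N then
    if (j < n)%N && (l < n)%N then c i j l else 0
  else if (n <= j)%N && (n <= l)%N then c' (i - n)%N (j - n)%N (l - n)%N
  else zero.

Lemma dsum_has_constants A B n m c c' :
  has_constants A n c -> has_constants B m c' ->
  has_constants (dsum A B) (n + m) (dsum_constants n 0 c c').
Proof.
move=> [b bB bM] [d dB dM].
pose h : (n + m).-tuple (A * B)%type :=
  [tuple of [seq (x, 0) | x <- b] ++ [seq (0, y) | y <- d]].
have hl (i : 'I_n) : h`_(lshift m i) = (b`_i, 0).
  by rewrite nth_cat size_map size_tuple /= ltn_ord (nth_map 0) ?size_tuple.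
have hr (i : 'I_m) : h`_(rshift n i) = (0, d`_i).
  rewrite nth_cat size_map size_tuple /= ltnNge leq_addr /= addKn.
  by rewrite (nth_map 0) ?size_tuple.
have hsum (a : 'I_(n + m) -> k) : \sum_i a i *: h`_i =
    (\sum_i a (lshift m i) *: b`_i, \sum_i a (rshift n i) *: d`_i).
  rewrite big_split_ord /=.
  under eq_bigr do rewrite hl; under [X in _ + X]eq_bigr do rewrite hr.
  apply/eqP; rewrite -pair_eqE /= !(raddf_sum fst) !(raddf_sum snd) /=.
  rewrite [\sum_i a (rshift n i) *: 0]big1 => [|i _]; last by rewrite scaler0.
  rewrite [\sum_i a (lshift m i) *: 0]big1 => [|i _]; last by rewrite scaler0.
  by rewrite addr0 add0r !eqxx.
have hfree : free h.
  apply/freeP => a; rewrite hsum => -[/eqP ea /eqP eb] i.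
  case: (split_ordP i) => j ->.
    by move/freeP: (basis_free bB) => /(_ (fun i => a (lshift m i))); apply; apply/eqP.
  by move/freeP: (basis_free dB) => /(_ (fun i => a (rshift n i))); apply; apply/eqP.
exists h.
  rewrite basisEfree hfree subvf size_tuple dimvf /dim /=.
  by rewrite -(size_basis bB) -(size_basis dB) !dimvf.
move=> i j; rewrite (hsum (fun l => dsum_constants n 0 c c' i j l)).
have ge x : (n + x < n)%N = false by lia.
have nle (l : 'I_n) : (n <= l)%N = false by rewrite leqNgt ltn_ord.
rewrite /amul /= /dsum_mul /dsum_constants.
case: (split_ordP i) => i' ->; case: (split_ordP j) => j' ->;
  rewrite ?hl ?hr /= ?linear0l ?linear0r ?bM ?dM; congr pair;
  (apply: eq_bigr => l _ || (symmetry; apply: big1 => l _));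
  by rewrite ?ltn_ord ?ge ?nle ?leq_addr /= ?addKn ?andbF ?scale0r.
Qed.

End StructureConstants.

(** * The tables of the 73 algebras *)

Definition vec4 (a b c d : Z) : seq Z := [:: a; b; c; d].

(* Tables of a commutative product on a 4-dimensional space. The entry
   [(i, j, v)] lists the coordinates [v] of TWICE the product of the basis
   vectors i and j, which makes all the coefficients integral. *)
Definition ztable := seq (nat * nat * seq Z).

Fixpoint zproduct (t : ztable) (i j : nat) : seq Z :=
  if t is (p, v) :: t' then
    if (p == (i, j)) || (p == (j, i)) then v else zproduct t' i j
  else [::].

Definition zcoef (t : ztable) (i j l : nat) : Z := nth Z0 (zproduct t i j) l.

(** The bases are the listed ones, concatenated along direct sums. [J_has_constants] checks the
    tables against the definitions of the algebras. *)
Definition Jtables : seq ztable := [::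
  [:: (0,0,vec4 2 0 0 0); (0,2,vec4 0 0 1 0); (1,1,vec4 0 2 0 0);
      (1,2,vec4 0 0 1 0); (2,2,vec4 2 2 0 0); (3,3,vec4 0 0 0 2)];
  [:: (0,0,vec4 2 0 0 0); (0,2,vec4 0 0 1 0); (0,3,vec4 0 0 0 1);
      (1,1,vec4 0 2 0 0); (1,2,vec4 0 0 1 0); (1,3,vec4 0 0 0 1);
      (2,3,vec4 1 1 0 0)];
  [:: (0,0,vec4 2 0 0 0); (1,1,vec4 0 2 0 0); (2,2,vec4 0 0 2 0);
      (3,3,vec4 0 0 0 2)];
  [:: (0,0,vec4 2 0 0 0); (0,1,vec4 0 2 0 0); (2,2,vec4 0 0 2 0);
      (3,3,vec4 0 0 0 2)];
  [:: (0,0,vec4 2 0 0 0); (1,1,vec4 0 2 0 0); (2,2,vec4 0 0 2 0)];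
  [:: (0,0,vec4 2 0 0 0); (0,1,vec4 0 1 0 0); (2,2,vec4 0 0 2 0);
      (3,3,vec4 0 0 0 2)];
  [:: (0,0,vec4 2 0 0 0); (0,2,vec4 0 0 1 0); (1,1,vec4 0 2 0 0);
      (1,2,vec4 0 0 1 0); (3,3,vec4 0 0 0 2)];
  [:: (0,0,vec4 2 0 0 0); (0,2,vec4 0 0 1 0); (1,1,vec4 0 2 0 0);
      (1,2,vec4 0 0 1 0); (2,2,vec4 2 2 0 0)];
  [:: (0,0,vec4 2 0 0 0); (0,2,vec4 0 0 1 0); (0,3,vec4 0 0 0 1);
      (1,1,vec4 0 2 0 0); (1,2,vec4 0 0 1 0); (1,3,vec4 0 0 0 1);
      (2,2,vec4 2 2 0 0)];
  [:: (0,0,vec4 2 0 0 0); (0,1,vec4 0 1 0 0); (2,2,vec4 0 0 2 0)];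
  [:: (0,0,vec4 2 0 0 0); (0,2,vec4 0 0 1 0); (1,1,vec4 0 2 0 0);
      (1,2,vec4 0 0 1 0)];
  [:: (0,0,vec4 2 0 0 0); (0,1,vec4 0 1 0 0); (0,2,vec4 0 0 1 0);
      (3,3,vec4 0 0 0 2)];
  [:: (0,0,vec4 2 0 0 0); (0,1,vec4 0 1 0 0); (2,2,vec4 0 0 2 0);
      (2,3,vec4 0 0 0 1)];
  [:: (0,0,vec4 2 0 0 0); (0,1,vec4 0 1 0 0); (0,2,vec4 0 0 2 0);
      (3,3,vec4 0 0 0 2)];
  [:: (0,0,vec4 2 0 0 0); (0,1,vec4 0 1 0 0); (2,2,vec4 0 0 2 0);
      (2,3,vec4 0 0 0 2)];
  [:: (0,0,vec4 2 0 0 0); (0,2,vec4 0 0 1 0); (0,3,vec4 0 0 0 1);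
      (1,1,vec4 0 2 0 0); (1,2,vec4 0 0 1 0)];
  [:: (0,0,vec4 2 0 0 0); (0,2,vec4 0 0 1 0); (0,3,vec4 0 0 0 2);
      (1,1,vec4 0 2 0 0); (1,2,vec4 0 0 1 0)];
  [:: (0,0,vec4 2 0 0 0); (0,2,vec4 0 0 1 0); (0,3,vec4 0 0 0 1);
      (1,1,vec4 0 2 0 0); (1,2,vec4 0 0 1 0); (1,3,vec4 0 0 0 1)];
  [:: (0,0,vec4 2 0 0 0); (2,2,vec4 0 0 2 0)];
  [:: (0,0,vec4 2 0 0 0); (0,1,vec4 0 2 0 0); (2,2,vec4 0 0 2 0)];
  [:: (0,0,vec4 2 0 0 0); (0,1,vec4 0 2 0 0); (0,2,vec4 0 0 2 0);
      (3,3,vec4 0 0 0 2)];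
  [:: (0,0,vec4 2 0 0 0); (0,1,vec4 0 2 0 0); (2,2,vec4 0 0 2 0);
      (2,3,vec4 0 0 0 2)];
  [:: (0,0,vec4 2 0 0 0); (0,1,vec4 0 1 0 0); (1,1,vec4 0 0 2 0);
      (3,3,vec4 0 0 0 2)];
  [:: (0,0,vec4 2 0 0 0); (0,1,vec4 0 1 0 0); (0,2,vec4 0 0 2 0);
      (1,1,vec4 0 0 2 0); (3,3,vec4 0 0 0 2)];
  [:: (0,0,vec4 2 0 0 0); (0,2,vec4 0 0 1 0); (0,3,vec4 0 0 0 2);
      (1,1,vec4 0 2 0 0); (1,2,vec4 0 0 1 0); (2,2,vec4 0 0 0 2)];
  [:: (0,0,vec4 0 2 0 0); (2,2,vec4 0 0 2 0); (3,3,vec4 0 0 0 2)];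
  [:: (0,0,vec4 2 0 0 0); (0,1,vec4 0 2 0 0); (0,2,vec4 0 0 2 0);
      (1,1,vec4 0 0 2 0); (3,3,vec4 0 0 0 2)];
  [:: (0,0,vec4 2 0 0 0); (0,1,vec4 0 1 0 0)];
  [:: (0,0,vec4 2 0 0 0); (0,1,vec4 0 1 0 0); (0,2,vec4 0 0 2 0)];
  [:: (0,0,vec4 2 0 0 0); (0,1,vec4 0 1 0 0); (0,2,vec4 0 0 1 0)];
  [:: (0,0,vec4 2 0 0 0); (0,1,vec4 0 2 0 0); (0,2,vec4 0 0 2 0);
      (0,3,vec4 0 0 0 1)];
  [:: (0,0,vec4 2 0 0 0); (0,1,vec4 0 1 0 0); (0,2,vec4 0 0 1 0);
      (0,3,vec4 0 0 0 2)];
  [:: (0,0,vec4 2 0 0 0); (0,1,vec4 0 1 0 0); (0,2,vec4 0 0 1 0);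
      (0,3,vec4 0 0 0 1)];
  [:: (0,0,vec4 2 0 0 0)];
  [:: (0,0,vec4 2 0 0 0); (0,1,vec4 0 2 0 0)];
  [:: (0,0,vec4 2 0 0 0); (0,1,vec4 0 2 0 0); (0,2,vec4 0 0 2 0);
      (0,3,vec4 0 0 0 2)];
  [:: (0,0,vec4 2 0 0 0); (0,1,vec4 0 2 0 0); (0,2,vec4 0 0 2 0)];
  [:: (0,0,vec4 0 2 0 0); (0,1,vec4 0 0 2 0); (3,3,vec4 0 0 0 2)];
  [:: (0,0,vec4 2 0 0 0); (0,1,vec4 0 2 0 0); (0,2,vec4 0 0 2 0);
      (0,3,vec4 0 0 0 2); (1,1,vec4 0 0 2 0); (1,2,vec4 0 0 0 2)];
  [:: (0,0,vec4 0 2 0 0); (2,2,vec4 0 0 2 0)];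
  [:: (0,0,vec4 0 2 0 0); (0,2,vec4 0 2 0 0); (3,3,vec4 0 0 0 2)];
  [:: (0,0,vec4 2 0 0 0); (0,1,vec4 0 2 0 0); (0,2,vec4 0 0 2 0);
      (0,3,vec4 0 0 0 2); (1,1,vec4 0 0 2 0)];
  [:: (0,0,vec4 2 0 0 0); (0,1,vec4 0 2 0 0); (0,2,vec4 0 0 2 0);
      (0,3,vec4 0 0 0 2); (1,1,vec4 0 0 2 0); (1,3,vec4 0 0 2 0)];
  [:: (0,0,vec4 2 0 0 0); (0,1,vec4 0 1 0 0); (1,1,vec4 0 0 2 0)];
  [:: (0,0,vec4 2 0 0 0); (0,1,vec4 0 1 0 0); (1,1,vec4 0 0 2 0);
      (3,3,vec4 0 0 2 0)];
  [:: (0,0,vec4 2 0 0 0); (0,1,vec4 0 1 0 0); (2,2,vec4 0 0 0 2)];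
  [:: (0,0,vec4 2 0 0 0); (0,1,vec4 0 2 0 0); (2,2,vec4 0 0 0 2)];
  [:: (0,0,vec4 2 0 0 0); (0,2,vec4 0 0 1 0); (0,3,vec4 0 0 0 1);
      (3,3,vec4 0 2 0 0)];
  [:: (0,0,vec4 2 0 0 0); (0,2,vec4 0 0 1 0); (0,3,vec4 0 0 0 1);
      (2,3,vec4 0 2 0 0); (3,3,vec4 0 2 0 0)];
  [:: (0,0,vec4 2 0 0 0); (0,2,vec4 0 0 1 0); (0,3,vec4 0 0 0 1);
      (1,2,vec4 0 0 0 2)];
  [:: (0,0,vec4 2 0 0 0); (0,1,vec4 0 1 0 0); (0,2,vec4 0 0 2 0);
      (1,1,vec4 0 0 2 0)];
  [:: (0,0,vec4 2 0 0 0); (0,1,vec4 0 1 0 0); (0,2,vec4 0 0 2 0);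
      (1,1,vec4 0 0 0 2)];
  [:: (0,0,vec4 2 0 0 0); (0,1,vec4 0 1 0 0); (0,2,vec4 0 0 2 0);
      (1,1,vec4 0 0 2 2)];
  [:: (0,0,vec4 2 0 0 0); (0,1,vec4 0 2 0 0); (0,2,vec4 0 0 2 0);
      (1,1,vec4 0 0 2 0)];
  [:: (0,0,vec4 2 0 0 0); (0,1,vec4 0 2 0 0); (0,2,vec4 0 0 2 0);
      (0,3,vec4 0 0 0 1); (3,3,vec4 0 0 2 0)];
  [:: (0,0,vec4 2 0 0 0); (0,1,vec4 0 2 0 0); (0,2,vec4 0 0 2 0);
      (0,3,vec4 0 0 0 1); (1,1,vec4 0 0 2 0)];
  [:: (0,0,vec4 2 0 0 0); (0,1,vec4 0 2 0 0); (0,2,vec4 0 0 2 0);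
      (0,3,vec4 0 0 0 1); (1,1,vec4 0 0 2 0); (3,3,vec4 0 0 2 0)];
  [:: (0,0,vec4 2 0 0 0); (0,1,vec4 0 2 0 0); (0,2,vec4 0 0 1 0);
      (0,3,vec4 0 0 0 1); (3,3,vec4 0 2 0 0)];
  [:: (0,0,vec4 2 0 0 0); (0,1,vec4 0 2 0 0); (0,2,vec4 0 0 1 0);
      (0,3,vec4 0 0 0 1); (2,3,vec4 0 2 0 0); (3,3,vec4 0 2 0 0)];
  [:: (0,0,vec4 2 0 0 0); (0,1,vec4 0 2 0 0); (0,2,vec4 0 0 1 0);
      (0,3,vec4 0 0 0 1); (1,2,vec4 0 0 0 2)];
  [:: (0,0,vec4 0 2 0 0); (0,1,vec4 0 0 2 0); (0,2,vec4 0 0 0 2);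
      (1,1,vec4 0 0 0 2)];
  [:: (0,0,vec4 0 2 0 0); (0,1,vec4 0 0 2 0); (3,3,vec4 0 2 0 0)];
  [:: (0,0,vec4 0 2 0 0); (0,1,vec4 0 0 2 0); (1,3,vec4 0 0 2 0);
      (3,3,vec4 0 (-2) (-2) 0)];
  [:: (0,0,vec4 0 2 0 0); (0,1,vec4 0 0 2 0); (1,3,vec4 0 0 2 0);
      (3,3,vec4 0 (-2) 0 0)];
  [:: (0,0,vec4 0 2 0 0); (0,1,vec4 0 0 2 0); (1,3,vec4 0 0 2 0)];
  [:: (0,0,vec4 0 2 0 0); (0,1,vec4 0 0 2 0); (3,3,vec4 0 0 2 0)];
  [:: (0,0,vec4 0 2 0 0); (0,1,vec4 0 0 2 0)];
  [:: (0,0,vec4 0 2 0 0); (2,2,vec4 0 0 0 2)];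
  [:: (0,0,vec4 0 2 0 0); (0,2,vec4 0 0 0 2)];
  [:: (0,0,vec4 0 2 0 0); (2,3,vec4 0 2 0 0)];
  [:: (0,0,vec4 0 2 0 0); (0,2,vec4 0 2 0 0)];
  [:: (0,0,vec4 0 2 0 0)];
  [::]].

Section Half.
Variable k : fieldType.

(** Integers are taken in [Z], whose binary arithmetic makes the eliminations feasible by
    [vm_compute]. *)
Definition zr (z : Z) : k := (int_of_Z z)%:~R.

Lemma zr1 : zr (Zpos xH) = 1. Proof. by []. Qed.
Lemma zrN1 : zr (Zneg xH) = -1. Proof. by []. Qed.
Lemma zrD x y : zr (Z.add x y) = zr x + zr y.
Proof. by rewrite /zr (rmorphD int_of_Z) rmorphD. Qed.
Lemma zrN x : zr (Z.opp x) = - zr x.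
Proof. by rewrite /zr (rmorphN int_of_Z) rmorphN. Qed.
Lemma zrM x y : zr (Z.mul x y) = zr x * zr y.
Proof. by rewrite /zr (rmorphM int_of_Z) rmorphM. Qed.

Hypothesis two_neq0 : (2 : k) != 0.

(** The values that occur in the tables are matched separately, so that they are convertible to the
    scalars 0, 1/2, 1 and -1 as written in the definitions. *)
Definition half_of (z : Z) : k :=
  match z with
  | Z0 => 0
  | Zpos xH => 2^-1
  | Zpos (xO xH) => 1
  | Zneg (xO xH) => -1
  | _ => zr z / 2
  end.

Lemma half_ofE z : half_of z = zr z / 2.
Proof.
by case: z => [|[p|[p|p|]|]|[p|[p|p|]|]] //=; rewrite /zr ?mul0r ?mul1r ?mulNr ?divff.
Qed.

Definition half_constants (t : ztable) i j l : k := half_of (zcoef t i j l).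

(** Turns the agreement of two families of constants into one equality between lists of 64 scalars,
    which reduction settles. *)
Lemma has_constants_tabulated (A : algebra k) n c c' :
  has_constants A n c -> n = 4%N ->
  [seq [seq [seq c i j l | l <- iota 0 4] | j <- iota 0 4] | i <- iota 0 4] =
  [seq [seq [seq c' i j l | l <- iota 0 4] | j <- iota 0 4] | i <- iota 0 4] ->
  has_constants A 4 c'.
Proof.
move=> + n4; rewrite {}n4 => cA e; apply: eq_has_constants cA => i j l i4 j4 l4.
have /(congr1 (fun s => nth 0 (nth [::] (nth [::] s i) j) l)) := e.
by rewrite !(nth_map 0%N) ?size_map ?size_iota // !nth_iota.
Qed.

Ltac constants_of_J :=
  lazymatch goal with
  | |- has_constants (dsum _ _) _ _ =>
      apply: dsum_has_constants; constants_of_J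
  | |- has_constants (table _ _) _ _ => exact: table_has_constants
  | |- has_constants ?A _ _ =>
      let B := eval red in A in change A with B; constants_of_J
  end.

Lemma kadd_half0 x : kadd x (half_of Z0) = x.
Proof. exact: addr0. Qed.

Lemma once_half x : once k x = [:: (half_of (Zpos (xO xH)), x)].
Proof. by []. Qed.

Lemma halved_half x : halved k x = [:: (half_of (Zpos xH), x)].
Proof. by []. Qed.

Lemma zero_half : 0 = half_of Z0. Proof. by []. Qed.
Lemma half_half : 2^-1 = half_of (Zpos xH). Proof. by []. Qed.
Lemma one_half : 1 = half_of (Zpos (xO xH)). Proof. by []. Qed.
Lemma minus1_half : -1 = half_of (Zneg (xO xH)). Proof. by []. Qed.

(* Every scalar is first rewritten as a value of [half_of], so that the
   comparison of the tables never unfolds the operations of [k]. *)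
Ltac compare_tables :=
  rewrite ?once_half ?halved_half /table_constants;
  rewrite ?minus1_half ?half_half ?one_half ?zero_half;
  lazy -[half_of kadd]; rewrite ?kadd_half0.

Lemma J_has_constants (i : 'I_73) :
  has_constants (J k i) 4 (half_constants (nth [::] Jtables i)).
Proof.
suff H : forall i, (i < 73)%N ->
    has_constants (nth (J1 k) (Jlist k) i) 4
      (half_constants (nth [::] Jtables i)) by exact: H.
move=> {}i.
do 73 (case: i => [_|i]; first by
  cbn [nth Jlist Jtables]; eapply has_constants_tabulated;
    [constants_of_J | by [] | compare_tables]).
by [].
Qed.

End Half.

(** * The Jordan identity for the tables *)

Definition dense (t : ztable) : seq (seq (seq Z)) :=
  [seq [seq zproduct t i j | j <- iota 0 4] | i <- iota 0 4].

Fixpoint vadd (u v : seq Z) : seq Z :=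
  match u, v with
  | a :: u', b :: v' => Z.add a b :: vadd u' v'
  | [::], _ => v
  | _, [::] => u
  end.

Definition vscale (a : Z) (v : seq Z) : seq Z := [seq Z.mul a b | b <- v].

Fixpoint vlin (x : seq Z) (L : seq (seq Z)) : seq Z :=
  match x, L with
  | a :: x', v :: L' =>
      if Z.eqb a Z0 then vlin x' L' else vadd (vscale a v) (vlin x' L')
  | _, _ => [::]
  end.

Definition vmul (D : seq (seq (seq Z))) (x y : seq Z) : seq Z :=
  vlin x [seq vlin y L | L <- D].

Definition vunit (i : nat) : seq Z := ncons i Z0 [:: Zpos xH].

Section ZVectors.
Variable k : fieldType.
Local Notation zr := (@zr k).

Definition zat (v : seq Z) (l : nat) : k := zr (nth Z0 v l).

Lemma zat_nil l : zat [::] l = 0.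
Proof. by rewrite /zat nth_nil. Qed.

Lemma zat_vadd u v l : zat (vadd u v) l = zat u l + zat v l.
Proof.
elim: u v l => [|a u IH] [|b v] [|l] //=; rewrite ?zat_nil ?add0r ?addr0 //.
  by rewrite /zat /= zrD.
exact: IH.
Qed.

Lemma zat_vscale a v l : zat (vscale a v) l = zr a * zat v l.
Proof.
have [ll|ll] := ltnP l (size v); first by rewrite /zat (nth_map Z0) // zrM.
by rewrite /zat !nth_default ?size_map // mulr0.
Qed.

Lemma zat_vlin x L l : zat (vlin x L) l =
  \sum_(i < size L) zat x i * zat (nth [::] L i) l.
Proof.
elim: x L => [|a x IH] [|v L] /=; rewrite ?big_ord0 ?zat_nil //.
  by rewrite big1 // => i _; rewrite zat_nil mul0r.
rewrite big_ord_recl /=; case: Z.eqb_spec => [->|_].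
  by rewrite {2}/zat /= mul0r add0r IH.
by rewrite zat_vadd zat_vscale IH.
Qed.

Lemma zat_vunit i l : zat (vunit i) l = (l == i)%:R.
Proof.
rewrite /zat nth_ncons; case: ltngtP => // [li|->].
  by rewrite nth_default ?subn_gt0.
by rewrite subnn.
Qed.

End ZVectors.

Section Denotation.
Variables (k : fieldType) (A : algebra k) (t : ztable).
Variable b : 4.-tuple A.

Definition den (v : seq Z) : A := \sum_(l < 4) zat k v l *: b`_l.

(* Twice the product of [A], which is integral on the basis [b]. *)
Definition mul2 (x y : A) : A := 2%:R *: @amul k A x y.

Hypothesis mul2_b : forall i j : 'I_4, mul2 b`_i b`_j = den (zproduct t i j).

Lemma mul2_lincomb n m (a : 'I_n -> k) (c : 'I_m -> k) u v :
  mul2 (\sum_i a i *: u i) (\sum_j c j *: v j) =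
    \sum_i \sum_j (a i * c j) *: mul2 (u i) (v j).
Proof.
rewrite /mul2 amul_lincomb scaler_sumr; apply: eq_bigr => i _.
rewrite scaler_sumr; apply: eq_bigr => j _.
by rewrite !scalerA mulrC.
Qed.

Lemma den_vadd u v : den (vadd u v) = den u + den v.
Proof.
rewrite -big_split; apply: eq_bigr => l _ /=.
by rewrite zat_vadd scalerDl.
Qed.

Lemma den_vscale a v : den (vscale a v) = zr k a *: den v.
Proof.
rewrite scaler_sumr; apply: eq_bigr => l _ /=.
by rewrite zat_vscale scalerA.
Qed.

Lemma den_vlin x L : den (vlin x L) =
  \sum_(i < size L) zat k x i *: den (nth [::] L i).
Proof.
under [RHS]eq_bigr do rewrite scaler_sumr.
rewrite exchange_big; apply: eq_bigr => l _ /=.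
rewrite zat_vlin scaler_suml; apply: eq_bigr => i _.
by rewrite scalerA.
Qed.

Lemma den_vmul x y : den (vmul (dense t) x y) = mul2 (den x) (den y).
Proof.
rewrite mul2_lincomb den_vlin; apply: eq_bigr => i _ /=.
have -> : nth [::] [seq vlin y L | L <- dense t] i =
    vlin y [seq zproduct t i j | j <- iota 0 4].
  by case: i => [[|[|[|[|i]]]] hi].
rewrite den_vlin scaler_sumr; apply: eq_bigr => j _.
rewrite mul2_b scalerA; congr (_ *: den _).
by case: j => [[|[|[|[|j]]]] hj].
Qed.

Lemma den_vunit (i : 'I_4) : den (vunit i) = b`_i.
Proof.
rewrite /den (bigD1 i) //= big1 => [|l li]; rewrite zat_vunit.
  by rewrite eqxx scale1r addr0.
by rewrite val_eqE (negPf li) scale0r.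
Qed.

Lemma den_eq0 v : all (Z.eqb Z0) v -> den v = 0.
Proof.
move=> v0; apply: big1 => l _; have [lv|lv] := ltnP l (size v).
  by move/Z.eqb_spec: (all_nthP Z0 v0 _ lv); rewrite /zat => <-; rewrite scale0r.
by rewrite /zat nth_default // scale0r.
Qed.

End Denotation.

Section JordanCheck.

(** Both terms contain three products, so doubling the product multiplies the whole defect by 8. *)
Definition jordan_defect D i j m p : seq Z :=
  let xy := vmul D (vunit i) (vunit j) in
  vadd (vmul D (vmul D xy (vunit p)) (vunit m))
    (vscale (Zneg xH) (vmul D xy (vmul D (vunit p) (vunit m)))).

(* The vanishing of the coefficients of the cubic form
   [x |-> ((x x) y) x - (x x) (y x)]. The diagonal triples are tested apart,
   since 3 may be zero in the field. *)
Definition jordan_check (t : ztable) : bool :=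
  let d := dense t in
  let f := jordan_defect d in
  let vz := all (Z.eqb Z0) in
  let r := iota 0 4 in
  all (fun p =>
    [&& all (fun i => vz (f i i i p)) r,
        all (fun i => all (fun j =>
          vz (vadd (f i i j p) (vadd (f i j i p) (f j i i p)))) r) r &
        all (fun i => all (fun j => all (fun m =>
          vz (vadd (vadd (f i j m p) (vadd (f j m i p) (f m i j p)))
               (vadd (f j i m p) (vadd (f i m j p) (f m j i p))))) r) r) r]) r.

Lemma Jtables_jordan : all jordan_check Jtables.
Proof. by vm_compute. Qed.

End JordanCheck.

(** The 64 terms are grouped by monomial. No symmetry of [f] is assumed and nothing is divided,
    hence the validity over any commutative ring. *)
Lemma cubic_form_eq0 (k : comPzRingType) (x : nat -> k)
    (f : nat -> nat -> nat -> k) :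
  (forall i, (i < 4)%N -> f i i i = 0) ->
  (forall i j, (i < 4)%N -> (j < 4)%N ->
     f i i j + (f i j i + f j i i) = 0) ->
  (forall i j m, (i < 4)%N -> (j < 4)%N -> (m < 4)%N ->
     f i j m + (f j m i + f m i j) + (f j i m + (f i m j + f m j i)) = 0) ->
  \sum_(i < 4) \sum_(j < 4) \sum_(m < 4) x i * x j * x m * f i j m = 0.
Proof.
move=> f1 f2 f3; rewrite !big_ord_recl !big_ord0 /=.
transitivity (
    x 0 ^+ 3 * f 0 0 0 +
    x 1 ^+ 3 * f 1 1 1 +
    x 2 ^+ 3 * f 2 2 2 +
    x 3 ^+ 3 * f 3 3 3 +
    x 0 ^+ 2 * x 1 * (f 0 0 1 + (f 0 1 0 + f 1 0 0)) +
    x 0 ^+ 2 * x 2 * (f 0 0 2 + (f 0 2 0 + f 2 0 0)) +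
    x 0 ^+ 2 * x 3 * (f 0 0 3 + (f 0 3 0 + f 3 0 0)) +
    x 1 ^+ 2 * x 0 * (f 1 1 0 + (f 1 0 1 + f 0 1 1)) +
    x 1 ^+ 2 * x 2 * (f 1 1 2 + (f 1 2 1 + f 2 1 1)) +
    x 1 ^+ 2 * x 3 * (f 1 1 3 + (f 1 3 1 + f 3 1 1)) +
    x 2 ^+ 2 * x 0 * (f 2 2 0 + (f 2 0 2 + f 0 2 2)) +
    x 2 ^+ 2 * x 1 * (f 2 2 1 + (f 2 1 2 + f 1 2 2)) +
    x 2 ^+ 2 * x 3 * (f 2 2 3 + (f 2 3 2 + f 3 2 2)) +
    x 3 ^+ 2 * x 0 * (f 3 3 0 + (f 3 0 3 + f 0 3 3)) +
    x 3 ^+ 2 * x 1 * (f 3 3 1 + (f 3 1 3 + f 1 3 3)) +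
    x 3 ^+ 2 * x 2 * (f 3 3 2 + (f 3 2 3 + f 2 3 3)) +
    x 0 * x 1 * x 2 * (f 0 1 2 + (f 1 2 0 + f 2 0 1) + (f 1 0 2 + (f 0 2 1 + f 2 1 0))) +
    x 0 * x 1 * x 3 * (f 0 1 3 + (f 1 3 0 + f 3 0 1) + (f 1 0 3 + (f 0 3 1 + f 3 1 0))) +
    x 0 * x 2 * x 3 * (f 0 2 3 + (f 2 3 0 + f 3 0 2) + (f 2 0 3 + (f 0 3 2 + f 3 2 0))) +
    x 1 * x 2 * x 3 * (f 1 2 3 + (f 2 3 1 + f 3 1 2) + (f 2 1 3 + (f 1 3 2 + f 3 2 1)))).
  by rewrite /bump /=; ring.
by rewrite !f1 // !f2 // !f3 // !mulr0 !addr0.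
Qed.

Section JordanOfCheck.
Variables (k : fieldType) (A : algebra k) (t : ztable).
Hypothesis two_neq0 : (2 : k) != 0.
Variable b : 4.-tuple A.
Hypothesis bB : basis_of fullv b.
Hypothesis bM :
  forall i j : 'I_4, @amul k A b`_i b`_j =
    \sum_(l < 4) half_constants k t i j l *: b`_l.

Lemma mul2_basis (i j : 'I_4) : mul2 b`_i b`_j = den b (zproduct t i j).
Proof.
rewrite /mul2 bM scaler_sumr; apply: eq_bigr => l _.
by rewrite /half_constants half_ofE // scalerA mulrC divfK.
Qed.

Lemma zproductC i j : zproduct t i j = zproduct t j i.
Proof. by elim: t => //= -[p v] u ->; rewrite orbC. Qed.

Lemma mul2C (x y : A) : mul2 x y = mul2 y x.
Proof.
rewrite (coord_basis bB (memvf x)) (coord_basis bB (memvf y)).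
rewrite !mul2_lincomb exchange_big; apply: eq_bigr => i _.
by apply: eq_bigr => j _; rewrite !mul2_basis zproductC mulrC.
Qed.

Let mul2_suml n (a : 'I_n -> k) (u : 'I_n -> A) y :
  mul2 (\sum_i a i *: u i) y = \sum_i a i *: mul2 (u i) y.
Proof.
rewrite /mul2 linear_sumlz scaler_sumr; apply: eq_bigr => i _.
by rewrite linearZl_LR !scalerA mulrC.
Qed.

Let mul2_sumr n (a : 'I_n -> k) (u : 'I_n -> A) y :
  mul2 y (\sum_i a i *: u i) = \sum_i a i *: mul2 y (u i).
Proof. by rewrite mul2C mul2_suml; under eq_bigr do rewrite mul2C. Qed.

Definition defect (x w z y : A) : A :=
  mul2 (mul2 (mul2 x w) y) z - mul2 (mul2 x w) (mul2 y z).

Let sum_scaleB n (a : 'I_n -> k) (u v : 'I_n -> A) :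
  \sum_i a i *: u i - \sum_i a i *: v i = \sum_i a i *: (u i - v i).
Proof. by rewrite -sumrB; apply: eq_bigr => i _; rewrite scalerBr. Qed.

Lemma defect_sum1 n (a : 'I_n -> k) u w z y :
  defect (\sum_i a i *: u i) w z y = \sum_i a i *: defect (u i) w z y.
Proof. by rewrite /defect !mul2_suml sum_scaleB. Qed.

Lemma defect_sum2 n (a : 'I_n -> k) u x z y :
  defect x (\sum_i a i *: u i) z y = \sum_i a i *: defect x (u i) z y.
Proof. by rewrite /defect mul2_sumr !mul2_suml sum_scaleB. Qed.

Lemma defect_sum3 n (a : 'I_n -> k) u x w y :
  defect x w (\sum_i a i *: u i) y = \sum_i a i *: defect x w (u i) y.
Proof. by rewrite /defect !mul2_sumr sum_scaleB. Qed.

Lemma defect_sum4 n (a : 'I_n -> k) u x w z :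
  defect x w z (\sum_i a i *: u i) = \sum_i a i *: defect x w z (u i).
Proof. by rewrite /defect mul2_sumr !mul2_suml mul2_sumr sum_scaleB. Qed.

Lemma defect_eq0 (t_jordan : jordan_check t) x y : defect x x x y = 0.
Proof.
rewrite (coord_basis bB (memvf y)) defect_sum4.
apply: big1 => p _; apply/eqP; rewrite scaler_eq0; apply/orP; right; apply/eqP.
pose xn i := if insub i is Some i' then coord b i' x else 0.
have xE (i : 'I_4) : coord b i x = xn i by rewrite /xn valK.
pose f i j m := jordan_defect (dense t) i j m p.
have fE (i j m : 'I_4) : defect b`_i b`_j b`_m b`_p = den b (f i j m).
  rewrite /f /jordan_defect den_vadd den_vscale !(den_vmul mul2_basis).
  by rewrite !den_vunit zrN1 scaleN1r.
rewrite (coord_basis bB (memvf x)) defect_sum1.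
transitivity (\sum_(l < 4) (\sum_(i < 4) \sum_(j < 4) \sum_(m < 4)
    xn i * xn j * xn m * zat k (f i j m) l) *: b`_l).
  under [RHS]eq_bigr do rewrite scaler_suml.
  rewrite [RHS]exchange_big; apply: eq_bigr => i _.
  under [RHS]eq_bigr do rewrite scaler_suml.
  rewrite [RHS]exchange_big defect_sum2 scaler_sumr; apply: eq_bigr => j _.
  under [RHS]eq_bigr do rewrite scaler_suml.
  rewrite [RHS]exchange_big defect_sum3 !scaler_sumr; apply: eq_bigr => m _.
  rewrite fE !scalerA !xE scaler_sumr; apply: eq_bigr => l _.
  by rewrite scalerA.
have rI (i : nat) : (i < 4)%N -> i \in iota 0 4 by rewrite mem_iota.
have /and3P[/allP f1 /allP f2 /allP f3] := allP t_jordan _ (rI _ (ltn_ord p)).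
have zE v l : all (Z.eqb Z0) v -> zat k v l = 0.
  move=> v0; have [lv|lv] := ltnP l (size v); last by rewrite /zat nth_default.
  by move/Z.eqb_spec: (all_nthP Z0 v0 _ lv); rewrite /zat => <-.
apply: big1 => l _; rewrite (@cubic_form_eq0 k xn (fun i j m => zat k (f i j m) l)).
- by rewrite scale0r.
- by move=> i i4; rewrite (zE _ _ (f1 _ (rI _ i4))).
- move=> i j i4 j4; rewrite -!zat_vadd.
  by have /allP/(_ _ (rI _ j4)) h := f2 _ (rI _ i4); rewrite (zE _ _ h).
move=> i j m i4 j4 m4; rewrite -!zat_vadd.
have /allP/(_ _ (rI _ j4))/allP/(_ _ (rI _ m4)) h := f3 _ (rI _ i4).
by rewrite (zE _ _ h).
Qed.

Lemma jordan_of_check : jordan_check t -> jordan A.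
Proof.
move=> ck; split=> x y.
  by apply: (scalerI two_neq0); exact: mul2C.
have c8 : (8%:R : k) != 0.
  by rewrite (_ : 8%:R = 2%:R * (2%:R * 2%:R)) ?mulf_neq0 // -!natrM.
have [mZl mZr] : (forall a (u v : A), @amul k A (a *: u) v = a *: @amul k A u v) /\
    (forall a (u v : A), @amul k A u (a *: v) = a *: @amul k A u v).
  by split=> a u v; rewrite ?linearZl_LR ?linearZr_LR.
apply: (scalerI c8); apply/eqP; rewrite -subr_eq0; apply/eqP.
rewrite -(defect_eq0 ck x y) /defect /mul2 !mZl !mZr !scalerA -!natrM.
by [].
Qed.

End JordanOfCheck.

(** * Dimensions of spaces of linear maps satisfying an identity *)

Section Elimination.

(* [red] replaces an integer by another one with the same image in the field,
   and [ok] recognizes integers with a nonzero image. *)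
Variables (red : Z -> Z) (ok : Z -> bool).

(** Dividing by the gcd keeps the entries small. The quotients are verified by multiplication, so no
    property of [Z.gcd] has to be proved. *)
Definition pivot_step (pr r : seq Z) : seq Z :=
  let p := head Z0 pr in let a := head Z0 r in
  let g := Z.gcd p a in
  let u := Z.div p g in let w := Z.div a g in
  if Z.eqb (Z.mul u g) p && Z.eqb (Z.mul w g) a then
    [seq red z | z <- vadd (vscale u (behead r)) (vscale (Z.opp w) (behead pr))]
  else
    [seq red z | z <- vadd (vscale p (behead r)) (vscale (Z.opp a) (behead pr))].

Definition nonzero_row (r : seq Z) : bool := has (fun z => ~~ Z.eqb z Z0) r.

(** [None] is returned at a column with nonzero heads none of which is recognized as invertible,
    since the dimension might then depend on the field. *)
Fixpoint nullity (n : nat) (rs : seq (seq Z)) : option nat :=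
  if n is m.+1 then
    let rs := [seq r <- rs | nonzero_row r] in
    let c := [seq r <- rs | ok (head Z0 r)] in
    if c is pr :: _ then nullity m [seq pivot_step pr r | r <- rs]
    else if all (fun r => Z.eqb (head Z0 r) Z0) rs then
      omap S (nullity m [seq behead r | r <- rs])
    else None
  else Some 0%N.

Variable k : fieldType.
Hypothesis redE : forall z, zr k (red z) = zr k z.
Hypothesis okP : forall z, ok z -> zr k z != 0.

Fixpoint dot (r : seq Z) (v : nat -> k) : k :=
  if r is a :: r' then zr k a * v 0%N + dot r' (fun i => v i.+1) else 0.

Definition solution (rs : seq (seq Z)) (v : nat -> k) : Prop :=
  forall r, r \in rs -> dot r v = 0.

Lemma dotE n r v : (size r <= n)%N -> dot r v = \sum_(i < n) zat k r i * v i.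
Proof.
elim: n r v => [|n IH] [|a r] v //= rn.
- by rewrite big_ord0.
- by rewrite big1 // => i _; rewrite zat_nil mul0r.
- by rewrite big_ord_recl IH.
Qed.

Lemma dot_ext n r v w : (size r <= n)%N -> (forall i, (i < n)%N -> v i = w i) ->
  dot r v = dot r w.
Proof.
by move=> rn vw; rewrite !(dotE _ rn); apply: eq_bigr => i _; rewrite vw.
Qed.

Lemma dot_vadd r s v : dot (vadd r s) v = dot r v + dot s v.
Proof.
elim: r s v => [|a r IH] [|b s] v /=; rewrite ?add0r ?addr0 //.
by rewrite IH zrD mulrDl addrACA.
Qed.

Lemma dot_vscale a r v : dot (vscale a r) v = zr k a * dot r v.
Proof.
elim: r v => [|b r IH] v /=; rewrite ?mulr0 //.
by rewrite IH zrM mulrDr mulrA.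
Qed.

Lemma dot_red r v : dot [seq red z | z <- r] v = dot r v.
Proof. by elim: r v => //= a r IH v; rewrite IH redE. Qed.

Lemma dot_zero r v : ~~ nonzero_row r -> dot r v = 0.
Proof.
elim: r v => //= a r IH v; rewrite negb_or negbK => /andP[/Z.eqb_spec -> /IH ->].
by rewrite mul0r addr0.
Qed.

Lemma dot_head r v :
  dot r v = zr k (head Z0 r) * v 0%N + dot (behead r) (fun i => v i.+1).
Proof. by case: r => [|a r] /=; rewrite ?mul0r ?addr0. Qed.

(** The step multiplies the row by some [u] and subtracts a multiple of the pivot row; [u] divides
    the pivot, so it is nonzero in the field. *)
Lemma pivot_stepP pr r v : zr k (head Z0 pr) != 0 -> dot pr v = 0 ->
  (dot (pivot_step pr r) (fun i => v i.+1) == 0) = (dot r v == 0).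
Proof.
move=> p0 prv; have [u [w [u0 -> uw]]] : exists u w : Z,
    [/\ zr k u != 0, pivot_step pr r =
      [seq red z | z <- vadd (vscale u (behead r)) (vscale (Z.opp w) (behead pr))] &
      Z.mul u (head Z0 r) = Z.mul w (head Z0 pr)].
  have cross (x y z p a : Z) : Z.mul x z = p -> Z.mul y z = a -> Z.mul x a = Z.mul y p.
    by move=> <- <-; lia.
  rewrite /pivot_step; case: ifP => [/andP[/Z.eqb_spec pE /Z.eqb_spec aE]|_].
    do 2 eexists; split=> //; last exact: cross pE aE.
    by apply: contraNneq p0 => u0; rewrite -pE zrM u0 mul0r.
  by exists (head Z0 pr), (head Z0 r); split=> //; apply: Z.mul_comm.
rewrite dot_red dot_vadd !dot_vscale zrN mulNr.
move: prv; rewrite dot_head => /eqP; rewrite addrC addr_eq0 => /eqP ->.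
rewrite mulrN opprK mulrA -zrM -uw zrM -mulrA -mulrDr addrC.
by rewrite -dot_head mulf_eq0 (negPf u0).
Qed.

(* The rows [theta 0 .. theta (d - 1)] are a basis of the solutions of [rs]
   among the vectors of length [n]. *)
Definition null_basis n rs d (theta : nat -> nat -> k) : Prop :=
  [/\ forall r, (r < d)%N -> solution rs (theta r),
      forall v, solution rs v -> exists a : nat -> k,
        forall i, (i < n)%N -> v i = \sum_(r < d) a r * theta r i &
      forall a : nat -> k,
        (forall i, (i < n)%N -> \sum_(r < d) a r * theta r i = 0) ->
        forall r, (r < d)%N -> a r = 0].

Lemma nullityP n rs d : all (fun r => size r <= n)%N rs ->
  nullity n rs = Some d -> exists theta, null_basis n rs d theta.
Proof.
elim: n rs d => [|n IH] rs d.
  move=> /allP szr [<-]; exists (fun _ _ => 0); split=> // v _.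
  by exists (fun _ => 0).
move=> /allP szr /=; set rs' := [seq r <- rs | nonzero_row r].
have solE v : solution rs v <-> solution rs' v.
  split=> sv r; first by rewrite mem_filter => /andP[_ /sv].
  move=> rrs; have [nz|] := boolP (nonzero_row r).
    by apply: sv; rewrite mem_filter nz.
  exact: dot_zero.
have szr' r : r \in rs' -> (size r <= n.+1)%N.
  by rewrite mem_filter => /andP[_ /szr].
have wlog_rs' th : null_basis n.+1 rs' d th -> null_basis n.+1 rs d th.
  case=> h1 h2 h3; split=> // [r rd|v /solE]; last exact: h2.
  by apply/solE; apply: h1.
case cE: [seq r <- rs' | ok (head Z0 r)] => [|pr c].
  case: ifP => // /allP hz; case nE: nullity => [d'|] //= [dd]; subst d => {cE}.
  have [|th [th1 th2 th3]] := IH _ _ _ nE.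
    apply/allP => r /mapP[r' /szr' + ->].
    by rewrite size_behead; case: (size r').
  have solB v : solution rs' v <->
      solution [seq behead r | r <- rs'] (fun i => v i.+1).
    split=> sv r.
      move=> /mapP[r' r'rs ->]; have := sv _ r'rs; rewrite dot_head.
      by rewrite (elimT (Z.eqb_spec _ _) (hz _ r'rs)) mul0r add0r.
    move=> rrs; rewrite dot_head (elimT (Z.eqb_spec _ _) (hz _ rrs)) mul0r add0r.
    by apply: sv; apply: map_f.
  (* A column of zeros is free: it contributes its own unit vector, and the vectors found before get
     the coordinate 0 there. *)
  pose th' r i : k :=
    match r, i with 0, 0 => 1 | 0, _.+1 => 0 | _.+1, 0 => 0
    | r'.+1, i'.+1 => th r' i' end.
  exists th'; apply: wlog_rs'; split=> [[|r] rd|v /solB /th2 [a ha]|a ha r rd].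
  - apply/solB => r _; rewrite (@dot_ext (size r) _ _ (fun _ => 0)) //.
    by rewrite (@dotE (size r)) // big1 // => i _; rewrite mulr0.
  - by apply/solB => s sr; rewrite -[RHS](th1 r rd s sr).
  - exists (fun r => if r is r'.+1 then a r' else v 0%N) => -[|i] ilt.
      rewrite big_ord_recl /= mulr1 big1 ?addr0 // => j _; exact: mulr0.
    rewrite big_ord_recl /= mulr0 add0r ha //.
  have h3 : forall r, (r < d')%N -> a r.+1 = 0.
    apply: (th3 (fun r => a r.+1)) => i ilt; rewrite -[RHS](ha i.+1 ilt).
    by rewrite big_ord_recl /= mulr0 add0r.
  case: r rd => [|r] rd; last exact: h3.
  have := ha 0%N isT; rewrite big_ord_recl /= mulr1 big1 ?addr0 // => j _.
  exact: mulr0.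
move=> nE; have prc : pr \in [seq r <- rs' | ok (head Z0 r)].
  by rewrite cE mem_head.
move: prc; rewrite mem_filter => /andP[/okP p0 prrs].
have solB v : solution rs' v <-> dot pr v = 0 /\
    solution [seq pivot_step pr r | r <- rs'] (fun i => v i.+1).
  split=> [sv|[pv sv] r rrs].
    have pv := sv _ prrs; split=> // r /mapP[r' r'rs ->].
    by apply/eqP; rewrite pivot_stepP // sv.
  by apply/eqP; rewrite -(pivot_stepP _ p0 pv) sv //; apply: map_f.
have [|th [th1 th2 th3]] := IH _ _ _ nE.
  have sB r : r \in rs' -> (size (behead r) <= n)%N.
    by move/szr'; rewrite size_behead; case: (size r).
  have sV u v : (size (vadd u v) <= maxn (size u) (size v))%N.
    elim: u v => [|a u IHu] [|b v] //=; rewrite ?maxn0 ?max0n //.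
    by rewrite maxnSS ltnS.
  apply/allP => r /mapP[r' r'rs ->]; rewrite /pivot_step.
  by case: ifP => _; rewrite size_map (leq_trans (sV _ _)) // geq_max;
    rewrite !size_map !sB.
(* The first coordinate that the pivot row forces on a vector with the remaining coordinates [v]. *)
pose lead (v : nat -> k) := - (zr k (head Z0 pr))^-1 * dot (behead pr) v.
have leadP v : dot pr v = 0 <-> v 0%N = lead (fun i => v i.+1).
  rewrite dot_head /lead; split=> [/eqP|->].
    by rewrite addr_eq0 => /eqP h; rewrite mulNr -mulrN -h mulKf.
  by rewrite mulrA mulrN mulfV // mulN1r addNr.
pose th' r i : k := if i is i'.+1 then th r i' else lead (th r).
have szb : (size (behead pr) <= n)%N.
  by move: (szr' _ prrs); rewrite size_behead; case: (size pr).
exists th'; apply: wlog_rs'; split=> [r rd|v /solB [/leadP pv /th2 [a ha]]|a ha r rd].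
- by apply/solB; split; [apply/leadP | exact: th1].
- exists a => -[|i] ilt; last exact: ha.
  rewrite pv /lead (dot_ext szb ha) (dotE _ szb) mulr_sumr.
  under eq_bigr do rewrite !mulr_sumr.
  rewrite exchange_big; apply: eq_bigr => s _ /=.
  rewrite /lead (dotE _ szb) !mulr_sumr; apply: eq_bigr => j _.
  by ring.
apply: th3 rd => i ilt; exact: (ha i.+1 ilt).
Qed.

End Elimination.

(** * Formal identities in a linear map and their integer systems *)

Inductive fterm := Var of nat | Mul of fterm & fterm | App of fterm.

(* A homogeneous identity in an unknown linear map, written [App], and in
   universally quantified elements [Var 0], [Var 1], ... *)
Definition fidentity := seq (Z * fterm).

Fixpoint app_count (t : fterm) : nat :=
  match t with
  | Var _ => 0 | Mul s u => app_count s + app_count u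
  | App s => (app_count s).+1
  end.

Fixpoint occurrences (i : nat) (t : fterm) : nat :=
  match t with
  | Var j => j == i | Mul s u => occurrences i s + occurrences i u
  | App s => occurrences i s
  end.

Fixpoint var_bound (t : fterm) : nat :=
  match t with
  | Var j => j.+1 | Mul s u => maxn (var_bound s) (var_bound u)
  | App s => var_bound s
  end.

(** With exactly one [App] in each term the identity is linear in the 16 entries of the map, and
    with each variable occurring once it only has to be tested on basis vectors. *)
Definition multilinear (nv : nat) (P : fidentity) : bool :=
  all (fun q => [&& app_count q.2 == 1%N, (var_bound q.2 <= nv)%N &
    all (fun i => occurrences i q.2 == 1%N) (iota 0 nv)]) P.

Fixpoint int_eval D (M : seq (seq Z)) (e : nat -> seq Z) (t : fterm) :=
  match t with
  | Var j => e j
  | Mul s u => vmul D (int_eval D M e s) (int_eval D M e u)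
  | App s => vlin (int_eval D M e s) M
  end.

Definition int_peval D M e (P : fidentity) : seq Z :=
  foldr (fun q v => vadd (vscale q.1 (int_eval D M e q.2)) v) [::] P.

(** Elementary matrices numbered row by row; the rows missing at the end of the list count as
    zero. *)
Definition unit_matrix (s : nat) : seq (seq Z) :=
  ncons (s %/ 4) [::] [:: vunit (s %% 4)].

Fixpoint basis_choices (nv : nat) : seq (seq nat) :=
  if nv is n.+1 then
    [seq i :: c | i <- iota 0 4, c <- basis_choices n] else [:: [::]].

Lemma basis_choicesS n : basis_choices n.+1 =
  [seq i :: c | i <- iota 0 4, c <- basis_choices n].
Proof. by []. Qed.

Definition identity_rows D P (c : seq nat) : seq (seq Z) :=
  let vals :=
    [seq int_peval D (unit_matrix s) (fun j => vunit (nth 0%N c j)) P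
    | s <- iota 0 16] in
  [seq [seq nth Z0 v l | v <- vals] | l <- iota 0 4].

Definition identity_system (t : ztable) nv P : seq (seq Z) :=
  flatten [seq identity_rows (dense t) P c | c <- basis_choices nv].

Lemma eq_sum_all (V : nmodType) (T : Type) (p : pred T) (s : seq T)
    (f g : T -> V) :
  all p s -> (forall x, p x -> f x = g x) ->
  \sum_(x <- s) f x = \sum_(x <- s) g x.
Proof.
move=> + fg; elim: s => [|x s IH] /=; rewrite ?big_nil // !big_cons.
by case/andP=> /fg -> /IH ->.
Qed.

Section Evaluation.
Variables (k : fieldType) (A : algebra k).

Fixpoint feval (F : A -> A) (e : nat -> A) (t : fterm) : A :=
  match t with
  | Var j => e j
  | Mul s u => mul2 (feval F e s) (feval F e u)
  | App s => F (feval F e s)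
  end.

Definition peval F e (P : fidentity) : A :=
  \sum_(q <- P) zr k q.1 *: feval F e q.2.

Definition satisfies (F : A -> A) P : Prop := forall e, peval F e P = 0.

Lemma eq_feval F F' e e' t : F =1 F' ->
  (forall i, (i < var_bound t)%N -> e i = e' i) -> feval F e t = feval F' e' t.
Proof.
move=> FF; elim: t => [j|s IHs u IHu|s IHs] /= ee.
- exact: ee.
- by rewrite IHs ?IHu // => i ib; apply: ee; rewrite leq_max ib ?orbT.
- by rewrite IHs.
Qed.

Lemma feval_app0 F F' e t : app_count t = 0%N -> feval F e t = feval F' e t.
Proof.
elim: t => //= s IHs u IHu /eqP; rewrite addn_eq0 => /andP[/eqP s0 /eqP u0].
by rewrite IHs // IHu.
Qed.

Definition update (e : nat -> A) i x : nat -> A :=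
  fun j => if j == i then x else e j.

Lemma feval_update0 F e i x t : occurrences i t = 0%N ->
  feval F (update e i x) t = feval F e t.
Proof.
elim: t => [j|s IHs u IHu|s IHs] /=; first by rewrite /update; case: (j == i).
  by move/eqP; rewrite addn_eq0 => /andP[/eqP s0 /eqP u0]; rewrite IHs ?IHu.
by move=> s0; rewrite IHs.
Qed.

Lemma mul2_suml n (a : 'I_n -> k) (u : 'I_n -> A) y :
  mul2 (\sum_i a i *: u i) y = \sum_i a i *: mul2 (u i) y.
Proof.
rewrite /mul2 linear_sumlz scaler_sumr; apply: eq_bigr => i _.
by rewrite linearZl_LR !scalerA mulrC.
Qed.

Lemma mul2_sumr n (a : 'I_n -> k) (u : 'I_n -> A) y :
  mul2 y (\sum_i a i *: u i) = \sum_i a i *: mul2 y (u i).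
Proof.
rewrite /mul2 linear_sumr scaler_sumr; apply: eq_bigr => i _.
by rewrite linearZr_LR !scalerA mulrC.
Qed.

Lemma feval_update (F : {linear A -> A}) e i n (a : 'I_n -> k) u t :
  occurrences i t = 1%N ->
  feval F (update e i (\sum_j a j *: u j)) t =
    \sum_j a j *: feval F (update e i (u j)) t.
Proof.
elim: t => [j|s IHs v IHv|s IHs] /=.
- by rewrite /update; case: (j == i).
- case: (occurrences i s) IHs (@feval_update0 F e i ^~ s) => [|[|//]] IHs s0.
    rewrite add0n => /IHv ->; rewrite s0 // mul2_sumr.
    by apply: eq_bigr => j _; rewrite s0.
  case: (occurrences i v) (@feval_update0 F e i ^~ v) => // v0 _.
  rewrite IHs // v0 // mul2_suml.
  by apply: eq_bigr => j _; rewrite v0.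
- move=> /IHs ->; rewrite linear_sum; apply: eq_bigr => j _.
  by rewrite linearZ.
Qed.

Lemma peval_update (F : {linear A -> A}) e i n (a : 'I_n -> k) u P nv :
  multilinear nv P -> (i < nv)%N ->
  peval F (update e i (\sum_j a j *: u j)) P =
    \sum_j a j *: peval F (update e i (u j)) P.
Proof.
move=> mP inv.
under [RHS]eq_bigr do rewrite scaler_sumr.
rewrite exchange_big /=; apply: eq_sum_all mP _ => q /and3P[_ _ /allP oq].
rewrite feval_update ?scaler_sumr; last by apply/eqP; apply: oq; rewrite mem_iota.
by apply: eq_bigr => j _; rewrite !scalerA mulrC.
Qed.

Lemma eq_peval F F' e e' P nv : multilinear nv P -> F =1 F' ->
  (forall i, (i < nv)%N -> e i = e' i) -> peval F e P = peval F' e' P.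
Proof.
move=> mP FF ee; apply: eq_sum_all mP _ => q /and3P[_ qb _].
by congr (_ *: _); apply: eq_feval => // i iq; apply: ee; apply: leq_trans qb.
Qed.

Variable b : 4.-tuple A.
Hypothesis bB : basis_of fullv b.

(** Basis vectors are replaced by arbitrary elements one variable at a time, by linearity in that
    variable. *)
Lemma satisfies_basis (F : {linear A -> A}) P nv : multilinear nv P ->
  (forall c : nat -> 'I_4, peval F (fun j => b`_(c j)) P = 0) ->
  satisfies F P.
Proof.
move=> mP H e.
suff S s : (s <= nv)%N -> forall (e : nat -> A) (c : nat -> 'I_4),
    peval F (fun j => if (j < s)%N then e j else b`_(c j)) P = 0.
  rewrite -(S nv (leqnn _) e (fun _ => ord0)).
  by apply: (eq_peval mP) => // i ->.
elim: s => [_ {}e c|s IH sn {}e c]; first exact: H.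
transitivity (peval F (update
    (fun j => if (j < s)%N then e j else b`_(c j)) s (e s)) P).
  apply: (eq_peval mP) => // i _; rewrite /update.
  by rewrite ltnS leq_eqVlt; case: eqP => [->|].
rewrite (coord_basis bB (memvf (e s))) (peval_update _ _ _ _ mP sn).
apply: big1 => l _; rewrite -[RHS](scaler0 _ (coord b l (e s))); congr (_ *: _).
rewrite -[RHS](IH (ltnW sn) e (fun j => if j == s then l else c j)).
apply: (eq_peval mP) => // i _; rewrite /update.
by case: eqP => [->|] //; rewrite ltnn.
Qed.

Definition matrix_map (phi : nat -> k) (x : A) : A :=
  \sum_(i < 4) \sum_(j < 4) (coord b i x * phi (4 * i + j)%N) *: b`_j.

Fact matrix_map_linear phi : linear (matrix_map phi).
Proof.
move=> a x y; rewrite /matrix_map scaler_sumr -big_split.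
apply: eq_bigr => i _ /=; rewrite scaler_sumr -big_split.
by apply: eq_bigr => j _ /=; rewrite linearP scalerA -scalerDl mulrDl mulrA.
Qed.

HB.instance Definition _ phi :=
  GRing.isLinear.Build k A A *:%R (matrix_map phi) (matrix_map_linear phi).

Definition delta (s i : nat) : k := (i == s)%:R.

Lemma matrix_map_delta phi x :
  matrix_map phi x = \sum_(s < 16) phi s *: matrix_map (delta s) x.
Proof.
under [RHS]eq_bigr do rewrite scaler_sumr.
rewrite exchange_big; apply: eq_bigr => i _ /=.
under [RHS]eq_bigr do rewrite scaler_sumr.
rewrite exchange_big; apply: eq_bigr => j _ /=.
have ij : (4 * i + j < 16)%N by case: i j => i i4 [j j4] /=; lia.
rewrite (bigD1 (Ordinal ij)) //= big1 => [|s sij].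
  by rewrite /delta eqxx mulr1 addr0 scalerA mulrC.
by move: sij; rewrite -val_eqE /= eq_sym /delta => /negPf ->; rewrite mulr0 scale0r scaler0.
Qed.

Lemma feval_delta phi e t : app_count t = 1%N ->
  feval (matrix_map phi) e t =
    \sum_(s < 16) phi s *: feval (matrix_map (delta s)) e t.
Proof.
elim: t => //= [s IHs u IHu|s _ [s0]]; last first.
  rewrite matrix_map_delta; apply: eq_bigr => j _.
  by rewrite (@feval_app0 _ (matrix_map (delta j)) _ _ s0).
have f0 := @feval_app0 (matrix_map phi).
case: (app_count s) IHs (fun F' => f0 F' e s) => [|[|//]] IHs s0.
  rewrite add0n => /IHu ->; rewrite mul2_sumr.
  by apply: eq_bigr => j _; rewrite (s0 (matrix_map (delta j))).
case: (app_count u) (fun F' => f0 F' e u) => // u0 _.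
rewrite IHs // mul2_suml.
by apply: eq_bigr => j _; rewrite (u0 (matrix_map (delta j))).
Qed.

Lemma peval_delta phi e P nv : multilinear nv P ->
  peval (matrix_map phi) e P =
    \sum_(s < 16) phi s *: peval (matrix_map (delta s)) e P.
Proof.
move=> mP; under [RHS]eq_bigr do rewrite scaler_sumr.
rewrite exchange_big /=; apply: eq_sum_all mP _ => q /and3P[/eqP q1 _ _].
rewrite feval_delta // scaler_sumr.
by apply: eq_bigr => j _; rewrite !scalerA mulrC.
Qed.

Variable t : ztable.
Hypothesis bM :
  forall i j : 'I_4, mul2 b`_i b`_j = den b (zproduct t i j).

Lemma coord_den v i : coord b i (den b v) = zat k v i.
Proof. exact: coord_sum_free (basis_free bB). Qed.

Lemma den_unit_matrix (s : 'I_16) v :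
  den b (vlin v (unit_matrix s)) = matrix_map (delta s) (den b v).
Proof.
rewrite /matrix_map exchange_big; apply: eq_bigr => l _ /=.
rewrite -scaler_suml; congr (_ *: _); rewrite zat_vlin.
have s4 : (s %/ 4 < 4)%N by rewrite ltn_divLR.
rewrite size_ncons addn1 (bigD1 (inord (s %/ 4))) //= inordK // big1 => [|i].
  rewrite addr0 (bigD1 (Ordinal s4)) //= big1 => [|i].
    rewrite addr0 coord_den; congr (_ * _).
    rewrite nth_ncons ltnn subnn /= zat_vunit /delta /=.
    have -> : (4 * (s %/ 4) + l == s)%N = (l == s %% 4 :> nat)%N.
      by rewrite {2}(divn_eq s 4) mulnC eqn_add2l.
    by case: eqP.
  rewrite -val_eqE /= /delta => /eqP si.
  have [js|] := eqVneq; last by rewrite mulr0.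
  by case: si; rewrite -js mulnC divnMDl // divn_small // addn0.
rewrite -val_eqE /= inordK // => /eqP si.
have ilt : (i < s %/ 4)%N by case: i si => i /=; rewrite ltnS leq_eqVlt => /orP[/eqP|].
by rewrite nth_ncons ilt zat_nil mulr0.
Qed.

Lemma den_int_eval (s : 'I_16) c u : (forall j, c j < 4)%N ->
  den b (int_eval (dense t) (unit_matrix s) (fun j => vunit (c j)) u) =
  feval (matrix_map (delta s)) (fun j => b`_(c j)) u.
Proof.
move=> c4; elim: u => [j|u IHu v IHv|u IHu] /=.
- exact: (den_vunit b (Ordinal (c4 j))).
- by rewrite den_vmul // IHu IHv.
- by rewrite den_unit_matrix IHu.
Qed.

Lemma den_int_peval (s : 'I_16) c P : (forall j, c j < 4)%N ->
  den b (int_peval (dense t) (unit_matrix s) (fun j => vunit (c j)) P) =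
  peval (matrix_map (delta s)) (fun j => b`_(c j)) P.
Proof.
move=> c4; elim: P => [|q P IH]; rewrite /peval ?big_nil ?big_cons /=.
  by rewrite den_eq0.
by rewrite den_vadd den_vscale den_int_eval // IH.
Qed.

Lemma identity_systemP phi nv P : multilinear nv P ->
  solution (identity_system t nv P) phi <-> satisfies (matrix_map phi) P.
Proof.
move=> mlin.
have key c : (forall j, c j < 4)%N ->
    peval (matrix_map phi) (fun j => b`_(c j)) P = \sum_(l < 4)
      (\sum_(s < 16) zat k (int_peval (dense t) (unit_matrix s)
         (fun j => vunit (c j)) P) l * phi s) *: b`_l.
  move=> c4; rewrite (peval_delta _ _ mlin).
  under [RHS]eq_bigr do rewrite scaler_suml.
  rewrite exchange_big; apply: eq_bigr => s _ /=.
  rewrite -den_int_peval // scaler_sumr.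
  by apply: eq_bigr => l _; rewrite scalerA mulrC.
have rowE c l : (l < 4)%N ->
    nth [::] (identity_rows (dense t) P c) l =
    [seq nth Z0 (int_peval (dense t) (unit_matrix s)
           (fun j => vunit (nth 0%N c j)) P) l | s <- iota 0 16].
  by case: l => [|[|[|[|]]]].
have dotr c (l : nat) :
    dot [seq nth Z0 (int_peval (dense t) (unit_matrix s)
           (fun j => vunit (nth 0%N c j)) P) l | s <- iota 0 16] phi =
    \sum_(s < 16) zat k (int_peval (dense t) (unit_matrix s)
           (fun j => vunit (nth 0%N c j)) P) l * phi s.
  rewrite (@dotE k 16) ?size_map ?size_iota //.
  apply: eq_bigr => s _.
  by rewrite {1}/zat (nth_map 0%N) ?size_iota // nth_iota.
have chP n c : c \in basis_choices n -> forall j, (nth 0%N c j < 4)%N.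
  elim: n c => [|n IH] c; first by rewrite inE => /eqP -> j; rewrite nth_nil.
  rewrite basis_choicesS => /allpairsP[[i d] []]; rewrite mem_iota.
  by move=> /andP[_ i4] /IH hd -> [|j] /=.
have chI n (c : nat -> 'I_4) :
    [seq (c j : nat) | j <- iota 0 n] \in basis_choices n.
  elim: n c => [|n IH] c; first by rewrite inE.
  have -> : [seq (c j : nat) | j <- iota 0 n.+1] =
      (c 0%N : nat) :: [seq (c j.+1 : nat) | j <- iota 0 n].
    rewrite [LHS]/= (_ : iota 1 n = [seq j.+1 | j <- iota 0 n]) -?map_comp //.
    exact: (iotaDl 1 0 n).
  rewrite basis_choicesS; apply: allpairs_f; last exact: (IH (fun j => c j.+1)).
  by rewrite mem_iota ltn_ord.
split=> [sol|sat r].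
  apply: (satisfies_basis mlin) => c.
  pose d := [seq (c j : nat) | j <- iota 0 nv].
  have dc := chI nv c.
  transitivity (peval (matrix_map phi) (fun j => b`_(nth 0%N d j)) P).
    apply: (eq_peval mlin) => // i inv.
    by rewrite (nth_map 0%N) ?size_iota // nth_iota.
  rewrite (key _ (chP _ _ dc)); apply: big1 => l _; rewrite -dotr sol ?scale0r //.
  apply/flatten_mapP; exists d => //; rewrite -rowE //.
  by apply: mem_nth; rewrite size_map size_iota.
case/flatten_mapP=> c /chP c4 /(nthP [::])[l]; rewrite size_map size_iota => l4.
rewrite rowE // => <-; rewrite dotr.
have := sat (fun j => b`_(nth 0%N c j)); rewrite (key _ c4) => s0.
have /freeP/(_ (fun l => _) s0 (Ordinal l4)) := basis_free bB; exact.
Qed.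

End Evaluation.

Lemma alg_iso_sym (k : fieldType) (A B : algebra k) :
  alg_iso A B -> alg_iso B A.
Proof.
move=> [f [[g fK gK] fM]].
have glin : linear g by move=> c x y; apply: (can_inj fK); rewrite linearP !gK.
pose h : {linear B -> A} := HB.pack g (GRing.isLinear.Build k B A *:%R g glin).
exists h; split; first by exists f.
by move=> x y; apply: (can_inj fK); rewrite /h /= fM !gK.
Qed.

(** * Nullities are isomorphism invariants *)

Section NullityInvariant.
Variables (k : fieldType) (red : Z -> Z) (ok : Z -> bool).
Hypothesis redE : forall z, zr k (red z) = zr k z.
Hypothesis okP : forall z, ok z -> zr k z != 0.

Definition reduced_system t nv P : seq (seq Z) :=
  [seq [seq red z | z <- r] | r <- identity_system t nv P].

Lemma reduced_systemP t nv P phi :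
  @solution k (reduced_system t nv P) phi <->
  solution (identity_system t nv P) phi.
Proof.
split=> sol r rs; first by rewrite -(dot_red redE); apply/sol/map_f.
by case/mapP: rs => r' /sol h ->; rewrite dot_red.
Qed.

Lemma size_reduced_system t nv P :
  all (fun r => size r <= 16)%N (reduced_system t nv P).
Proof.
apply/allP => r /mapP[r' /flatten_mapP[c _ /mapP[l _ ->]] ->].
by rewrite !size_map size_iota.
Qed.

(** Conjugation by the isomorphism carries the maps satisfying [P] on [A] injectively to those on
    [B]. *)
Lemma nullity_le (A B : algebra k) (a : 4.-tuple A) (b : 4.-tuple B) tA tB
    nv P dA dB :
  basis_of fullv a -> basis_of fullv b ->
  (forall i j : 'I_4, mul2 a`_i a`_j = den a (zproduct tA i j)) ->
  (forall i j : 'I_4, mul2 b`_i b`_j = den b (zproduct tB i j)) ->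
  alg_iso A B -> multilinear nv P ->
  nullity red ok 16 (reduced_system tA nv P) = Some dA ->
  nullity red ok 16 (reduced_system tB nv P) = Some dB -> (dA <= dB)%N.
Proof.
move=> aB bB aM bM [f [[g fK gK] fM]] mlin nA nB.
have [th [th1 _ th3]] := nullityP redE okP (size_reduced_system tA nv P) nA.
have [th' [_ th2' _]] := nullityP redE okP (size_reduced_system tB nv P) nB.
have f2 x y : f (mul2 x y) = mul2 (f x) (f y) by rewrite /mul2 linearZ fM.
have glin : linear g.
  by move=> c x y; apply: (can_inj fK); rewrite linearP !gK.
have [F FE] : exists F : nat -> {linear A -> A},
    forall r x, F r x = matrix_map a (th r) x.
  by exists (fun r => matrix_map a (th r)).
pose phi r i := coord b (inord (i %% 4)) (f (F r (g b`_(i %/ 4)))).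
have phiE r x : matrix_map b (phi r) x = f (F r (g x)).
  rewrite {2}(coord_basis bB (memvf x)).
  have -> : g (\sum_i coord b i x *: b`_i) = \sum_i coord b i x *: g b`_i.
    apply: (can_inj fK); rewrite gK linear_sum; apply: eq_bigr => i _.
    by rewrite linearZ /= gK.
  rewrite !linear_sum; apply: eq_bigr => i _; rewrite !linearZ /=.
  rewrite [f _ in RHS](coord_basis bB (memvf _)) scaler_sumr.
  apply: eq_bigr => j _; rewrite scalerA /phi; congr ((_ * coord b _ _) *: _).
    by rewrite mulnC modnMDl modn_small // inord_val.
  by rewrite mulnC divnMDl // divn_small // addn0.
have sat r : (r < dA)%N -> satisfies (matrix_map b (phi r)) P.
  move=> rd e; have /reduced_systemP/(identity_systemP aB aM _ mlin) := th1 r rd.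
  move=> /(_ (g \o e)) /(congr1 f); rewrite linear0 => <-.
  rewrite /peval linear_sum; apply: eq_bigr => q _; rewrite linearZ /=.
  congr (_ *: _); elim: q.2 => [j|s IHs u IHu|s IHs] /=; first by rewrite gK.
    by rewrite IHs IHu f2.
  by rewrite IHs phiE fK FE.
have /fin_all_exists[c cE] (r : 'I_dA) : exists c : nat -> k,
    forall i, (i < 16)%N -> phi r i = \sum_(s < dB) c s * th' s i.
  apply: th2'; apply/reduced_systemP/(identity_systemP bB bM _ mlin).
  exact: sat.
(* The rows are the coordinates of the transported solutions in the basis of solutions for [B].
   Their independence bounds their number by [dB]. *)
pose C : 'M[k]_(dA, dB) := \matrix_(r, s) c r s.
suff : row_free C by rewrite /row_free => /eqP <-; apply: rank_leq_col.
apply: inj_row_free => v v0; apply/rowP => r0; rewrite mxE.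
pose w r := if insub r is Some r' then v 0 r' else 0.
have wE (r : 'I_dA) : w r = v 0 r by rewrite /w valK.
rewrite -wE; apply: th3 (ltn_ord r0).
have phi0 i : (i < 16)%N -> \sum_(r < dA) w r * phi r i = 0.
  move=> i16.
  have wc (s : 'I_dB) : \sum_(r < dA) w r * c r s = 0.
    have /rowP/(_ s) := v0; rewrite !mxE => s0; rewrite -[RHS]s0.
    by apply: eq_bigr => r _; rewrite mxE wE.
  under eq_bigr do rewrite cE // mulr_sumr.
  rewrite exchange_big big1 // => s _; under eq_bigr do rewrite mulrA.
  by rewrite -mulr_suml wc mul0r.
have sumF0 y : \sum_(r < dA) w r *: F r y = 0.
  apply: (can_inj fK); rewrite linear_sum linear0 -[y]fK.
  under eq_bigr do rewrite linearZ /= -phiE /matrix_map scaler_sumr.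
  rewrite exchange_big big1 // => i _; under eq_bigr do rewrite scaler_sumr.
  rewrite exchange_big big1 // => j _; under eq_bigr do rewrite scalerA mulrCA.
  rewrite -scaler_suml -mulr_sumr phi0 ?mulr0 ?scale0r //.
  by case: i j => i i4 [j j4] /=; lia.
move=> i i16.
have i4 : (i %/ 4 < 4)%N by rewrite ltn_divLR.
have thE r : th r i = coord a (inord (i %% 4)) (F r a`_(i %/ 4)).
  rewrite FE /matrix_map (bigD1 (Ordinal i4)) //= [X in _ + X]big1 => [|l li].
    rewrite addr0 coord_sum_free ?(basis_free aB) //.
    rewrite (coord_free (Ordinal i4)) ?(basis_free aB) // eqxx mul1r.
    by rewrite inordK ?ltn_mod // mulnC -divn_eq.
  rewrite big1 // => j _; rewrite (coord_free (Ordinal i4)) ?(basis_free aB) //.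
  by rewrite eq_sym (negPf li) mul0r scale0r.
under eq_bigr do rewrite thE -[_ * _]linearZ.
by rewrite -linear_sum sumF0 linear0.
Qed.

Lemma nullity_eq (A B : algebra k) (a : 4.-tuple A) (b : 4.-tuple B) tA tB
    nv P dA dB :
  basis_of fullv a -> basis_of fullv b ->
  (forall i j : 'I_4, mul2 a`_i a`_j = den a (zproduct tA i j)) ->
  (forall i j : 'I_4, mul2 b`_i b`_j = den b (zproduct tB i j)) ->
  alg_iso A B -> multilinear nv P ->
  nullity red ok 16 (reduced_system tA nv P) = Some dA ->
  nullity red ok 16 (reduced_system tB nv P) = Some dB -> dA = dB.
Proof.
move=> aB bB aM bM iAB mlin nA nB; apply/eqP; rewrite eqn_leq.
rewrite (nullity_le aB bB aM bM iAB mlin nA nB).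
exact: nullity_le bB aB bM aM (alg_iso_sym iAB) mlin nB nA.
Qed.

End NullityInvariant.

(** * The chosen identities and the computed profiles *)

Definition mod3 (z : Z) : Z := Z.sub (Z.modulo (Z.add z 1) 3) 1.

(** Recognizes products of 2 and 3. Running out of fuel rejects the number, which can only cost an
    answer of [nullity], never make it wrong. *)
Fixpoint smooth (fuel : nat) (p : positive) : bool :=
  match fuel, p with
  | _, xH => true
  | f.+1, xO q => smooth f q
  | f.+1, _ =>
      let q := Z.div (Zpos p) 3 in
      Z.eqb (Z.mul q 3) (Zpos p) && (if q is Zpos q' then smooth f q' else false)
  | _, _ => false
  end.

Definition three_smooth (z : Z) : bool :=
  match z with Z0 => false | Zpos p => smooth 10 p | Zneg p => smooth 10 p end.

(* [a F(x y) + b F(x) y + c x F(y) = 0] *)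
Definition linear_identity (a b c : Z) : fidentity :=
  [seq q <- [:: (a, App (Mul (Var 0) (Var 1))); (b, Mul (App (Var 0)) (Var 1));
                (c, Mul (Var 0) (App (Var 1)))] | ~~ Z.eqb q.1 Z0].

(** In order: derivations; maps with F(x)y = xF(y); the centroid, when 3 is invertible; maps with
    F(xy) = 2F(x)y = 2xF(y); maps with F(x)y = xF(y) that vanish on products; and two twisted
    derivations, with factors 2 and 1/2. The third to fifth descriptions follow by exchanging x and
    y. All terms contain one product, so doubling the product changes nothing. *)
Definition identities : seq fidentity :=
  [:: linear_identity 1 (-1) (-1); linear_identity 0 1 (-1);
      linear_identity 1 (-2) 1; linear_identity 1 (-3) 1;
      linear_identity 1 (-2) 2; linear_identity 1 (-2) (-2);
      linear_identity 2 (-1) (-1)].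

Definition profile (m3 : bool) (t : ztable) : seq (option nat) :=
  let red := if m3 then mod3 else id in
  let ok := if m3 then (fun z => ~~ Z.eqb (mod3 z) Z0) else three_smooth in
  [seq nullity red ok 16 (reduced_system red t 2 P) | P <- identities].

Lemma identities_multilinear : all (multilinear 2) identities.
Proof. by []. Qed.

Definition distinguishes (p q : seq (option nat)) : bool :=
  has (fun x => if x is (Some a, Some b) then a != b else false) (zip p q).

(* The pairs of algebras, numbered from 0, that the profiles may confuse. *)
Definition twins : seq (nat * nat) :=
  [:: (21, 26); (20, 42); (37, 46); (26, 38); (54, 55); (13, 56)]%N.

Definition separated (m3 : bool) : bool :=
  let ps := [seq profile m3 t | t <- Jtables] in
  all (fun j => all (fun i => ((i, j) \in twins) ||
    distinguishes (nth [::] ps i) (nth [::] ps j)) (iota 0 j)) (iota 0 73).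

Lemma profiles_separated m3 : separated m3.
Proof. by case: m3; vm_compute. Qed.

Definition associator_identity : fidentity :=
  [:: (Zpos xH, App (Mul (Mul (Var 0) (Var 1)) (Var 2)));
      (Zneg xH, App (Mul (Var 0) (Mul (Var 1) (Var 2))))].

(** The maps vanishing on an r-dimensional space of associators form a space of dimension 4(4 - r).
    For J_55 the associators span n_2 and n_3, for J_56 only n_3. *)
Lemma associator_separated m3 :
  let red := if m3 then mod3 else id in
  let ok := if m3 then (fun z => ~~ Z.eqb (mod3 z) Z0) else three_smooth in
  let nul i :=
    nullity red ok 16 (reduced_system red (nth [::] Jtables i) 3
      associator_identity) in
  nul 54%N = Some 8%N /\ nul 55%N = Some 12%N.
Proof. by case: m3; vm_compute; split. Qed.

Section Separation.
Variable k : fieldType.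
Hypothesis two_neq0 : (2 : k) != 0.

Lemma J_basis (i : 'I_73) : exists2 b : 4.-tuple (J k i), basis_of fullv b &
  forall u v : 'I_4,
    mul2 b`_u b`_v = den b (zproduct (nth [::] Jtables i) u v).
Proof.
have [b bB bM] := J_has_constants k i; exists b => // u v.
rewrite /mul2 bM scaler_sumr; apply: eq_bigr => l _.
by rewrite /half_constants half_ofE // scalerA mulrC divfK.
Qed.

Lemma alg_iso_nullity red (ok : Z -> bool) (i j : 'I_73) nv P :
  (forall z, zr k (red z) = zr k z) -> (forall z, ok z -> zr k z != 0) ->
  let nul t := nullity red ok 16 (reduced_system red t nv P) in
  multilinear nv P -> alg_iso (J k i) (J k j) -> forall di dj,
  nul (nth [::] Jtables i) = Some di -> nul (nth [::] Jtables j) = Some dj ->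
  di = dj.
Proof.
move=> redE okP nul mlin iAB di dj; have [a aB aM] := J_basis i.
have [b bB bM] := J_basis j.
exact: (nullity_eq redE okP aB bB aM bM iAB mlin).
Qed.

Lemma zr_mod3 z : (3 : k) = 0 -> zr k (mod3 z) = zr k z.
Proof.
move=> k3; rewrite /mod3 -[in RHS](Z.add_simpl_r z 1).
have -> : Z.sub (Z.modulo (Z.add z 1) 3) 1 =
  Z.add (Z.sub (Z.add z 1) 1) (Z.mul (Zpos 3) (Z.opp (Z.div (Z.add z 1) 3))).
  by have := Z.div_mod (Z.add z 1) 3; lia.
by rewrite zrD zrM (_ : zr k (Zpos 3) = 3) // k3 mul0r addr0.
Qed.

Lemma mod3_neq0 z : (3 : k) = 0 -> ~~ Z.eqb (mod3 z) Z0 -> zr k z != 0.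
Proof.
move=> k3 z0; rewrite -zr_mod3 //; move: z0.
have : mod3 z = Zneg xH \/ mod3 z = Z0 \/ mod3 z = Zpos xH.
  by have := Z.mod_pos_bound (Z.add z 1) 3; rewrite /mod3; lia.
case=> [->|[->|->]] /= z0; rewrite ?zrN1 ?zr1 ?oppr_eq0 ?oner_neq0 //.
Qed.

Lemma three_smooth_neq0 z : (3 : k) != 0 -> three_smooth z -> zr k z != 0.
Proof.
move=> k3.
have sm f p : smooth f p -> zr k (Zpos p) != 0.
  elim: f p => [|f IH] [p|p|]; rewrite ?zr1 ?oner_neq0 //.
    pose q := Z.div (Zpos p~1) 3; move=> sp.
    have : Z.eqb (Z.mul q 3) (Zpos p~1) &&
        (if q is Zpos q' then smooth f q' else false) := sp.
    case/andP=> /Z.eqb_spec <-; case: q => // q /IH q0.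
    by rewrite zrM mulf_neq0.
  move=> /IH p0; rewrite (_ : Zpos p~0 = Z.mul (Zpos 2) (Zpos p)) //.
  by rewrite zrM mulf_neq0.
case: z => // p sp; have p0 := sm 10%N p sp; first exact: p0.
rewrite (_ : Zneg p = Z.opp (Zpos p)) //.
by rewrite zrN oppr_eq0.
Qed.

Lemma distinguishesP (T : Type) (p : pred T) (f g : T -> option nat) s :
  all p s -> distinguishes [seq f x | x <- s] [seq g x | x <- s] ->
  exists x d e, [/\ p x, f x = Some d, g x = Some e & d != e].
Proof.
elim: s => //= x s IH /andP[px ps] /orP[|]; last exact: IH.
case fE: (f x) => [d|] //; case gE: (g x) => [e|] // de.
by exists x, d, e; rewrite px fE gE.
Qed.

Lemma elimination_mode : exists (red : Z -> Z) (ok : Z -> bool) (m3 : bool), [/\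
    forall z, zr k (red z) = zr k z,
    forall z, ok z -> zr k z != 0,
    red = (if m3 then mod3 else id) &
    ok = if m3 then (fun z => ~~ Z.eqb (mod3 z) Z0) else three_smooth].
Proof.
have [k3|k3] := eqVneq (3 : k) 0.
  exists mod3, (fun z => ~~ Z.eqb (mod3 z) Z0), true; split=> // z.
    exact: zr_mod3.
  exact: mod3_neq0.
by exists id, three_smooth, false; split=> // z; apply: three_smooth_neq0.
Qed.

Lemma alg_iso_twins (i j : 'I_73) : (i < j)%N -> alg_iso (J k i) (J k j) ->
  ((i : nat), (j : nat)) \in twins.
Proof.
move=> ij iij; have [red [ok [m3 [redE okP eR eO]]]] := elimination_mode.
have /allP sep := profiles_separated m3.
have in73 (n : nat) : (n < 73)%N -> n \in iota 0 73 by rewrite mem_iota.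
have nthp (l : 'I_73) : nth [::] [seq profile m3 t | t <- Jtables] l =
    profile m3 (nth [::] Jtables l).
  by rewrite (nth_map [::]) // ltn_ord.
have /allP/(_ (i : nat)) := sep _ (in73 _ (ltn_ord j)).
rewrite mem_iota ij /= => /(_ isT) /orP[// |].
rewrite !nthp /profile -eR -eO => /(distinguishesP identities_multilinear).
move=> [P [di [dj [mP ni nj]]]].
by rewrite (alg_iso_nullity redE okP mP iij ni nj) eqxx.
Qed.

Lemma J55_J56_not_iso : ~ alg_iso (J k (inord 54)) (J k (inord 55)).
Proof.
have [red [ok [m3 [redE okP eR eO]]]] := elimination_mode.
move=> iij; have [] := associator_separated m3; rewrite -eR -eO => n1 n2.
have mA : multilinear 3 associator_identity by [].
have h := alg_iso_nullity redE okP mA iij; rewrite !inordK // in h.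
by have := h _ _ n1 n2.
Qed.

End Separation.

(** * Presentations by coordinates *)

Section Presentations.
Variable k : fieldType.
Implicit Types A B : algebra k.

(** With explicit quadruples, an identity between products unfolds to four scalar goals for [ring]
    and [field]. *)
Definition quad : Type := (k * k * k * k)%type.

Definition q0 (v : quad) : k := v.1.1.1.
Definition q1 (v : quad) : k := v.1.1.2.
Definition q2 (v : quad) : k := v.1.2.
Definition q3 (v : quad) : k := v.2.

(* The products of a commutative algebra with a basis indexed by 0, 1, 2, 3. *)
Record tab := Tab {
  t00 : quad; t01 : quad; t02 : quad; t03 : quad; t11 : quad;
  t12 : quad; t13 : quad; t22 : quad; t23 : quad; t33 : quad }.

Definition tab_coef (S : tab) (f : quad -> k) (x y : quad) : k :=
  q0 x * q0 y * f (t00 S) + (q0 x * q1 y + q1 x * q0 y) * f (t01 S) +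
  (q0 x * q2 y + q2 x * q0 y) * f (t02 S) +
  (q0 x * q3 y + q3 x * q0 y) * f (t03 S) +
  q1 x * q1 y * f (t11 S) + (q1 x * q2 y + q2 x * q1 y) * f (t12 S) +
  (q1 x * q3 y + q3 x * q1 y) * f (t13 S) +
  q2 x * q2 y * f (t22 S) + (q2 x * q3 y + q3 x * q2 y) * f (t23 S) +
  q3 x * q3 y * f (t33 S).

Definition tab_mul (S : tab) (x y : quad) : quad :=
  (tab_coef S q0 x y, tab_coef S q1 x y, tab_coef S q2 x y, tab_coef S q3 x y).

Section Combination.
Variables (V : lmodType k) (b0 b1 b2 b3 : V).

Definition comb (v : quad) : V :=
  q0 v *: b0 + q1 v *: b1 + q2 v *: b2 + q3 v *: b3.

Lemma comb_add v w : comb v + comb w =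
  comb (q0 v + q0 w, q1 v + q1 w, q2 v + q2 w, q3 v + q3 w).
Proof. by rewrite /comb /= !scalerDl addrACA (addrACA _ _ _ (q2 w *: b2)) (addrACA _ _ _ (q1 w
  *: b1)). Qed.

Lemma comb_scale a v : a *: comb v = comb (a * q0 v, a * q1 v, a * q2 v, a * q3 v).
Proof. by rewrite /comb !scalerDr !scalerA. Qed.

Lemma comb_sum (s : seq (k * quad)) : \sum_(p <- s) p.1 *: comb p.2 =
  comb (\sum_(p <- s) p.1 * q0 p.2, \sum_(p <- s) p.1 * q1 p.2,
    \sum_(p <- s) p.1 * q2 p.2, \sum_(p <- s) p.1 * q3 p.2).
Proof.
elim: s => [|p s IH]; first by rewrite !big_nil /comb !scale0r !addr0.
by rewrite !big_cons IH comb_scale comb_add.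
Qed.

Lemma comb_opp v : - comb v = comb (- q0 v, - q1 v, - q2 v, - q3 v).
Proof. by rewrite /comb /= !scaleNr !opprD. Qed.

End Combination.

Definition presents A (S : tab) : Prop :=
  exists b0 b1 b2 b3 : A, let m := @amul k A in let c := comb b0 b1 b2 b3 in
  [/\ basis_of fullv [:: b0; b1; b2; b3],
      [/\ m b0 b0 = c (t00 S), m b0 b1 = c (t01 S), m b0 b2 = c (t02 S) &
          m b0 b3 = c (t03 S)],
      [/\ m b1 b1 = c (t11 S), m b1 b2 = c (t12 S) & m b1 b3 = c (t13 S)],
      [/\ m b2 b2 = c (t22 S), m b2 b3 = c (t23 S) & m b3 b3 = c (t33 S)] &
      forall x y, m x y = m y x].

Lemma quad_eq (v w : quad) :
  q0 v = q0 w -> q1 v = q1 w -> q2 v = q2 w -> q3 v = q3 w -> v = w.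
Proof.
case: v w => [[[v0 v1] v2] v3] [[[w0 w1] w2] w3].
by rewrite /q0 /q1 /q2 /q3 /= => -> -> -> ->.
Qed.

Section FreeBasis.
Variables (V : vectType k) (b0 b1 b2 b3 : V).
Local Notation c := (comb b0 b1 b2 b3).

Lemma comb_big v : c v =
  \sum_(i < 4) [:: q0 v; q1 v; q2 v; q3 v]`_i *: [:: b0; b1; b2; b3]`_i.
Proof. by rewrite !big_ord_recl big_ord0 /= addr0 !addrA. Qed.

Lemma comb_eq0 v : free [:: b0; b1; b2; b3] -> c v = 0 -> v = (0, 0, 0, 0).
Proof.
move=> f cv; have /freeP h : free [tuple b0; b1; b2; b3] by [].
have {}h i : [:: q0 v; q1 v; q2 v; q3 v]`_(i : 'I_4) = 0.
  by apply: (h (fun i : 'I_4 => [:: q0 v; q1 v; q2 v; q3 v]`_i)); rewrite -comb_big.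
apply: quad_eq; [exact: (h ord0) | exact: (h (@Ordinal 4 1 isT))
  | exact: (h (@Ordinal 4 2 isT)) | exact: (h ord_max)].
Qed.

Lemma comb_inj : free [:: b0; b1; b2; b3] -> injective c.
Proof.
move=> f v w /eqP; rewrite -subr_eq0 comb_opp comb_add => /eqP /(comb_eq0 f).
by case=> /subr0_eq v0 /subr0_eq v1 /subr0_eq v2 /subr0_eq v3; apply: quad_eq.
Qed.

Lemma free_of_comb :
  (forall v, c v = 0 -> v = (0, 0, 0, 0)) -> free [:: b0; b1; b2; b3].
Proof.
move=> h; have -> : [:: b0; b1; b2; b3] = [tuple b0; b1; b2; b3] by [].
apply/freeP => a a0.
have := h (a ord0, a (@Ordinal 4 1 isT), a (@Ordinal 4 2 isT), a ord_max).
have -> : c (a ord0, a (@Ordinal 4 1 isT), a (@Ordinal 4 2 isT), a ord_max) = 0.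
  rewrite -[RHS]a0 /comb !big_ord_recl big_ord0 /= addr0 !addrA.
  by congr (_ *: _ + _ *: _ + _ *: _ + _ *: _); congr a; apply: val_inj.
move=> /(_ erefl) [h0 h1 h2 h3] i.
have : i \in [:: ord0; @Ordinal 4 1 isT; @Ordinal 4 2 isT; ord_max].
  by rewrite !inE -!val_eqE /=; case: i => [[|[|[|[|]]]]].
by rewrite !inE => /or4P[] /eqP ->.
Qed.

Lemma comb_surj : basis_of fullv [:: b0; b1; b2; b3] -> forall x, exists v, x = c v.
Proof.
move=> bB x.
have {}bB : basis_of fullv [tuple b0; b1; b2; b3] by [].
rewrite (coord_basis bB (memvf x)).
exists (coord [tuple b0; b1; b2; b3] ord0 x, coord [tuple b0; b1; b2; b3] (@Ordinal 4 1 isT) x,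
  coord [tuple b0; b1; b2; b3] (@Ordinal 4 2 isT) x, coord [tuple b0; b1; b2; b3] ord_max x).
rewrite /comb !big_ord_recl big_ord0 /= addr0 !addrA.
congr (_ *: _ + _ *: _ + _ *: _ + _ *: _); congr coord; exact: val_inj.
Qed.

Lemma basis_of_free : \dim {: V} = 4%N -> free [:: b0; b1; b2; b3] ->
  basis_of fullv [:: b0; b1; b2; b3].
Proof. by move=> d f; rewrite basisEfree f subvf d. Qed.

End FreeBasis.

Lemma amul_comb A (S : tab) (b0 b1 b2 b3 : A) :
  let m := @amul k A in let c := comb b0 b1 b2 b3 in
  [/\ m b0 b0 = c (t00 S), m b0 b1 = c (t01 S), m b0 b2 = c (t02 S) &
      m b0 b3 = c (t03 S)] ->
  [/\ m b1 b1 = c (t11 S), m b1 b2 = c (t12 S) & m b1 b3 = c (t13 S)] ->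
  [/\ m b2 b2 = c (t22 S), m b2 b3 = c (t23 S) & m b3 b3 = c (t33 S)] ->
  (forall x y, m x y = m y x) ->
  forall x y, m (c x) (c y) = c (tab_mul S x y).
Proof.
move=> m c [e00 e01 e02 e03] [e11 e12 e13] [e22 e23 e33] mC x y.
have e10 : m b1 b0 = c (t01 S) by rewrite mC.
have e20 : m b2 b0 = c (t02 S) by rewrite mC.
have e30 : m b3 b0 = c (t03 S) by rewrite mC.
have e21 : m b2 b1 = c (t12 S) by rewrite mC.
have e31 : m b3 b1 = c (t13 S) by rewrite mC.
have e32 : m b3 b2 = c (t23 S) by rewrite mC.
rewrite {1 2}/c /m /comb !linearDl !linearDr !linearZl_LR !linearZr_LR -/m.
rewrite e00 e01 e02 e03 e10 e11 e12 e13 e20 e21 e22 e23 e30 e31 e32 e33 !scalerA.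
transitivity (\sum_(p <- [::
      (q0 x * q0 y, t00 S); (q0 x * q1 y, t01 S); (q0 x * q2 y, t02 S);
      (q0 x * q3 y, t03 S); (q1 x * q0 y, t01 S); (q1 x * q1 y, t11 S);
      (q1 x * q2 y, t12 S); (q1 x * q3 y, t13 S); (q2 x * q0 y, t02 S);
      (q2 x * q1 y, t12 S); (q2 x * q2 y, t22 S); (q2 x * q3 y, t23 S);
      (q3 x * q0 y, t03 S); (q3 x * q1 y, t13 S); (q3 x * q2 y, t23 S);
      (q3 x * q3 y, t33 S)]) p.1 *: c p.2).
  by rewrite !big_cons big_nil addr0 !addrA.
rewrite comb_sum; congr comb.
by apply: quad_eq; rewrite /tab_mul /tab_coef /q0 /q1 /q2 /q3 /= !big_cons !big_nil /=; ring.
Qed.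

Definition jordan_tab (S : tab) : Prop := forall x y,
  tab_mul S (tab_mul S (tab_mul S x x) y) x =
  tab_mul S (tab_mul S x x) (tab_mul S y x).

Lemma presents_jordan A S : jordan A -> presents A S -> jordan_tab S.
Proof.
move=> [_ jA] [b0 [b1 [b2 [b3 [bB e0 e1 e2 mC]]]]] x y.
have M := amul_comb e0 e1 e2 mC.
by apply: (comb_inj (basis_free bB)); rewrite -!M jA.
Qed.

(** The intermediate products are supplied by hand, so that each remaining goal expands only one or
    two products instead of the whole nested expression. *)
Lemma jordan_coef (f : quad -> k) (d t : k) S x y xx yx xxy : jordan_tab S ->
  tab_mul S x x = xx -> tab_mul S y x = yx -> tab_mul S xx y = xxy ->
  t = d * (f (tab_mul S xxy x) - f (tab_mul S xx yx)) -> t = 0.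
Proof. by move=> j <- <- <- ->; rewrite j subrr mulr0. Qed.

Definition tab_constants (S : tab) (i j l : nat) : k :=
  let r :=
    [:: [:: t00 S; t01 S; t02 S; t03 S]; [:: t01 S; t11 S; t12 S; t13 S];
        [:: t02 S; t12 S; t22 S; t23 S]; [:: t03 S; t13 S; t23 S; t33 S]] in
  let v := nth (t00 S) (nth [::] r i) j in [:: q0 v; q1 v; q2 v; q3 v]`_l.

Lemma presents_constants A S :
  presents A S -> has_constants A 4 (tab_constants S).
Proof.
move=> [b0 [b1 [b2 [b3 [bB [e00 e01 e02 e03] [e11 e12 e13] [e22 e23 e33] mC]]]]].
exists [tuple b0; b1; b2; b3] => //.
move=> [[|[|[|[|i]]]] //= i4] [[|[|[|[|j]]]] //= j4]; last first.
all: rewrite ?e00 ?e01 ?e02 ?e03 ?e11 ?e12 ?e13 ?e22 ?e23 ?e33.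
all: try by rewrite comb_big.
all: rewrite mC ?e00 ?e01 ?e02 ?e03 ?e11 ?e12 ?e13 ?e22 ?e23 ?e33.
all: by rewrite comb_big.
Qed.

Definition quad_comb (P0 P1 P2 P3 v : quad) : quad :=
  (q0 v * q0 P0 + q1 v * q0 P1 + q2 v * q0 P2 + q3 v * q0 P3,
   q0 v * q1 P0 + q1 v * q1 P1 + q2 v * q1 P2 + q3 v * q1 P3,
   q0 v * q2 P0 + q1 v * q2 P1 + q2 v * q2 P2 + q3 v * q2 P3,
   q0 v * q3 P0 + q1 v * q3 P1 + q2 v * q3 P2 + q3 v * q3 P3).

Lemma comb_quad_comb (V : lmodType k) (b0 b1 b2 b3 : V) P0 P1 P2 P3 v :
  let c := comb b0 b1 b2 b3 in
  comb (c P0) (c P1) (c P2) (c P3) v = c (quad_comb P0 P1 P2 P3 v).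
Proof.
move=> c; transitivity (\sum_(p <- [:: (q0 v, P0); (q1 v, P1); (q2 v, P2);
    (q3 v, P3)]) p.1 *: c p.2).
  by rewrite !big_cons big_nil addr0 !addrA.
rewrite comb_sum !big_cons !big_nil /=.
by congr comb; apply: quad_eq; rewrite /q0 /q1 /q2 /q3 /= addr0 !addrA.
Qed.

(* [P] lists the new basis in terms of the old one, [Q] the old basis in terms
   of the new one. *)
Lemma rebase A S S' (P0 P1 P2 P3 Q0 Q1 Q2 Q3 : quad) :
  presents A S ->
  let P := quad_comb P0 P1 P2 P3 in let m := tab_mul S in
  [/\ P Q0 = (1, 0, 0, 0), P Q1 = (0, 1, 0, 0), P Q2 = (0, 0, 1, 0) &
      P Q3 = (0, 0, 0, 1)] ->
  [/\ m P0 P0 = P (t00 S'), m P0 P1 = P (t01 S'), m P0 P2 = P (t02 S') &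
      m P0 P3 = P (t03 S')] ->
  [/\ m P1 P1 = P (t11 S'), m P1 P2 = P (t12 S') & m P1 P3 = P (t13 S')] ->
  [/\ m P2 P2 = P (t22 S'), m P2 P3 = P (t23 S') & m P3 P3 = P (t33 S')] ->
  presents A S'.
Proof.
move=> [b0 [b1 [b2 [b3 [bB e0 e1 e2 mC]]]]] P m [Pe0 Pe1 Pe2 Pe3].
move=> [f00 f01 f02 f03] [f11 f12 f13] [f22 f23 f33].
have M := amul_comb e0 e1 e2 mC; pose c := comb b0 b1 b2 b3.
have cP := comb_quad_comb b0 b1 b2 b3 P0 P1 P2 P3.
exists (c P0), (c P1), (c P2), (c P3); split=> //.
- have d4 := size_basis (n := 4) (X := [tuple b0; b1; b2; b3]) bB.
  rewrite basisEdim d4 andbT -(span_basis bB).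
  have cE v : comb (c P0) (c P1) (c P2) (c P3) v \in <<[:: c P0; c P1; c P2; c P3]>>%VS.
    by rewrite /comb !memvD // memvZ // memv_span // !inE eqxx ?orbT.
  apply/span_subvP => x; rewrite !inE => /or4P[] /eqP ->.
  + have := cE Q0; rewrite cP -/P Pe0.
    by rewrite /comb /q0 /q1 /q2 /q3 /= scale1r !scale0r !addr0.
  + have := cE Q1; rewrite cP -/P Pe1.
    by rewrite /comb /q0 /q1 /q2 /q3 /= scale1r !scale0r !addr0 add0r.
  + have := cE Q2; rewrite cP -/P Pe2.
    by rewrite /comb /q0 /q1 /q2 /q3 /= scale1r !scale0r !addr0 !add0r.
  + have := cE Q3; rewrite cP -/P Pe3.
    by rewrite /comb /q0 /q1 /q2 /q3 /= scale1r !scale0r !add0r.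
- by split; rewrite cP -/P -?f00 -?f01 -?f02 -?f03; apply: M.
- by split; rewrite cP -/P -?f11 -?f12 -?f13; apply: M.
- by split; rewrite cP -/P -?f22 -?f23 -?f33; apply: M.
Qed.

Definition half_quad (v : seq Z) : quad :=
  (half_of k (nth Z0 v 0), half_of k (nth Z0 v 1), half_of k (nth Z0 v 2),
   half_of k (nth Z0 v 3)).

Definition half_tab (L : seq (seq Z)) : tab :=
  let v n := half_quad (nth [::] L n) in
  Tab (v 0%N) (v 1%N) (v 2%N) (v 3%N) (v 4%N) (v 5%N) (v 6%N) (v 7%N) (v 8%N)
    (v 9%N).

Definition upper_products (t : ztable) : seq (seq Z) :=
  [seq zproduct t p.1 p.2 | p <- [:: (0, 0); (0, 1); (0, 2); (0, 3); (1, 1);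
    (1, 2); (1, 3); (2, 2); (2, 3); (3, 3)]%N].

Lemma presents_J A (i : 'I_73) :
  presents A (half_tab (upper_products (nth [::] Jtables i))) ->
  alg_iso A (J k i).
Proof.
move=> /presents_constants pA; apply: alg_iso_of_constants pA _.
have zC i' j' l' : half_constants k (nth [::] Jtables i) i' j' l' =
    half_constants k (nth [::] Jtables i) j' i' l'.
  by rewrite /half_constants /zcoef zproductC.
apply: eq_has_constants (J_has_constants k i).
by move=> [|[|[|[|a]]]] [|[|[|[|b]]]] [|[|[|[|c]]]] // _ _ _; rewrite ?[LHS]zC.
Qed.

Definition listed A : Prop := exists i : 'I_73, alg_iso A (J k i).

Lemma listed_of_products (n : nat) A : (n < 73)%N -> forall L,
  upper_products (nth [::] Jtables n) = L -> presents A (half_tab L) -> listed A.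
Proof. by move=> n73 L <- pA; exists (Ordinal n73); apply: presents_J. Qed.

Lemma rebase_J (n : nat) A S (P0 P1 P2 P3 Q0 Q1 Q2 Q3 : quad) :
  presents A S -> (n < 73)%N -> forall L,
  upper_products (nth [::] Jtables n) = L ->
  let S' := half_tab L in
  let P := quad_comb P0 P1 P2 P3 in let m := tab_mul S in
  [/\ P Q0 = (1, 0, 0, 0), P Q1 = (0, 1, 0, 0), P Q2 = (0, 0, 1, 0) &
      P Q3 = (0, 0, 0, 1)] ->
  [/\ m P0 P0 = P (t00 S'), m P0 P1 = P (t01 S'), m P0 P2 = P (t02 S') &
      m P0 P3 = P (t03 S')] ->
  [/\ m P1 P1 = P (t11 S'), m P1 P2 = P (t12 S') & m P1 P3 = P (t13 S')] ->
  [/\ m P2 P2 = P (t22 S'), m P2 P3 = P (t23 S') & m P3 P3 = P (t33 S')] ->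
  listed A.
Proof.
move=> pA n73 L eL S' P m h1 h2 h3 h4; apply: (listed_of_products n73 eL).
exact: rebase pA h1 h2 h3 h4.
Qed.

End Presentations.

Ltac unfold_quads :=
  cbv [tab_mul tab_coef quad_comb half_tab half_quad half_of nth q0 q1 q2 q3
    fst snd t00 t01 t02 t03 t11 t12 t13 t22 t23 t33].

Ltac by_field :=
  solve [ring | field; rewrite ?andbT; by repeat (apply/andP; split)].

Ltac quad_field := apply: quad_eq; unfold_quads; by_field.

(* Proves [t = 0] when [t] is [d] times the component [f] of the Jordan identity
   for [x] and [y], given the intermediate products. *)
Tactic Notation "jordan" uconstr(f) uconstr(d) constr(j) uconstr(x) uconstr(y)
    uconstr(xx) uconstr(yx) uconstr(xxy) :=
  refine (@jordan_coef _ f d _ _ x y xx yx xxy j _ _ _ _);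
  [quad_field | quad_field | quad_field | unfold_quads; by_field].

Tactic Notation "rebase_by" constr(h)
    uconstr(P0) uconstr(P1) uconstr(P2) uconstr(P3)
    uconstr(Q0) uconstr(Q1) uconstr(Q2) uconstr(Q3) :=
  refine (@rebase _ _ _ _ P0 P1 P2 P3 Q0 Q1 Q2 Q3 h _ _ _ _); split; quad_field.

Tactic Notation "to_J" constr(n) constr(h)
    uconstr(P0) uconstr(P1) uconstr(P2) uconstr(P3)
    uconstr(Q0) uconstr(Q1) uconstr(Q2) uconstr(Q3) :=
  let L := eval vm_compute in (upper_products (nth [::] Jtables n)) in
  refine (@rebase_J _ n _ _ P0 P1 P2 P3 Q0 Q1 Q2 Q3 h isT L (erefl _) _ _ _ _);
  split; quad_field.

Tactic Notation "is_J" constr(n) constr(h) :=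
  let L := eval vm_compute in (upper_products (nth [::] Jtables n)) in
  exact: (@listed_of_products _ n _ isT L (erefl _) h).

(** * Tables with at least two idempotents *)

Lemma quadratic_root (k : closedFieldType) (a b : k) : exists x, x ^+ 2 = a + b * x.
Proof.
have [x xE] := @solve_monicpoly k 2 (fun i => if i is 0 then a else b) isT.
by exists x; rewrite xE !big_ord_recl big_ord0 /= expr0 expr1 mulr1 addr0.
Qed.

Lemma sqrt_exists (k : closedFieldType) (a : k) : exists s, s ^+ 2 = a.
Proof. by have [s] := quadratic_root a 0; rewrite mul0r addr0; exists s. Qed.

(* The normal form of the quadratic form [a X^2 + 2 b X Y + c Y^2]; the second
   vector of the new basis is isotropic. *)
Lemma binary_form (k : closedFieldType) (two_neq0 : (2 : k) != 0) (a b c : k) :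
  exists p q r s A B, p * s - q * r != 0 /\
   [/\ a * p ^+ 2 + 2 * b * p * q + c * q ^+ 2 = A,
       a * p * r + b * (p * s + q * r) + c * q * s = B,
       a * r ^+ 2 + 2 * b * r * s + c * s ^+ 2 = 0 &
       (A = 0 /\ B = 0) \/ (A = 1 /\ B = 0) \/ (A = 1 /\ B = 1)].
Proof.
(* An isotropic vector [(r, s)], which exists because the field has square roots, and a vector
   [(w1, w2)] independent of it. *)
have [w1 [w2 [r [s [d0 iso]]]]] : exists w1 w2 r s : k, w1 * s - w2 * r != 0 /\
    a * r ^+ 2 + 2 * b * r * s + c * s ^+ 2 = 0.
  have [c0|c0] := eqVneq c 0.
    exists 1, 0, 0, 1; split; first by rewrite mulr1 mulr0 subr0 oner_neq0.
    by rewrite c0; ring.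
  have [x xE] := quadratic_root (- (a / c)) (- (2 * b / c)).
  exists 0, 1, 1, x; split; first by rewrite mul0r mul1r sub0r oppr_eq0 oner_neq0.
  by rewrite xE; field.
pose Q := a * w1 ^+ 2 + 2 * b * w1 * w2 + c * w2 ^+ 2.
pose B := a * w1 * r + b * (w1 * s + w2 * r) + c * w2 * s.
have [B0|B0] := eqVneq B 0.
  have [Q0|Q0] := eqVneq Q 0.
    by exists w1, w2, r, s, 0, 0; split=> //; split=> //; left.
  have [t tE] := sqrt_exists Q.
  have t0 : t != 0 by apply: contraNneq Q0 => t0; rewrite -tE t0 expr0n.
  exists (w1 / t), (w2 / t), r, s, 1, 0; split.
    rewrite (_ : _ - _ = (w1 * s - w2 * r) / t); last by field.
    by rewrite mulf_neq0 // invr_neq0.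
  split=> //; last by right; left.
    rewrite (_ : _ + _ + _ = Q / t ^+ 2); last by rewrite /Q; field.
    by rewrite tE divff.
  transitivity (t^-1 * B); last by rewrite B0 mulr0.
  by rewrite /B; move: (_^-1) => u; ring.
(* The form takes the value Q/B^2 at w/B, whose pairing with the isotropic vector is 1; adding [t]
   times that vector raises the value by 2t, up to 1. *)
pose t := (1 - Q / B ^+ 2) / 2.
exists (B^-1 * w1 + t * r), (B^-1 * w2 + t * s), r, s, 1, 1; split.
  rewrite (_ : _ - _ = (w1 * s - w2 * r) / B); last by field.
  by rewrite mulf_neq0 // invr_neq0.
split=> //; last by right; right.
  transitivity (B^-1 ^+ 2 * Q + 2 * (B^-1 * t) * B +
      t ^+ 2 * (a * r ^+ 2 + 2 * b * r * s + c * s ^+ 2)).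
    by rewrite /Q /B; move: (_^-1) t => u t; ring.
  by rewrite iso /t; field; rewrite B0 two_neq0.
transitivity (B^-1 * B + t * (a * r ^+ 2 + 2 * b * r * s + c * s ^+ 2)).
  by move: (_^-1) t => u t; rewrite /B; ring.
by rewrite iso mulr0 addr0 mulVf.
Qed.

Section SeveralIdempotents.
Variables (k : closedFieldType) (A : algebra k).
Hypothesis two_neq0 : (2 : k) != 0.
Hypothesis jA : jordan A.
Local Notation "0q" := (0, 0, 0, 0).
Local Notation h := (2^-1 : k).

(** In the names that follow, the digits give the Peirce spaces A_ij of the basis vectors other than
    the idempotents, and parameters stand for the products that the Peirce rules leave open. *)
Lemma listed_four : presents A
    (Tab (1,0,0,0) 0q 0q 0q (0,1,0,0) 0q 0q (0,0,1,0) 0q (0,0,0,1)) ->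
  listed A.
Proof.
move=> pA; is_J 2%N pA.
Qed.

Lemma listed_three_00 : presents A
    (Tab (1,0,0,0) 0q 0q 0q (0,1,0,0) 0q 0q (0,0,1,0) 0q 0q) ->
  listed A.
Proof.
move=> pA; is_J 4%N pA.
Qed.

Lemma listed_three_11 : presents A
    (Tab (1,0,0,0) 0q 0q (0,0,0,1) (0,1,0,0) 0q 0q (0,0,1,0) 0q 0q) ->
  listed A.
Proof.
move=> pA; to_J 3%N pA (1,0,0,0) (0,0,0,1) (0,1,0,0) (0,0,1,0)
    (1,0,0,0) (0,0,1,0) (0,0,0,1) (0,1,0,0).
Qed.

(** For x in A_10 with x^2 = a e_1, comparing (x^2 e_1)x with x^2(e_1 x) gives a/2 = a/4. The same
    computation removes this parameter in all half-spaces of a single idempotent. *)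
Lemma listed_three_10 a : presents A
    (Tab (1,0,0,0) 0q 0q (0,0,0,h) (0,1,0,0) 0q 0q (0,0,1,0) 0q
      (a,0,0,0)) ->
  listed A.
Proof.
move=> pA; have j := presents_jordan jA pA.
have a0 : a = 0 by jordan (@q3 k) 4 j (0,0,0,1) (1,0,0,0) (a,0,0,0) (0,0,0,h) (a,0,0,0).
subst a; to_J 5%N pA (1,0,0,0) (0,0,0,1) (0,1,0,0) (0,0,1,0)
    (1,0,0,0) (0,0,1,0) (0,0,0,1) (0,1,0,0).
Qed.

(** For x in A_12 with x^2 = a e_1 + b e_2, the same comparison gives a/2 = (a + b)/4, so x^2 is a
    multiple of e_1 + e_2. The vector x is then scaled by a square root. *)
Lemma listed_three_12 a b : presents A
    (Tab (1,0,0,0) 0q 0q (0,0,0,h) (0,1,0,0) 0q (0,0,0,h) (0,0,1,0) 0q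
      (a,b,0,0)) ->
  listed A.
Proof.
move=> pA; have j := presents_jordan jA pA.
have /subr0_eq ab : a - b = 0
  by jordan (@q3 k) 4 j (0,0,0,1) (1,0,0,0) (a,b,0,0) (0,0,0,h) (a,0,0,0).
subst b; have [a0|a0] := eqVneq a 0.
  by subst a; to_J 6%N pA (1,0,0,0) (0,1,0,0) (0,0,0,1) (0,0,1,0)
    (1,0,0,0) (0,1,0,0) (0,0,0,1) (0,0,1,0).
have [s sE] := sqrt_exists a; have s0 : s != 0.
  by apply: contraNneq a0 => s0; rewrite -sE s0 expr0n.
subst a; to_J 0%N pA (1,0,0,0) (0,1,0,0) (0,0,0,s^-1) (0,0,1,0)
    (1,0,0,0) (0,1,0,0) (0,0,0,1) (0,0,s,0).
Qed.

Lemma listed_two_00_00_zero : presents A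
    (Tab (1,0,0,0) 0q 0q 0q (0,1,0,0) 0q 0q 0q 0q 0q) ->
  listed A.
Proof.
move=> pA; to_J 18%N pA (1,0,0,0) (0,0,1,0) (0,1,0,0) (0,0,0,1)
    (1,0,0,0) (0,0,1,0) (0,1,0,0) (0,0,0,1).
Qed.

Lemma listed_two_00_00 : presents A
    (Tab (1,0,0,0) 0q 0q 0q (0,1,0,0) 0q 0q (0,0,0,1) 0q 0q) ->
  listed A.
Proof.
move=> pA; to_J 25%N pA (0,0,1,0) (0,0,0,1) (1,0,0,0) (0,1,0,0)
    (0,0,1,0) (0,0,0,1) (1,0,0,0) (0,1,0,0).
Qed.

Lemma listed_two_00_11 : presents A
    (Tab (1,0,0,0) 0q 0q (0,0,0,1) (0,1,0,0) 0q 0q 0q 0q 0q) ->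
  listed A.
Proof.
move=> pA; to_J 19%N pA (1,0,0,0) (0,0,0,1) (0,1,0,0) (0,0,1,0)
    (1,0,0,0) (0,0,1,0) (0,0,0,1) (0,1,0,0).
Qed.

Lemma listed_two_00_10 a g : presents A
    (Tab (1,0,0,0) 0q 0q (0,0,0,h) (0,1,0,0) 0q 0q 0q 0q (a,0,g,0)) ->
  listed A.
Proof.
move=> pA; have j := presents_jordan jA pA.
have a0 : a = 0 by jordan (@q3 k) 4 j (0,0,0,1) (1,0,0,0) (a,0,g,0) (0,0,0,h) (a,0,0,0).
subst a; have [g0|g0] := eqVneq g 0; first by subst g;
  to_J 9%N pA (1,0,0,0) (0,0,0,1) (0,1,0,0) (0,0,1,0)
    (1,0,0,0) (0,0,1,0) (0,0,0,1) (0,1,0,0).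
to_J 22%N pA (1,0,0,0) (0,0,0,1) (0,0,g,0) (0,1,0,0)
    (1,0,0,0) (0,0,0,1) (0,0,g^-1,0) (0,1,0,0).
Qed.

Lemma listed_two_00_12 a b : presents A
    (Tab (1,0,0,0) 0q 0q (0,0,0,h) (0,1,0,0) 0q (0,0,0,h) 0q 0q
      (a,b,0,0)) ->
  listed A.
Proof.
move=> pA; have j := presents_jordan jA pA.
have /subr0_eq ab : a - b = 0
  by jordan (@q3 k) 4 j (0,0,0,1) (1,0,0,0) (a,b,0,0) (0,0,0,h) (a,0,0,0).
subst b; have [a0|a0] := eqVneq a 0.
  by subst a; to_J 10%N pA (1,0,0,0) (0,1,0,0) (0,0,0,1) (0,0,1,0)
    (1,0,0,0) (0,1,0,0) (0,0,0,1) (0,0,1,0).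
have [s sE] := sqrt_exists a; have s0 : s != 0.
  by apply: contraNneq a0 => s0; rewrite -sE s0 expr0n.
subst a; to_J 7%N pA (1,0,0,0) (0,1,0,0) (0,0,0,s^-1) (0,0,1,0)
    (1,0,0,0) (0,1,0,0) (0,0,0,1) (0,0,s,0).
Qed.

Lemma listed_two_11_11_zero : presents A
    (Tab (1,0,0,0) 0q (0,0,1,0) (0,0,0,1) (0,1,0,0) 0q 0q 0q 0q 0q) ->
  listed A.
Proof.
move=> pA; to_J 20%N pA (1,0,0,0) (0,0,1,0) (0,0,0,1) (0,1,0,0)
    (1,0,0,0) (0,0,0,1) (0,1,0,0) (0,0,1,0).
Qed.

Lemma listed_two_11_11 : presents A
    (Tab (1,0,0,0) 0q (0,0,1,0) (0,0,0,1) (0,1,0,0) 0q 0q (0,0,0,1) 0q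
      0q) ->
  listed A.
Proof.
move=> pA; to_J 26%N pA (1,0,0,0) (0,0,1,0) (0,0,0,1) (0,1,0,0)
    (1,0,0,0) (0,0,0,1) (0,1,0,0) (0,0,1,0).
Qed.

Lemma listed_two_11_22 : presents A
    (Tab (1,0,0,0) 0q (0,0,1,0) 0q (0,1,0,0) 0q (0,0,0,1) 0q 0q 0q) ->
  listed A.
Proof.
move=> pA; to_J 21%N pA (1,0,0,0) (0,0,1,0) (0,1,0,0) (0,0,0,1)
    (1,0,0,0) (0,0,1,0) (0,1,0,0) (0,0,0,1).
Qed.

Lemma listed_two_11_10 a b : presents A
    (Tab (1,0,0,0) 0q (0,0,1,0) (0,0,0,h) (0,1,0,0) 0q 0q 0q 0q
      (a,0,b,0)) ->
  listed A.
Proof.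
move=> pA; have j := presents_jordan jA pA.
have a0 : a = 0 by jordan (@q3 k) 4 j (0,0,0,1) (1,0,0,0) (a,0,b,0) (0,0,0,h) (a,0,b,0).
subst a; have [b0|b0] := eqVneq b 0; first by subst b;
  to_J 13%N pA (1,0,0,0) (0,0,0,1) (0,0,1,0) (0,1,0,0)
    (1,0,0,0) (0,0,0,1) (0,0,1,0) (0,1,0,0).
to_J 23%N pA (1,0,0,0) (0,0,0,1) (0,0,b,0) (0,1,0,0)
    (1,0,0,0) (0,0,0,1) (0,0,b^-1,0) (0,1,0,0).
Qed.

Lemma listed_two_11_20 b : presents A
    (Tab (1,0,0,0) 0q (0,0,1,0) 0q (0,1,0,0) 0q (0,0,0,h) 0q 0q
      (0,b,0,0)) ->
  listed A.
Proof.
move=> pA; have j := presents_jordan jA pA.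
have b0 : b = 0 by jordan (@q3 k) 4 j (0,0,0,1) (0,1,0,0) (0,b,0,0) (0,0,0,h) (0,b,0,0).
subst b; to_J 14%N pA (0,1,0,0) (0,0,0,1) (1,0,0,0) (0,0,1,0)
    (0,0,1,0) (1,0,0,0) (0,0,0,1) (0,1,0,0).
Qed.

Lemma listed_two_11_12 a a' b : presents A
    (Tab (1,0,0,0) 0q (0,0,1,0) (0,0,0,h) (0,1,0,0) 0q (0,0,0,h) 0q 0q
      (a,a',b,0)) ->
  listed A.
Proof.
move=> pA; have j := presents_jordan jA pA.
have /subr0_eq aa : a - a' = 0
  by jordan (@q3 k) 4 j (0,0,0,1) (1,0,0,0) (a,a',b,0) (0,0,0,h) (a,0,b,0).
subst a'.
(* The test elements add idempotents and n to h. Behind the result [a = 0] is the fact that a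
   nonzero [a] would connect e_1 and e_2 through h and make A_11 and A_22 equidimensional. *)
have ab0 : a * b = 0
  by jordan (@q2 k) (-1) j (0,1,0,1) (0,0,0,1) (a,1+a,b,1) (a,a,b,h) (a,a,b,a+h).
have a0 : a - a * b = 0
  by jordan (@q2 k) 1 j (0,1,1,1) (0,0,0,1) (a,1+a,b,1) (a,a,b,h) (a,a,b,a+h).
rewrite ab0 subr0 in a0; subst a; have [b0|b0] := eqVneq b 0; first by subst b;
  to_J 16%N pA (1,0,0,0) (0,1,0,0) (0,0,0,1) (0,0,1,0)
    (1,0,0,0) (0,1,0,0) (0,0,0,1) (0,0,1,0).
to_J 24%N pA (1,0,0,0) (0,1,0,0) (0,0,0,1) (0,0,b,0)
    (1,0,0,0) (0,1,0,0) (0,0,0,b^-1) (0,0,1,0).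
Qed.

Lemma listed_two_10_10 a b c : presents A
    (Tab (1,0,0,0) 0q (0,0,h,0) (0,0,0,h) (0,1,0,0) 0q 0q (a,0,0,0)
      (b,0,0,0) (c,0,0,0)) ->
  listed A.
Proof.
move=> pA; have j := presents_jordan jA pA.
have a0 : a = 0 by jordan (@q2 k) 4 j (0,0,1,0) (1,0,0,0) (a,0,0,0) (0,0,h,0) (a,0,0,0).
have c0 : c = 0 by jordan (@q3 k) 4 j (0,0,0,1) (1,0,0,0) (c,0,0,0) (0,0,0,h) (c,0,0,0).
subst a c.
have b0 : b = 0 by jordan (@q3 k) 2 j (0,0,1,1) (1,0,0,0) (2*b,0,0,0) (0,0,h,h) (2*b,0,0,0).
subst b; to_J 11%N pA (1,0,0,0) (0,0,1,0) (0,0,0,1) (0,1,0,0)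
    (1,0,0,0) (0,0,0,1) (0,1,0,0) (0,0,1,0).
Qed.

Lemma listed_two_10_20 a b : presents A
    (Tab (1,0,0,0) 0q (0,0,h,0) 0q (0,1,0,0) 0q (0,0,0,h) (a,0,0,0) 0q
      (0,b,0,0)) ->
  listed A.
Proof.
move=> pA; have j := presents_jordan jA pA.
have a0 : a = 0 by jordan (@q2 k) 4 j (0,0,1,0) (1,0,0,0) (a,0,0,0) (0,0,h,0) (a,0,0,0).
have b0 : b = 0 by jordan (@q3 k) 4 j (0,0,0,1) (0,1,0,0) (0,b,0,0) (0,0,0,h) (0,b,0,0).
subst a b; to_J 12%N pA (1,0,0,0) (0,0,1,0) (0,1,0,0) (0,0,0,1)
    (1,0,0,0) (0,0,1,0) (0,1,0,0) (0,0,0,1).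
Qed.

Lemma listed_two_10_12 a b c : presents A
    (Tab (1,0,0,0) 0q (0,0,h,0) (0,0,0,h) (0,1,0,0) 0q (0,0,0,h)
      (a,0,0,0) 0q (b,c,0,0)) ->
  listed A.
Proof.
move=> pA; have j := presents_jordan jA pA.
have a0 : a = 0 by jordan (@q2 k) 4 j (0,0,1,0) (1,0,0,0) (a,0,0,0) (0,0,h,0) (a,0,0,0).
have /subr0_eq bc : b - c = 0
  by jordan (@q3 k) 4 j (0,0,0,1) (1,0,0,0) (b,c,0,0) (0,0,0,h) (b,0,0,0).
subst a c.
(* A nonzero [b] would let the vector of A_12 carry A_10 isomorphically into A_20, which is zero
   here. *)
have b0 : b = 0
  by jordan (@q2 k) 2 j (0,1,1,1) (0,0,0,1) (b,1+b,0,1) (b,b,0,h) (b,b,0,b+h).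
subst b; to_J 15%N pA (1,0,0,0) (0,1,0,0) (0,0,0,1) (0,0,1,0)
    (1,0,0,0) (0,1,0,0) (0,0,0,1) (0,0,1,0).
Qed.

(** The product on A_12 is a quadratic form with values in the line of e_1 + e_2; ranks 0, 1 and 2
    give J_18, J_9 and J_2. *)
Lemma listed_two_12_12 a a' b b' c c' : presents A
    (Tab (1,0,0,0) 0q (0,0,h,0) (0,0,0,h) (0,1,0,0) (0,0,h,0) (0,0,0,h)
      (a,a',0,0) (b,b',0,0) (c,c',0,0)) ->
  listed A.
Proof.
move=> pA; have j := presents_jordan jA pA.
have /subr0_eq aa : a - a' = 0
  by jordan (@q2 k) 4 j (0,0,1,0) (1,0,0,0) (a,a',0,0) (0,0,h,0) (a,0,0,0).
have /subr0_eq cc : c - c' = 0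
  by jordan (@q3 k) 4 j (0,0,0,1) (1,0,0,0) (c,c',0,0) (0,0,0,h) (c,0,0,0).
subst a' c'.
have /subr0_eq bb : b - b' = 0
  by jordan (@q2 k) 2 j (0,0,1,1) (1,0,0,0) (a+2*b+c,a+2*b'+c,0,0) (0,0,h,h)
    (a+2*b+c,0,0,0).
subst b'; have [p [q [r [s [A' [B' [det0 [eA eB eC] hAB]]]]]]] := binary_form two_neq0 a b c.
pose fA := a * p ^+ 2 + 2 * b * p * q + c * q ^+ 2.
pose fB := a * p * r + b * (p * s + q * r) + c * q * s.
pose fC := a * r ^+ 2 + 2 * b * r * s + c * s ^+ 2.
have {}pA : presents A
    (Tab (1,0,0,0) 0q (0,0,h,0) (0,0,0,h) (0,1,0,0) (0,0,h,0) (0,0,0,h)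
       (fA,fA,0,0) (fB,fB,0,0) (fC,fC,0,0)).
  rewrite /fA /fB /fC.
  rebase_by pA (1,0,0,0) (0,1,0,0) (0,0,p,q) (0,0,r,s)
    (1,0,0,0) (0,1,0,0) (0,0,s/(p*s-q*r),-q/(p*s-q*r)) (0,0,-r/(p*s-q*r),p/(p*s-q*r)).
rewrite /fA /fB /fC eA eB eC in pA.
case: hAB => [[A1 B1]|[[A1 B1]|[A1 B1]]]; rewrite A1 B1 in pA.
- is_J 17%N pA.
- is_J 8%N pA.
- to_J 1%N pA (1,0,0,0) (0,1,0,0) (0,0,1,-h) (0,0,0,h)
    (1,0,0,0) (0,1,0,0) (0,0,1,1) (0,0,0,2).
Qed.

End SeveralIdempotents.

(** * Tables with one idempotent *)

Section OneIdempotent.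
Variables (k : closedFieldType) (A : algebra k).
Hypothesis two_neq0 : (2 : k) != 0.
Hypothesis jA : jordan A.
Local Notation "0q" := (0, 0, 0, 0).
Local Notation h := (2^-1 : k).

(** In these names the letters are the Peirce eigenvalues of the three other basis vectors, up to
    order, with [h] for 1/2. A last digit numbers the possible products on A_11 or A_00, and
    [action] means that such a space acts nontrivially on the half-space. *)
Lemma listed_one_000_0 : presents A
    (Tab (1,0,0,0) 0q 0q 0q 0q 0q 0q 0q 0q 0q) ->
  listed A.
Proof.
move=> pA; is_J 33%N pA.
Qed.

Lemma listed_one_000_1 : presents A
    (Tab (1,0,0,0) 0q 0q 0q (0,0,1,0) 0q 0q 0q 0q 0q) ->
  listed A.
Proof.
move=> pA; to_J 39%N pA (0,1,0,0) (0,0,1,0) (1,0,0,0) (0,0,0,1)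
    (0,0,1,0) (1,0,0,0) (0,1,0,0) (0,0,0,1).
Qed.

Lemma listed_one_000_2 : presents A
    (Tab (1,0,0,0) 0q 0q 0q (0,0,1,0) (0,0,0,1) 0q 0q 0q 0q) ->
  listed A.
Proof.
move=> pA; to_J 37%N pA (0,1,0,0) (0,0,1,0) (0,0,0,1) (1,0,0,0)
    (0,0,0,1) (1,0,0,0) (0,1,0,0) (0,0,1,0).
Qed.

Lemma listed_one_000_3 : presents A
    (Tab (1,0,0,0) 0q 0q 0q (0,0,1,0) 0q (0,0,1,0) 0q 0q 0q) ->
  listed A.
Proof.
move=> pA; to_J 40%N pA (0,1,0,0) (0,0,1,0) (0,0,0,1) (1,0,0,0)
    (0,0,0,1) (1,0,0,0) (0,1,0,0) (0,0,1,0).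
Qed.

Lemma listed_one_111_0 : presents A
    (Tab (1,0,0,0) (0,1,0,0) (0,0,1,0) (0,0,0,1) 0q 0q 0q 0q 0q 0q) ->
  listed A.
Proof.
move=> pA; is_J 35%N pA.
Qed.

Lemma listed_one_111_1 : presents A
    (Tab (1,0,0,0) (0,1,0,0) (0,0,1,0) (0,0,0,1) (0,0,1,0) 0q 0q 0q 0q
      0q) ->
  listed A.
Proof.
move=> pA; is_J 41%N pA.
Qed.

Lemma listed_one_111_2 : presents A
    (Tab (1,0,0,0) (0,1,0,0) (0,0,1,0) (0,0,0,1) (0,0,1,0) (0,0,0,1) 0q
      0q 0q 0q) ->
  listed A.
Proof.
move=> pA; is_J 38%N pA.
Qed.

Lemma listed_one_111_3 : presents A
    (Tab (1,0,0,0) (0,1,0,0) (0,0,1,0) (0,0,0,1) (0,0,1,0) 0q (0,0,1,0)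
      0q 0q 0q) ->
  listed A.
Proof.
move=> pA; is_J 42%N pA.
Qed.

Lemma listed_one_h00_0 a b c : presents A
    (Tab (1,0,0,0) (0,h,0,0) 0q 0q (a,0,b,c) 0q 0q 0q 0q 0q) ->
  listed A.
Proof.
move=> pA; have j := presents_jordan jA pA.
have a0 : a = 0 by jordan (@q1 k) 4 j (0,1,0,0) (1,0,0,0) (a,0,b,c) (0,h,0,0) (a,0,0,0).
subst a; have [c0|c0] := eqVneq c 0.
  subst c; have [b0|b0] := eqVneq b 0; first by subst b; is_J 27%N pA.
  to_J 43%N pA (1,0,0,0) (0,1,0,0) (0,0,b,0) (0,0,0,1)
    (1,0,0,0) (0,1,0,0) (0,0,b^-1,0) (0,0,0,1).
to_J 43%N pA (1,0,0,0) (0,1,0,0) (0,0,b,c) (0,0,1,0)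
    (1,0,0,0) (0,1,0,0) (0,0,0,1) (0,0,c^-1,-b/c).
Qed.

Lemma listed_one_h00_1 a b c : presents A
    (Tab (1,0,0,0) (0,h,0,0) 0q 0q (a,0,b,c) 0q 0q (0,0,0,1) 0q 0q) ->
  listed A.
Proof.
move=> pA; have j := presents_jordan jA pA.
have a0 : a = 0 by jordan (@q1 k) 4 j (0,1,0,0) (1,0,0,0) (a,0,b,c) (0,h,0,0) (a,0,0,0).
(* Fourth powers: with x the half vector, x^2 x = 0 whereas x^2 x^2 is b^2 times the last basis
   vector. *)
subst a; have /eqP : b ^+ 2 = 0
  by jordan (@q3 k) (-1) j (0,1,0,0) (0,1,0,0) (0,0,b,c) (0,0,b,c) 0q.
rewrite expf_eq0 /= => /eqP b0; subst b.
have [c0|c0] := eqVneq c 0; first by subst c; is_J 45%N pA.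
have [s sE] := sqrt_exists c; have s0 : s != 0.
  by apply: contraNneq c0 => s0; rewrite -sE s0 expr0n.
subst c; to_J 44%N pA (1,0,0,0) (0,s^-1,0,0) (0,0,0,1) (0,0,1,0)
    (1,0,0,0) (0,s,0,0) (0,0,0,1) (0,0,1,0).
Qed.

(** Once the components along e vanish, the product of the half-space is a quadratic form with
    values in the line A_00. Ranks 0, 1 and 2 give J_30, J_48 and J_49. *)
Lemma listed_one_hh0 a b c x y z : presents A
    (Tab (1,0,0,0) (0,h,0,0) (0,0,h,0) 0q (a,0,0,x) (b,0,0,y) 0q
      (c,0,0,z) 0q 0q) ->
  listed A.
Proof.
move=> pA; have j := presents_jordan jA pA.
have a0 : a = 0 by jordan (@q1 k) 4 j (0,1,0,0) (1,0,0,0) (a,0,0,x) (0,h,0,0) (a,0,0,0).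
have c0 : c = 0 by jordan (@q2 k) 4 j (0,0,1,0) (1,0,0,0) (c,0,0,z) (0,0,h,0) (c,0,0,0).
subst a c.
have b0 : b = 0
  by jordan (@q1 k) 2 j (0,1,1,0) (1,0,0,0) (2*b,0,0,x+2*y+z) (0,h,h,0) (2*b,0,0,0).
subst b; have [p [q [r [s [A' [B' [det0 [eA eB eC] hAB]]]]]]] := binary_form two_neq0 x y z.
pose fA := x * p ^+ 2 + 2 * y * p * q + z * q ^+ 2.
pose fB := x * p * r + y * (p * s + q * r) + z * q * s.
pose fC := x * r ^+ 2 + 2 * y * r * s + z * s ^+ 2.
have {}pA : presents A
    (Tab (1,0,0,0) (0,h,0,0) (0,0,h,0) 0q (0,0,0,fA) (0,0,0,fB) 0q (0,0,0,fC) 0q 0q).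
  rewrite /fA /fB /fC.
  rebase_by pA (1,0,0,0) (0,p,q,0) (0,r,s,0) (0,0,0,1)
    (1,0,0,0) (0,s/(p*s-q*r),-q/(p*s-q*r),0) (0,-r/(p*s-q*r),p/(p*s-q*r),0) (0,0,0,1).
rewrite /fA /fB /fC eA eB eC in pA.
case: hAB => [[A1 B1]|[[A1 B1]|[A1 B1]]]; rewrite A1 B1 in pA.
- is_J 29%N pA.
- to_J 47%N pA (1,0,0,0) (0,0,0,1) (0,0,1,0) (0,1,0,0)
    (1,0,0,0) (0,0,0,1) (0,0,1,0) (0,1,0,0).
- to_J 48%N pA (1,0,0,0) (0,0,0,1) (0,0,1,0) (0,1,0,0)
    (1,0,0,0) (0,0,0,1) (0,0,1,0) (0,1,0,0).
Qed.

Lemma listed_one_hh0_action a b c x y z : presents A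
    (Tab (1,0,0,0) (0,h,0,0) (0,0,h,0) 0q (a,0,0,x) (b,0,0,y) (0,0,1,0)
      (c,0,0,z) 0q 0q) ->
  listed A.
Proof.
move=> pA; have j := presents_jordan jA pA.
have a0 : a = 0 by jordan (@q1 k) 4 j (0,1,0,0) (1,0,0,0) (a,0,0,x) (0,h,0,0) (a,0,0,0).
have x0 : x = 0 by subst a; jordan (@q2 k) (-2) j (0,1,0,0) (1,0,0,0) (0,0,0,x) (0,h,0,0)
  (0,0,0,0).
have c0 : c = 0 by jordan (@q2 k) 4 j (0,0,1,0) (1,0,0,0) (c,0,0,z) (0,0,h,0) (c,0,0,0).
subst a c x.
have b0 : b = 0
  by jordan (@q1 k) 2 j (0,1,1,0) (1,0,0,0) (2*b,0,0,2*y+z) (0,h,h,0) (2*b,0,0,0).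
subst b.
(* Evaluating at the sum and at the difference of the two half vectors separates [y] from [z] with a
   division by 2 only. *)
have yz : 2 * y + z = 0
  by jordan (@q2 k) (-2) j (0,1,1,0) (1,0,0,0) (0,0,0,2*y+z) (0,h,h,0) (0,0,0,0).
have yz' : - (2 * y) + z = 0
  by jordan (@q2 k) (-2) j (0,1,-1,0) (1,0,0,0) (0,0,0,-(2*y)+z) (0,h,-h,0) (0,0,0,0).
have z0 : z = 0.
  by apply: (mulfI two_neq0); rewrite mulr0 -[RHS](addr0 0) -{1}yz -yz'; ring.
have y0 : y = 0 by apply: (mulfI two_neq0); rewrite mulr0 -yz z0 addr0.
subst z y; to_J 49%N pA (1,0,0,0) (0,0,0,1) (0,1,0,0) (0,0,1,0)
    (1,0,0,0) (0,0,1,0) (0,0,0,1) (0,1,0,0).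
Qed.

Lemma listed_one_1hh a b c x y z : presents A
    (Tab (1,0,0,0) (0,h,0,0) (0,0,h,0) (0,0,0,1) (a,0,0,x) (b,0,0,y) 0q
      (c,0,0,z) 0q 0q) ->
  listed A.
Proof.
move=> pA; have j := presents_jordan jA pA.
have a0 : a = 0 by jordan (@q1 k) 4 j (0,1,0,0) (1,0,0,0) (a,0,0,x) (0,h,0,0) (a,0,0,x).
have c0 : c = 0 by jordan (@q2 k) 4 j (0,0,1,0) (1,0,0,0) (c,0,0,z) (0,0,h,0) (c,0,0,z).
subst a c.
have b0 : b = 0
  by jordan (@q1 k) 2 j (0,1,1,0) (1,0,0,0) (2*b,0,0,x+2*y+z) (0,h,h,0) (2*b,0,0,x+2*y+z).
subst b; have [p [q [r [s [A' [B' [det0 [eA eB eC] hAB]]]]]]] := binary_form two_neq0 x y z.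
pose fA := x * p ^+ 2 + 2 * y * p * q + z * q ^+ 2.
pose fB := x * p * r + y * (p * s + q * r) + z * q * s.
pose fC := x * r ^+ 2 + 2 * y * r * s + z * s ^+ 2.
have {}pA : presents A
    (Tab (1,0,0,0) (0,h,0,0) (0,0,h,0) (0,0,0,1) (0,0,0,fA) (0,0,0,fB) 0q (0,0,0,fC) 0q 0q).
  rewrite /fA /fB /fC.
  rebase_by pA (1,0,0,0) (0,p,q,0) (0,r,s,0) (0,0,0,1)
    (1,0,0,0) (0,s/(p*s-q*r),-q/(p*s-q*r),0) (0,-r/(p*s-q*r),p/(p*s-q*r),0) (0,0,0,1).
rewrite /fA /fB /fC eA eB eC in pA.
case: hAB => [[A1 B1]|[[A1 B1]|[A1 B1]]]; rewrite A1 B1 in pA.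
- is_J 31%N pA.
- to_J 57%N pA (1,0,0,0) (0,0,0,1) (0,0,1,0) (0,1,0,0)
    (1,0,0,0) (0,0,0,1) (0,0,1,0) (0,1,0,0).
- to_J 58%N pA (1,0,0,0) (0,0,0,1) (0,0,1,0) (0,1,0,0)
    (1,0,0,0) (0,0,0,1) (0,0,1,0) (0,1,0,0).
Qed.

Lemma listed_one_1hh_action a b c x y z : presents A
    (Tab (1,0,0,0) (0,h,0,0) (0,0,h,0) (0,0,0,1) (a,0,0,x) (b,0,0,y)
      (0,0,1,0) (c,0,0,z) 0q 0q) ->
  listed A.
Proof.
move=> pA; have j := presents_jordan jA pA.
have a0 : a = 0 by jordan (@q1 k) 4 j (0,1,0,0) (1,0,0,0) (a,0,0,x) (0,h,0,0) (a,0,0,x).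
have x0 : x = 0 by subst a; jordan (@q2 k) 2 j (0,1,0,0) (1,0,0,0) (0,0,0,x) (0,h,0,0) (0,0,0,x).
have c0 : c = 0 by jordan (@q2 k) 4 j (0,0,1,0) (1,0,0,0) (c,0,0,z) (0,0,h,0) (c,0,0,z).
subst a c x.
have b0 : b = 0
  by jordan (@q1 k) 2 j (0,1,1,0) (1,0,0,0) (2*b,0,0,2*y+z) (0,h,h,0) (2*b,0,0,2*y+z).
subst b.
have yz : 2 * y + z = 0
  by jordan (@q2 k) 2 j (0,1,1,0) (1,0,0,0) (0,0,0,2*y+z) (0,h,h,0) (0,0,0,2*y+z).
have yz' : - (2 * y) + z = 0
  by jordan (@q2 k) 2 j (0,1,-1,0) (1,0,0,0) (0,0,0,-(2*y)+z) (0,h,-h,0) (0,0,0,-(2*y)+z).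
have z0 : z = 0.
  by apply: (mulfI two_neq0); rewrite mulr0 -[RHS](addr0 0) -{1}yz -yz'; ring.
have y0 : y = 0 by apply: (mulfI two_neq0); rewrite mulr0 -yz z0 addr0.
subst z y; to_J 59%N pA (1,0,0,0) (0,0,0,1) (0,1,0,0) (0,0,1,0)
    (1,0,0,0) (0,0,1,0) (0,0,0,1) (0,1,0,0).
Qed.

Lemma listed_one_hhh a b c x y z : presents A
    (Tab (1,0,0,0) (0,h,0,0) (0,0,h,0) (0,0,0,h) (a,0,0,0) (x,0,0,0)
      (y,0,0,0) (b,0,0,0) (z,0,0,0) (c,0,0,0)) ->
  listed A.
Proof.
move=> pA; have j := presents_jordan jA pA.
have a0 : a = 0 by jordan (@q1 k) 4 j (0,1,0,0) (1,0,0,0) (a,0,0,0) (0,h,0,0) (a,0,0,0).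
have b0 : b = 0 by jordan (@q2 k) 4 j (0,0,1,0) (1,0,0,0) (b,0,0,0) (0,0,h,0) (b,0,0,0).
have c0 : c = 0 by jordan (@q3 k) 4 j (0,0,0,1) (1,0,0,0) (c,0,0,0) (0,0,0,h) (c,0,0,0).
subst a b c.
have x0 : x = 0 by jordan (@q1 k) 2 j (0,1,1,0) (1,0,0,0) (2*x,0,0,0) (0,h,h,0) (2*x,0,0,0).
have y0 : y = 0 by jordan (@q1 k) 2 j (0,1,0,1) (1,0,0,0) (2*y,0,0,0) (0,h,0,h) (2*y,0,0,0).
have z0 : z = 0 by jordan (@q2 k) 2 j (0,0,1,1) (1,0,0,0) (2*z,0,0,0) (0,0,h,h) (2*z,0,0,0).
subst x y z; is_J 32%N pA.
Qed.

Lemma listed_one_100_0 : presents A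
    (Tab (1,0,0,0) (0,1,0,0) 0q 0q 0q 0q 0q 0q 0q 0q) ->
  listed A.
Proof.
move=> pA; is_J 34%N pA.
Qed.

Lemma listed_one_100_1 : presents A
    (Tab (1,0,0,0) (0,1,0,0) 0q 0q 0q 0q 0q (0,0,0,1) 0q 0q) ->
  listed A.
Proof.
move=> pA; is_J 46%N pA.
Qed.

(** The square of the half vector has one component in A_11 and one in A_00, each of which can be
    scaled to 0 or 1; this gives J_29, J_51, J_52 and J_53. *)
Lemma listed_one_1h0 a b c : presents A
    (Tab (1,0,0,0) (0,1,0,0) (0,0,h,0) 0q 0q 0q 0q (a,b,0,c) 0q 0q) ->
  listed A.
Proof.
move=> pA; have j := presents_jordan jA pA.
have a0 : a = 0 by jordan (@q2 k) 4 j (0,0,1,0) (1,0,0,0) (a,b,0,c) (0,0,h,0) (a,b,0,0).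
subst a; have [b0|b0] := eqVneq b 0.
  subst b; have [c0|c0] := eqVneq c 0; first by subst c;
    to_J 28%N pA (1,0,0,0) (0,0,1,0) (0,1,0,0) (0,0,0,1)
    (1,0,0,0) (0,0,1,0) (0,1,0,0) (0,0,0,1).
  to_J 51%N pA (1,0,0,0) (0,0,1,0) (0,1,0,0) (0,0,0,c)
    (1,0,0,0) (0,0,1,0) (0,1,0,0) (0,0,0,c^-1).
have [c0|c0] := eqVneq c 0.
  by subst c; to_J 50%N pA (1,0,0,0) (0,0,1,0) (0,b,0,0) (0,0,0,1)
    (1,0,0,0) (0,0,b^-1,0) (0,1,0,0) (0,0,0,1).
to_J 52%N pA (1,0,0,0) (0,0,1,0) (0,b,0,0) (0,0,0,c)
    (1,0,0,0) (0,0,b^-1,0) (0,1,0,0) (0,0,0,c^-1).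
Qed.

Lemma listed_one_110_0 : presents A
    (Tab (1,0,0,0) (0,1,0,0) (0,0,1,0) 0q 0q 0q 0q 0q 0q 0q) ->
  listed A.
Proof.
move=> pA; is_J 36%N pA.
Qed.

Lemma listed_one_110_1 : presents A
    (Tab (1,0,0,0) (0,1,0,0) (0,0,1,0) 0q (0,0,1,0) 0q 0q 0q 0q 0q) ->
  listed A.
Proof.
move=> pA; is_J 53%N pA.
Qed.

Lemma listed_one_11h_0 a b c : presents A
    (Tab (1,0,0,0) (0,1,0,0) (0,0,1,0) (0,0,0,h) 0q 0q 0q 0q 0q
      (a,b,c,0)) ->
  listed A.
Proof.
move=> pA; have j := presents_jordan jA pA.
have a0 : a = 0 by jordan (@q3 k) 4 j (0,0,0,1) (1,0,0,0) (a,b,c,0) (0,0,0,h) (a,b,c,0).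
subst a; have [c0|c0] := eqVneq c 0.
  subst c; have [b0|b0] := eqVneq b 0; first by subst b; is_J 30%N pA.
  to_J 54%N pA (1,0,0,0) (0,0,1,0) (0,b,0,0) (0,0,0,1)
    (1,0,0,0) (0,0,b^-1,0) (0,1,0,0) (0,0,0,1).
to_J 54%N pA (1,0,0,0) (0,1,0,0) (0,b,c,0) (0,0,0,1)
    (1,0,0,0) (0,1,0,0) (0,-b/c,c^-1,0) (0,0,0,1).
Qed.

Lemma listed_one_11h_1 a b c : presents A
    (Tab (1,0,0,0) (0,1,0,0) (0,0,1,0) (0,0,0,h) (0,0,1,0) 0q 0q 0q 0q
      (a,b,c,0)) ->
  listed A.
Proof.
move=> pA; have j := presents_jordan jA pA.
have a0 : a = 0 by jordan (@q3 k) 4 j (0,0,0,1) (1,0,0,0) (a,b,c,0) (0,0,0,h) (a,b,c,0).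
subst a; have /eqP : b ^+ 2 = 0
  by jordan (@q2 k) (-1) j (0,0,0,1) (0,0,0,1) (0,b,c,0) (0,b,c,0) 0q.
rewrite expf_eq0 /= => /eqP b0; subst b.
have [c0|c0] := eqVneq c 0; first by subst c; is_J 55%N pA.
have [s sE] := sqrt_exists c; have s0 : s != 0.
  by apply: contraNneq c0 => s0; rewrite -sE s0 expr0n.
subst c; to_J 56%N pA (1,0,0,0) (0,1,0,0) (0,0,1,0) (0,0,0,s^-1)
    (1,0,0,0) (0,1,0,0) (0,0,1,0) (0,0,0,s).
Qed.

End OneIdempotent.

(** * Nilpotent tables *)

Section Nilpotent.
Variables (k : closedFieldType) (A : algebra k).
Hypothesis two_neq0 : (2 : k) != 0.
Hypothesis jA : jordan A.
Local Notation "0q" := (0, 0, 0, 0).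
Local Notation h := (2^-1 : k).

Lemma listed_nil_4 : presents A
    (Tab (0,1,0,0) (0,0,1,0) (0,0,0,1) 0q (0,0,0,1) 0q 0q 0q 0q 0q) ->
  listed A.
Proof.
move=> pA; is_J 60%N pA.
Qed.

(** With x, x^2, x^3, n for the basis and v = p x + q n, one has v^2 = (p^2 + b q^2) x^2 and v x^2 =
    (p + c q) x^3, the former modulo x^3. The data are thus a binary form and a linear form with
    kernel spanned by (-c, 1), where the form takes the value c^2 + b. The cases are: degenerate
    form, isotropic kernel, and the general one, in which the new generators are orthogonal and one
    of them lies in the kernel. The parameter [d] is absorbed by terms in x^2 or by scaling. *)
Lemma listed_nil_3 b c d : presents A
    (Tab (0,1,0,0) (0,0,1,0) 0q 0q 0q 0q (0,0,c,0) 0q 0q (0,b,d,0)) ->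
  listed A.
Proof.
move=> pA; have [b0|b0] := eqVneq b 0.
  subst b; have [c0|c0] := eqVneq c 0.
    subst c; have [d0|d0] := eqVneq d 0; first by subst d; is_J 66%N pA.
    to_J 65%N pA (d,0,0,0) (0,d^+2,0,0) (0,0,d^+3,0) (0,0,0,d)
      (d^-1,0,0,0) (0,d^-1^+2,0,0) (0,0,d^-1^+3,0) (0,0,0,d^-1).
  to_J 64%N pA (1,-(-d/(2*c^+2)),0,0) (0,1,-2*(-d/(2*c^+2)),0) (0,0,1,0) (0,(-d/(2*c^+2)),0,c^-1)
    (1,(-d/(2*c^+2)),2*(-d/(2*c^+2))^+2,0) (0,1,2*(-d/(2*c^+2)),0) (0,0,1,0)
      (0,-c*(-d/(2*c^+2)),-2*c*(-d/(2*c^+2))^+2,c).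
have [w0|w0] := eqVneq (c ^+ 2 + b) 0.
  have bE : b = - c ^+ 2 by apply/eqP; rewrite -addr_eq0 addrC w0.
  have c0 : c != 0.
    by apply: contraNneq b0 => c0; rewrite bE c0 expr0n oppr0.
  subst b; have [d0|d0] := eqVneq d 0.
    by subst d; to_J 63%N pA (1,0,0,0) (0,1,0,0) (0,0,1,0) (0,0,0,c^-1)
      (1,0,0,0) (0,1,0,0) (0,0,1,0) (0,0,0,c).
  to_J 62%N pA ((-d/c^+2),0,0,0) (0,(-d/c^+2)^+2,0,0) (0,0,(-d/c^+2)^+3,0) (0,0,0,(-d/c^+2)/c)
    ((-c^+2/d),0,0,0) (0,(-c^+2/d)^+2,0,0) (0,0,(-c^+2/d)^+3,0) (0,0,0,(-c^+2/d)*c).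
have [s sE] := sqrt_exists b; have s0 : s != 0.
  by apply: contraNneq b0 => s0; rewrite -sE s0 expr0n.
subst b.
to_J 61%N pA (s^+2,(d*(s^+2-c^+2)/(2*(c^+2+s^+2))),0,c) (0,s^+2*(c^+2+s^+2),s^+2*d,0)
  (0,0,s^+2*(c^+2+s^+2)^+2,0) (-s*c,(-s*c*d/(c^+2+s^+2)),0,s)
    (1/(c^+2+s^+2),
      ((-s*(d*(s^+2-c^+2)/(2*(c^+2+s^+2)))+c*(-s*c*d/(c^+2+s^+2)))/(s*(c^+2+s^+2)))
        *(1/(s^+2*(c^+2+s^+2))),
      ((-s*(d*(s^+2-c^+2)/(2*(c^+2+s^+2)))+c*(-s*c*d/(c^+2+s^+2)))/(s*(c^+2+s^+2)))
        *(-d/(s^+2*(c^+2+s^+2)^+3)),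
      -c/(s*(c^+2+s^+2)))
    (0,1/(s^+2*(c^+2+s^+2)),-d/(s^+2*(c^+2+s^+2)^+3),0) (0,0,1/(s^+2*(c^+2+s^+2)^+2),0)
    (c/(c^+2+s^+2),
      ((-s*c*(d*(s^+2-c^+2)/(2*(c^+2+s^+2)))-s^+2*(-s*c*d/(c^+2+s^+2)))/(s*(c^+2+s^+2)))
        *(1/(s^+2*(c^+2+s^+2))),
      ((-s*c*(d*(s^+2-c^+2)/(2*(c^+2+s^+2)))-s^+2*(-s*c*d/(c^+2+s^+2)))/(s*(c^+2+s^+2)))
        *(-d/(s^+2*(c^+2+s^+2)^+3)),
      s/(c^+2+s^+2)).
Qed.

(** The product is a quadratic form with values in one line; its restriction to the vectors
    orthogonal to the first one has rank 0, 1 or 2, giving J_72, J_71 and J_70. In rank 1 a square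
    root of -1 makes the second vector isotropic. *)
Lemma listed_nil_31 x y z : presents A
    (Tab (0,1,0,0) 0q 0q 0q 0q 0q 0q (0,x,0,0) (0,y,0,0) (0,z,0,0)) ->
  listed A.
Proof.
move=> pA; have [p [q [r [s [A' [B' [det0 [eA eB eC] hAB]]]]]]] := binary_form two_neq0 x y z.
pose fA := x * p ^+ 2 + 2 * y * p * q + z * q ^+ 2.
pose fB := x * p * r + y * (p * s + q * r) + z * q * s.
pose fC := x * r ^+ 2 + 2 * y * r * s + z * s ^+ 2.
have {}pA : presents A
    (Tab (0,1,0,0) 0q 0q 0q 0q 0q 0q (0,fA,0,0) (0,fB,0,0) (0,fC,0,0)).
  rewrite /fA /fB /fC.
  rebase_by pA (1,0,0,0) (0,1,0,0) (0,0,p,q) (0,0,r,s)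
    (1,0,0,0) (0,1,0,0) (0,0,s/(p*s-q*r),-q/(p*s-q*r)) (0,0,-r/(p*s-q*r),p/(p*s-q*r)).
rewrite /fA /fB /fC eA eB eC in pA.
case: hAB => [[A1 B1]|[[A1 B1]|[A1 B1]]]; rewrite A1 B1 in pA.
- is_J 71%N pA.
- have [i iE] := sqrt_exists (-1 : k); have i0 : i != 0.
    apply/eqP => i0; move/eqP: iE; rewrite i0 expr0n /= eq_sym oppr_eq0.
    by rewrite (negPf (oner_neq0 k)).
  have {}pA : presents A
      (Tab (0,1,0,0) 0q (0,1,0,0) 0q 0q 0q 0q (0,1+i^+2,0,0) 0q 0q).
    rebase_by pA (1,0,0,0) (0,1,0,0) (1,0,i,0) (0,0,0,1)
      (1,0,0,0) (0,1,0,0) (-i^-1,0,i^-1,0) (0,0,0,1).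
  rewrite iE subrr in pA.
  is_J 70%N pA.
- to_J 69%N pA (1,0,0,0) (0,1,0,0) (0,0,1,-h) (0,0,0,1)
    (1,0,0,0) (0,1,0,0) (0,0,1,h) (0,0,0,1).
Qed.

(** With x, y for the two generators, (x + t y)(x + t' y) = 0 when t + t' = -1/a and t t' = b/a. Two
    distinct roots split the algebra as B_3 + B_3, while a double root gives a generator of square
    zero and hence J_69. *)
Lemma listed_nil_22 a b : presents A
    (Tab (0,0,1,0) (0,0,a,b) 0q 0q (0,0,0,1) 0q 0q 0q 0q 0q) ->
  listed A.
Proof.
move=> pA; have [a0|a0] := eqVneq a 0.
  by subst a; to_J 67%N pA (1,-b,0,0) (0,0,1,-b^+2) (0,1,0,0) (0,0,0,1)
    (1,0,b,0) (0,0,1,0) (0,1,0,b^+2) (0,0,0,1).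
have [t tE] := quadratic_root (- (b / a)) (- a^-1).
have {tE} bE : b = - (a * t ^+ 2 + t) by rewrite tE; field.
subst b; have [m0|m0] := eqVneq (1 + 2 * a * t) 0.
  have {}m0 : t = - (2 * a)^-1.
    have -> : t = (1 + 2 * a * t - 1) / (2 * a) by field; rewrite a0 two_neq0.
    by rewrite m0 sub0r mulN1r.
  subst t.
  to_J 68%N pA (1,0,0,0) (0,0,1,0) (1,-(2*a)^-1,0,0) (0,0,h,-h*(2*a)^-1^+2)
    (1,0,0,0) (2*a,0,-2*a,0) (0,1,0,0) (0,4*a^+2,0,-8*a^+2).
to_J 67%N pA (1,t,0,0) (0,0,(1+2*a*t),-(1+2*a*t)*t^+2) (1,(-a^-1-t),0,0)
  (0,0,-(1+2*a*t),(1+2*a*t)*(-a^-1-t)^+2)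
    (1-t*a/(1+2*a*t),0,t*a/(1+2*a*t),0) (a/(1+2*a*t),0,-a/(1+2*a*t),0)
    (0,(1+2*a*t)^-1+t^+2*a^+2/(1+2*a*t)^+2,0,t^+2*a^+2/(1+2*a*t)^+2)
      (0,a^+2/(1+2*a*t)^+2,0,a^+2/(1+2*a*t)^+2).
Qed.

Lemma listed_nil_zero : presents A
    (Tab 0q 0q 0q 0q 0q 0q 0q 0q 0q 0q) ->
  listed A.
Proof.
move=> pA; is_J 72%N pA.
Qed.

End Nilpotent.

(** * Peirce decomposition *)

(** Passing to coordinates makes linear identities between vectors accessible to [ring] and
    [field]. *)
Lemma vec_ext (k : fieldType) (V : vectType k) (v w : V) :
  (forall i, coord (vbasis fullv) i v = coord (vbasis fullv) i w) -> v = w.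
Proof.
move=> h; rewrite (coord_vbasis (memvf v)) (coord_vbasis (memvf w)).
by apply: eq_bigr => i _; rewrite h.
Qed.

Section CombineEquations.
Variables (k : fieldType) (V : vectType k).
Implicit Types u v a b : V.

(** Form of a certificate: an equation follows linearly from [a = b] once its difference of sides
    equals [a - b] identically. *)
Lemma eq_of_eq u v a b : a = b -> u - v = a - b -> u = v.
Proof. by move=> -> /eqP; rewrite subrr subr_eq0 => /eqP. Qed.

Lemma eq_add a b u v : a = b -> u = v -> a + u = b + v.
Proof. by move=> -> ->. Qed.

Lemma eq_scale (c : k) a b : a = b -> c *: a = c *: b.
Proof. by move=> ->. Qed.

Lemma scale_neq0_eq0 (c : k) v : c != 0 -> c *: v = 0 -> v = 0.
Proof. by move=> c0 /eqP; rewrite scaler_eq0 (negPf c0) => /eqP. Qed.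

End CombineEquations.

Section Coordinates.
Variables (k : fieldType) (V : vectType k) (n : nat) (X : n.-tuple V) (i : 'I_n).

Lemma coordD u v : coord X i (u + v) = coord X i u + coord X i v.
Proof. exact: linearD. Qed.
Lemma coordN v : coord X i (- v) = - coord X i v.
Proof. exact: linearN. Qed.
Lemma coordZ c v : coord X i (c *: v) = c * coord X i v.
Proof. exact: linearZ. Qed.
Lemma coord0 : coord X i 0 = 0.
Proof. exact: linear0. Qed.

End Coordinates.

Ltac on_coordinates :=
  apply: vec_ext => i; rewrite ?(coordD, coordN, coordZ, coord0);
  repeat match goal with
  | |- context [coord ?b ?j ?v] => generalize (coord b j v); intro
  end.

Ltac module_ring := on_coordinates; ring.

Ltac module_field := on_coordinates; field; rewrite ?andbT.

Tactic Notation "linear_from" constr(h) := apply: (eq_of_eq h); module_ring.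

Section JordanIdentities.
Variables (k : fieldType) (A : algebra k).
Hypothesis two_neq0 : (2 : k) != 0.
Hypothesis jA : jordan A.
Local Notation "x ** y" := (@amul k A x y) (at level 40, left associativity).
Implicit Types x y z v w e : A.

Lemma amulC x y : x ** y = y ** x.
Proof. by case: jA. Qed.

Lemma amulDl x y z : (x + y) ** z = x ** z + y ** z. Proof. exact: linearDl. Qed.
Lemma amulDr x y z : x ** (y + z) = x ** y + x ** z. Proof. exact: linearDr. Qed.
Lemma amulBl x y z : (x - y) ** z = x ** z - y ** z. Proof. exact: linearBl. Qed.
Lemma amulBr x y z : x ** (y - z) = x ** y - x ** z. Proof. exact: linearBr. Qed.
Lemma amulNl x y : (- x) ** y = - (x ** y). Proof. exact: linearNl. Qed.
Lemma amulNr x y : x ** (- y) = - (x ** y). Proof. exact: linearNr. Qed.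
Lemma amulZl a x y : (a *: x) ** y = a *: (x ** y). Proof. exact: linearZl_LR. Qed.
Lemma amulZr a x y : x ** (a *: y) = a *: (x ** y). Proof. exact: linearZr_LR. Qed.
Lemma amul0l x : 0 ** x = 0. Proof. exact: linear0l. Qed.
Lemma amul0r x : x ** 0 = 0. Proof. exact: linear0r. Qed.
Definition amulE := (amulDl, amulDr, amulBl, amulBr, amulNl, amulNr, amulZl, amulZr, amul0l,
  amul0r).

Lemma jordanE x y : x ** (y ** (x ** x)) = (x ** x) ** (x ** y).
Proof. by case: jA => _ h; rewrite amulC (amulC y) h (amulC x y). Qed.

Let D x w z y := z ** (y ** (x ** w)) - (x ** w) ** (z ** y).

Let D1 x x' w z y : D (x + x') w z y = D x w z y + D x' w z y.
Proof. by rewrite /D !amulE; module_ring. Qed.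
Let D2 x w w' z y : D x (w + w') z y = D x w z y + D x w' z y.
Proof. by rewrite /D !amulE; module_ring. Qed.
Let D3 x w z z' y : D x w (z + z') y = D x w z y + D x w z' y.
Proof. by rewrite /D !amulE; module_ring. Qed.
Let DN1 x w z y : D (- x) w z y = - D x w z y.
Proof. by rewrite /D !amulE; module_ring. Qed.
Let DN2 x w z y : D x (- w) z y = - D x w z y.
Proof. by rewrite /D !amulE; module_ring. Qed.
Let DN3 x w z y : D x w (- z) y = - D x w z y.
Proof. by rewrite /D !amulE; module_ring. Qed.
Let DC x w z y : D x w z y = D w x z y.
Proof. by rewrite /D (amulC x w). Qed.
Let D0 x y : D x x x y = 0.
Proof. by rewrite /D jordanE subrr. Qed.

(** This is half the difference of the identities at x + w and x - w. The part cubic in w vanishes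
    by itself, so 3 is never divided by. *)
Let P0 x w y : D x x w y + 2 *: D x w x y = 0.
Proof.
have h1 := D0 (x + w) y; have h2 := D0 (x - w) y.
rewrite !(D1, D2, D3, DN1, DN2, DN3, D0) ?opprK !(DC w x) in h1.
rewrite !(D1, D2, D3, DN1, DN2, DN3, D0) ?opprK !(DC w x) in h2.
apply: (scale_neq0_eq0 two_neq0).
by linear_from (eq_add h1 (eq_scale (-1) h2)).
Qed.

Lemma jordan_lin3 x w z y :
  z ** (y ** (x ** w)) + x ** (y ** (w ** z)) + w ** (y ** (z ** x)) =
  (x ** w) ** (y ** z) + (w ** z) ** (y ** x) + (z ** x) ** (y ** w).
Proof.
have h := P0 (x + z) w y; have hx := P0 x w y; have hz := P0 z w y.
rewrite !(D1, D2, D3) !(DC z x) in h.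
apply/eqP; rewrite -subr_eq0; apply/eqP; apply: (scale_neq0_eq0 two_neq0).
have := eq_add h (eq_scale (-1) (eq_add hx hz)).
rewrite /D (amulC w z) (amulC z x) (amulC y z) (amulC y x) (amulC y w) => hh.
by linear_from hh.
Qed.

Lemma jordan_lin2 x w y :
  2 *: (x ** (y ** (x ** w))) + w ** (y ** (x ** x)) =
  2 *: ((x ** w) ** (x ** y)) + (x ** x) ** (w ** y).
Proof. by have h := P0 x w y; rewrite /D in h; linear_from h. Qed.

Section Peirce.
Variable e : A.
Hypothesis ee : e ** e = e.

Let half := (2^-1 : k).

Lemma peirce_1 x y j : e ** x = x -> e ** y = j *: y ->
  e ** (x ** y) = j *: (x ** y).
Proof.
move=> ex ey; have := jordan_lin2 e x y.
rewrite ee ex ey (amulC y e) ey (amulC y x) !amulE => h.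
by linear_from h.
Qed.

Lemma peirce_0 x y j : e ** x = 0 -> e ** y = j *: y ->
  e ** (x ** y) = j *: (x ** y).
Proof.
move=> ex ey; have := jordan_lin2 e x y.
rewrite ee ex ey (amulC y e) ey !amulE => h.
by linear_from (eq_scale (-1) h).
Qed.

Lemma peirce_10 x y : e ** x = x -> e ** y = 0 -> x ** y = 0.
Proof.
move=> ex ey; have h0 := @peirce_0 y x 1 ey.
have h1 := @peirce_1 x y 0 ex; rewrite !scale0r in h1; rewrite !scale1r in h0.
by rewrite amulC -h0 // amulC amulC (amulC y) h1.
Qed.

(** Says that a product of two half-space elements has no half-space component, since the eigenvalue
    1/2 is not a root of X^2 - X. *)
Lemma peirce_half x y : e ** x = half *: x -> e ** y = half *: y ->
  e ** (e ** (x ** y)) = e ** (x ** y).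
Proof.
move=> ex ey; have := jordan_lin3 e x y e.
rewrite (amulC y e) ex ey ee !amulE ex ey !amulE (amulC y x) (amulC (x ** y) e) => h.
by linear_from h.
Qed.

(** In the linearized identity for b, b, h and e, the idempotent only meets eigenvectors, so that it
    reduces to a scalar relation between the two sides. Both A_11 and A_00 are covered, through
    [ε]. *)
Lemma half_action b h (ε : bool) : e ** b = ε%:R *: b -> e ** h = half *: h ->
  b ** (b ** h) = half *: ((b ** b) ** h).
Proof.
move=> eb eh.
have ebh : e ** (b ** h) = half *: (b ** h).
  by case: ε eb; rewrite ?scale1r ?scale0r => eb; [apply: peirce_1 | apply: peirce_0].
have ebb : e ** (b ** b) = ε%:R *: (b ** b).
  case: ε eb; rewrite ?scale1r ?scale0r => eb.
    by rewrite -[RHS]scale1r; apply: peirce_1; rewrite ?scale1r.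
  by rewrite -[RHS](scale0r (b ** b)); apply: peirce_0; rewrite ?scale0r.
have := jordan_lin3 b b h e.
rewrite (amulC h b) ebh ebb eb eh !amulE (amulC h) (amulC (b ** h)) => hh.
have hf : 2 * half = 1 by rewrite /half divff.
have hf2 : (2 *: (b ** (b ** h))) = 2 *: (half *: ((b ** b) ** h)).
  rewrite !scalerA hf scale1r.
  case: ε {eb ebb} hh => /= hh.
    have := eq_scale (-2) hh; rewrite !(scalerA, scalerDr) => {}hh.
    apply: (eq_of_eq hh); rewrite !mulr1 !mulNr hf; module_ring.
  have := eq_scale 2 hh; rewrite !(scalerA, scalerDr) => {}hh.
  apply: (eq_of_eq hh); rewrite !hf; module_ring.
by apply: (scalerI two_neq0).
Qed.

(** The multiplication L by e satisfies 2L^3 - 3L^2 + L = 0, and the components are the Lagrange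
    polynomials in L at 1, 1/2 and 0. They are recorded because [joint_eigenvector] needs components
    that are polynomials in L. *)
Lemma peirce_decomp v : exists v1 vh v0,
  [/\ v = v1 + vh + v0, e ** v1 = v1, e ** vh = half *: vh & e ** v0 = 0] /\
  [/\ v1 = 2 *: (e ** (e ** v)) - e ** v, vh = 4 *: (e ** v - e ** (e ** v)) &
      v0 = v - 3 *: (e ** v) + 2 *: (e ** (e ** v))].
Proof.
have hf : 2 * half = 1 by rewrite /half divff.
have := jordan_lin2 e v e; rewrite !ee (amulC v e) (amulC (e ** v) e) => h.
exists (2 *: (e ** (e ** v)) - e ** v), (4 *: (e ** v - e ** (e ** v))),
  (v - 3 *: (e ** v) + 2 *: (e ** (e ** v))); split; last by split.
split; first by module_ring.
- by rewrite !amulE; linear_from h.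
- rewrite !amulE; apply: (scalerI two_neq0); rewrite (scalerA _ half) hf scale1r.
  by linear_from (eq_scale (-4) h).
- by rewrite !amulE; linear_from h.
Qed.

End Peirce.
End JordanIdentities.

(** * Powers *)

Definition root_closed (k : fieldType) : Prop :=
  forall q : {poly k}, (1 < size q)%N -> exists c, root q c.

Section Powers.
Variables (k : fieldType) (A : algebra k).
Hypothesis two_neq0 : (2 : k) != 0.
Hypothesis jA : jordan A.
Local Notation "x ** y" := (@amul k A x y) (at level 40, left associativity).
Implicit Types (x y z v w e s : A) (q r : {poly k}).

(* [pow x n] is the power with exponent [n.+1]. *)
Definition pow x n : A := iter n (@amul k A x) x.

Lemma powS x n : pow x n.+1 = x ** pow x n. Proof. by []. Qed.

Lemma pow_rec x n v : pow x n.+2 ** v =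
  2 *: (pow x n.+1 ** (x ** v)) + pow x 1 ** (pow x n ** v)
  - pow x n ** (x ** (x ** v)) - x ** (x ** (pow x n ** v)).
Proof.
have := jordan_lin3 two_neq0 jA x v (pow x n) x.
rewrite !powS (amulC jA v (pow x n)) (amulC jA (pow x n) x) (amulC jA v).
rewrite (amulC jA (pow x n ** v)) (amulC jA (x ** v)) /= => h.
by linear_from h.
Qed.

(** By [pow_rec] the multiplication by any power is a polynomial in those by x and by its square,
    which commute by the Jordan identity. The induction carries two consecutive powers. *)
Lemma pow_comm x n v : pow x n ** (x ** v) = x ** (pow x n ** v).
Proof.
suff: (forall v, pow x n ** (x ** v) = x ** (pow x n ** v) /\
    pow x n ** (pow x 1 ** v) = pow x 1 ** (pow x n ** v)) /\
  (forall v, pow x n.+1 ** (x ** v) = x ** (pow x n.+1 ** v) /\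
    pow x n.+1 ** (pow x 1 ** v) = pow x 1 ** (pow x n.+1 ** v)).
  by case=> /(_ v) [].
have c1 w : pow x 1 ** (x ** w) = x ** (pow x 1 ** w).
  by rewrite /= -jordanE // (amulC jA w).
elim: n => [|n [IH0 IH1]]; first by split=> w; split.
split=> // w; rewrite !pow_rec.
have {}IH00 w' := (IH0 w').1; have {}IH01 w' := (IH0 w').2.
have {}IH10 w' := (IH1 w').1; have {}IH11 w' := (IH1 w').2.
move: {IH0 IH1} (pow x n.+1) (pow x n) (pow x 1) c1 IH00 IH01 IH10 IH11.
move=> a b p c1 IH00 IH01 IH10 IH11.
split; rewrite !(amulE, IH10, IH00, c1, IH01, IH11) //.
Qed.

Lemma pow_mul x i j : pow x i ** pow x j = pow x (i + j).+1.
Proof.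
elim: j => [|j IH]; first by rewrite addn0 powS amulC.
by rewrite addnS !powS pow_comm IH.
Qed.

(* The value at [s] of the polynomial [q] in the multiplication by [x]. *)
Definition act x s (q : {poly k}) : A :=
  \sum_(i < size q) q`_i *: iter i (@amul k A x) s.

Lemma act_widen x s q n : (size q <= n)%N ->
  act x s q = \sum_(i < n) q`_i *: iter i (@amul k A x) s.
Proof.
move=> h; rewrite /act (big_ord_widen _ (fun i => q`_i *: iter i (@amul k A x) s) h).
rewrite big_mkcond /=; apply: eq_bigr => i _; case: ltnP => // h'.
by rewrite nth_default ?scale0r.
Qed.

Lemma actD x s q r : act x s (q + r) = act x s q + act x s r.
Proof.
rewrite (act_widen x s (size_polyD q r)) (act_widen x s (leq_maxl (size q) (size r))).
rewrite (act_widen x s (leq_maxr (size q) (size r))) -big_split /=.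
by apply: eq_bigr => i _; rewrite coefD scalerDl.
Qed.

Lemma actC x s c : act x s c%:P = c *: s.
Proof. by rewrite (act_widen x s (size_polyC_leq1 c)) big_ord1 coefC. Qed.

Lemma act0 x s : act x s 0 = 0.
Proof. by rewrite -[0]/(0%:P) actC scale0r. Qed.

Lemma act1 x s : act x s 1 = s.
Proof. by rewrite actC scale1r. Qed.

Lemma actMX x s q : act x s (q * 'X) = x ** act x s q.
Proof.
have h : (size (q * 'X)%R <= (size q).+1)%N.
  by rewrite (leq_trans (size_polyMleq _ _)) // size_polyX addn2.
rewrite (act_widen x s h) big_ord_recl coefMX scale0r add0r /act linear_sumr.
by apply: eq_bigr => i _; rewrite coefMX /= linearZr_LR.
Qed.

Lemma act_mul x s q r : act x s (q * r) = act x (act x s r) q.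
Proof.
elim/poly_ind: q => [|q c IH]; first by rewrite mul0r !act0.
rewrite mulrDl !actD actC -mulrA (mulrC 'X) mulrA !actMX IH.
congr (_ + _); elim/poly_ind: r {IH} => [|r d IH]; first by rewrite mulr0 !act0 scaler0.
by rewrite mulrDr mulrA -polyCM !actD !actMX IH !actC scalerDr linearZr_LR scalerA.
Qed.

Lemma act_scale x s c q : act x (c *: s) q = c *: act x s q.
Proof. by rewrite -(actC x s c) -act_mul mulrC act_mul actC. Qed.

Lemma act_comm a x s q : (forall v, a ** (x ** v) = x ** (a ** v)) ->
  a ** act x s q = act x (a ** s) q.
Proof.
move=> h; elim/poly_ind: q => [|q c IH]; first by rewrite !act0 amul0r.
by rewrite !actD !actMX !actC amulDr h IH amulZr.
Qed.

Lemma act_powE x q : act x x q = \sum_(i < size q) q`_i *: pow x i.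
Proof. by []. Qed.

Lemma act_pow_comm x q v : act x x q ** (x ** v) = x ** (act x x q ** v).
Proof.
have E w : act x x q ** w = \sum_(i < size q) q`_i *: (pow x i ** w).
  rewrite act_powE linear_sumlz; by apply: eq_bigr => i _; rewrite linearZl_LR.
rewrite !E linear_sumr /=.
by apply: eq_bigr => i _; rewrite linearZr_LR pow_comm.
Qed.

(** Without a unit, [act x x q] is the value at x of the polynomial 'X * q, whose constant term is
    zero; this explains the extra 'X. *)
Lemma act_power_mul x q r : act x x q ** act x x r = act x x ('X * q * r).
Proof.
rewrite (act_comm _ _ (act_pow_comm x q)) (amulC jA) -actMX (mulrC _ r) [in RHS]act_mul.
by rewrite (mulrC 'X).
Qed.

Lemma act_pow x n : act x x 'X^n = pow x n.
Proof.
elim: n => [|n IH]; first by rewrite expr0 act1.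
by rewrite exprSr actMX IH.
Qed.

Lemma act_dependence x s : exists2 q : {poly k}, q != 0 & act x s q = 0.
Proof.
pose n := (\dim {: A}).+1; pose t := [tuple iter i (@amul k A x) s | i < n].
have nf : ~~ free t.
  apply/negP => f; have := dimvS (subvf <<t>>%VS).
  by rewrite (eqP f) size_tuple ltnn.
have [c c0 [i ci]] : exists2 c : 'I_n -> k, \sum_(i < n) c i *: t`_i = 0 &
    exists i, c i != 0.
  apply: NNPP => H; move/negP: nf; apply; apply/freeP => c c0 i.
  by apply/eqP/negP => /negP ci; apply: H; exists c => //; exists i.
exists (\poly_(i < n) c (inord i)).
  by apply/eqP => /polyP /(_ i); rewrite coef_poly ltn_ord inord_val coef0 => /eqP; exact/negP.
rewrite (act_widen x s (size_poly _ _)) -[RHS]c0; apply: eq_bigr => j _.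
rewrite coef_poly ltn_ord inord_val; congr (_ *: _).
by rewrite (nth_map j) ?size_enum_ord // nth_ord_enum.
Qed.

Definition nilpotent x := exists n, pow x n = 0.

Lemma poly_split_X (q : {poly k}) : q != 0 ->
  exists a, exists2 g, q = g * 'X^a & coprimep 'X^(a.+1) g.
Proof.
move=> q0; have [a [g g0 ->]] := multiplicity_XsubC q 0.
rewrite q0 /= in g0; exists a, g; first by rewrite subr0.
by apply: coprimep_expl; rewrite -['X]subr0 coprimep_sym coprimep_XsubC.
Qed.

(** Write an annihilating polynomial as X^a g with g prime to X, and let s X^(a+1) + t g = 1. Then s
    X^(a+1) is idempotent modulo X^(a+1) g and its value at x is the required element; if that value
    vanishes, so does the power of x with exponent a + 1. *)
Lemma idempotent_or_nil x :
  nilpotent x \/ exists q, act x x q ** act x x q = act x x q /\ act x x q != 0.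
Proof.
have [m m0 am] := act_dependence x x.
have [a [g em /Bezout_eq1_coprimepP [[s t] /= st]]] := poly_split_X m0.
have kill r : act x x (r * m) = 0 by rewrite act_mul am; elim/poly_ind: r => [|r c IH];
  rewrite ?act0 // actD actMX IH amul0r actC scaler0 addr0.
have e1 : act x x ('X * ('X^a * s) * ('X^a * s)) = act x x ('X^a * s).
  have -> : 'X * ('X^a * s) * ('X^a * s) = 'X^a * s + (- (s * t)) * m.
    have -> : 'X * ('X^a * s) * ('X^a * s) = 'X^a * s * (s * 'X^(a.+1)).
      by rewrite exprS; ring.
    have -> : s * 'X^(a.+1) = 1 - t * g by rewrite -st; ring.
    by rewrite em; ring.
  by rewrite actD kill addr0.
have [u0|u0] := eqVneq (act x x ('X^a * s)) 0; last first.
  by right; exists ('X^a * s); rewrite act_power_mul e1.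
left; exists a; rewrite -act_pow.
have -> : 'X^a = 'X^(a.+1) * ('X^a * s) + t * m.
  by rewrite em -[LHS]mulr1 -st; ring.
by rewrite actD kill addr0 act_mul u0 -[X in act _ X _](scale0r (0 : A)) act_scale scale0r.
Qed.

Lemma act_sub_factor x s c q :
  act x s (q * ('X - c%:P)) = x ** act x s q - c *: act x s q.
Proof.
by rewrite mulrBr actD actMX -mulrN -polyCN mulrC act_mul actC scaleNr.
Qed.

Lemma pow_vanish x m n : (m <= n)%N -> pow x m = 0 -> pow x n = 0.
Proof.
by move=> /subnKC <- h; elim: (n - m)%N => [|d IH]; rewrite ?addn0 // addnS powS IH amul0r.
Qed.

Section Idempotent.
Variable e : A.
Hypotheses (ee : e ** e = e) (e0 : e != 0).

Lemma act_unit x q : e ** x = x -> e ** act x e q = act x e q.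
Proof.
move=> ex; elim/poly_ind: q => [|q c IH]; first by rewrite act0 amul0r.
rewrite actD actMX actC amulDr amulZr ee; congr (_ + _).
by rewrite -[RHS]scale1r; apply: peirce_1 => //; rewrite ?scale1r.
Qed.

Lemma act_unit_shift x q : e ** x = x -> act x e (q * 'X) = act x x q.
Proof.
move=> ex; rewrite act_mul; congr (act x _ q).
by rewrite -['X]mul1r actMX act1 (amulC jA) ex.
Qed.

(** In the Peirce space where e is a unit, [act x e q] is the value of [q] at x, including the
    constant term. *)
Lemma act_unit_mul x q r : e ** x = x ->
  act x e q ** act x e r = act x e (q * r).
Proof.
move=> ex; suff h v : e ** v = v -> act x e q ** (x ** v) = x ** (act x e q ** v).
  have : forall r, act x e q ** act x e r = act x (act x e q ** e) r.
    elim/poly_ind => [|r' c IH]; first by rewrite !act0 amul0r.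
    rewrite !actD !actMX !actC amulDr -IH h ?amulZr //; exact: act_unit.
  by move=> ->; rewrite (amulC jA) act_unit // mulrC act_mul.
elim/poly_ind: q => [|q c _] ev; first by rewrite act0 !amul0l amul0r.
have ev' : e ** (x ** v) = x ** v.
  by rewrite -[RHS]scale1r; apply: peirce_1 => //; rewrite ?scale1r.
rewrite actD act_unit_shift // actC !amulDl !amulDr !amulZl !amulZr ev ev'.
by rewrite act_pow_comm.
Qed.

(** A root c of an annihilating polynomial gives a factorization into P = (X - c)^a and g prime to
    each other, and Bezout gives an idempotent value u. If u = 0 then P annihilates x, so x - c e is
    nilpotent; if u = e then g annihilates x and has smaller degree. *)
Lemma local_nil (root_exists : root_closed k) x :
  e ** x = x ->
  (forall g, e ** g = g -> g ** g = g -> g = 0 \/ g = e) ->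
  exists c, nilpotent (x - c *: e).
Proof.
move=> ex loc; have [m m0 am] := act_dependence x e.
move: {2}(size m) (leqnn (size m)) => n; elim: n m m0 am => [|n IH] m m0 am sm.
  by move: m0; rewrite -size_poly_eq0; case: (size m) sm.
have kill r : act x e (r * m) = 0.
  by rewrite act_mul am -[X in act _ X _](scale0r (0 : A)) act_scale scale0r.
have [sm1|sm1] := leqP (size m) 1.
  move: m0 am; rewrite (size1_polyC sm1) polyC_eq0 actC => c0 /eqP.
  by rewrite scaler_eq0 (negPf c0) (negPf e0).
have [c rc] := root_exists m sm1.
have [a [g g0 em]] := multiplicity_XsubC m c; rewrite m0 /= in g0.
have a0 : (0 < a)%N.
  by case: a em => // em; move: g0; rewrite -[g]mulr1 -(expr0 ('X - c%:P)) -em rc.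
have /Bezout_eq1_coprimepP [[s t] /= st] : coprimep (('X - c%:P) ^+ a) g.
  by apply: coprimep_expl; rewrite coprimep_sym coprimep_XsubC.
pose P := ('X - c%:P) ^+ a; pose u := act x e (s * P).
rewrite -/P in st em.
have sP : s * P = 1 - t * g by rewrite -st; ring.
have uu : u ** u = u.
  rewrite act_unit_mul //; have -> : s * P * (s * P) = s * P + (- (s * t)) * m.
    rewrite em [X in _ * X = _]sP; ring.
  by rewrite actD kill addr0.
have [u0|ue] := loc u (act_unit _ ex) uu.
  have aP : act x e P = 0.
    have -> : P = P * (s * P) + t * m by rewrite em -[LHS]mulr1 -st; ring.
    by rewrite actD kill addr0 -act_unit_mul // -/u u0 amul0r.
  (* The shift of [pow] makes this the power of exponent [a], which is the value of P. *)
  exists c, a.-1; set y := x - c *: e.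
  have hy q : act x e (q * ('X - c%:P)) = y ** act x e q.
    by rewrite act_sub_factor /y amulBl amulZl act_unit.
  have hi n' : act x e (('X - c%:P) ^+ n') = iter n' (@amul k A y) e.
    by elim: n' => [|n' IHn]; rewrite ?expr0 ?act1 // exprSr hy IHn.
  rewrite -[RHS]aP hi -(prednK a0) iterSr /pow; congr (iter _ _ _).
  by rewrite /y amulBl amulZl ee (amulC jA) ex.
have ag : act x e g = 0.
  have h1 : act x e (t * g) = 0.
    have : act x e 1 = e by rewrite act1.
    by rewrite -st actD -/u ue -[RHS]addr0 => /addrI.
  have -> : g = g * (t * g) + s * m by rewrite em -[LHS]mulr1 -st; ring.
  by rewrite actD kill addr0 -act_unit_mul // h1 amul0r.
have gn0 : g != 0 by apply: contraNneq g0 => ->; rewrite root0.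
apply: (IH g gn0 ag); rewrite -ltnS; apply: leq_trans sm.
rewrite em size_Mmonic ?monic_exp ?monicXsubC // size_exp_XsubC addnS /=.
by rewrite -[X in (X < _)%N]addn0 ltn_add2l.
Qed.

End Idempotent.

(* Modulo [pow x 4 = 0] and [pow x 5 = 0] the recursion [pow_rec] gives two
   independent linear relations between [v] and [pow x 1 ** v]. *)
Lemma nil_eigenvalue x v c :
  pow x 3 = 0 -> v != 0 -> x ** v = c *: v -> c = 0.
Proof.
move=> x3 v0 xv; set w := pow x 1 ** v.
have x4 : pow x 4 = 0 by rewrite powS x3 amul0r.
have xw : x ** w = c *: w by rewrite /w -pow_comm xv amulZr.
have e2 : pow x 2 ** v = 3 * c *: w - 2 * c ^+ 3 *: v.
  by rewrite pow_rec xv -[pow x 0]/x !(amulE, xv) -/w; module_ring.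
have e3 : pow x 1 ** w = 4 * c ^+ 4 *: v - 4 * c ^+ 2 *: w.
  have := pow_rec x 1 v; rewrite x3 amul0l -/w !(amulE, xw, xv) e2 -/w => h.
  by linear_from (eq_scale (-1) h).
have e4 : 20 * c ^+ 3 *: w = 16 * c ^+ 5 *: v.
  have := pow_rec x 2 v; rewrite x4 x3 amul0l e2 !(amulE, xw, xv, e2) e3 -/w => h.
  by linear_from h.
have e5 : 96 * c ^+ 5 *: w = 80 * c ^+ 7 *: v.
  have := congr1 (@amul k A (pow x 1)) e4; rewrite !amulZr -/w e3 => h.
  by linear_from (eq_scale (-1) h).
(* The combination eliminates [w], as 24 * 20 = 5 * 96. What remains is 5 * 80 - 24 * 16 = 16, a
   power of 2, so that no odd characteristic is lost. *)
have h : (2 ^+ 4 * c ^+ 7) *: v = 0.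
  have h4 := eq_scale (24 * c ^+ 2) e4; have h5 := eq_scale (-5) e5.
  by linear_from (eq_add h4 h5).
apply/eqP; move/eqP: h; rewrite scaler_eq0 (negPf v0) orbF mulf_eq0.
by rewrite expf_eq0 (negPf two_neq0) expf_eq0.
Qed.

End Powers.

(** * Local subalgebras *)

Section RelativeIndependence.
Variables (k : fieldType) (V : vectType k).
Implicit Types (u v a b c : V) (X : seq V).

Lemma span_consP v b X : v \in <<b :: X>>%VS ->
  exists x, exists2 w, w \in <<X>>%VS & v = x *: b + w.
Proof.
rewrite span_cons => /memv_addP [b' /vlineP [x ->] [w wX ->]].
by exists x, w.
Qed.

Lemma span1P v a : v \in <<[:: a]>>%VS -> exists x, v = x *: a.
Proof.
case/span_consP=> x [w]; rewrite span_nil memv0 => /eqP -> ->.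
by exists x; rewrite addr0.
Qed.

Lemma span2P v a b : v \in <<[:: a; b]>>%VS -> exists x y, v = x *: a + y *: b.
Proof. by case/span_consP=> x [w /span1P [y ->] ->]; exists x, y. Qed.

Lemma span3P v a b c : v \in <<[:: a; b; c]>>%VS ->
  exists x y z, v = x *: a + y *: b + z *: c.
Proof.
by case/span_consP=> x [w /span2P [y [z ->]] ->]; exists x, y, z; rewrite addrA.
Qed.

Lemma span4P v a b c d : v \in <<[:: a; b; c; d]>>%VS ->
  exists x y z t, v = x *: a + y *: b + z *: c + t *: d.
Proof.
case/span_consP=> x [w /span3P [y [z [t ->]]] ->].
by exists x, y, z, t; rewrite !addrA.
Qed.

(* Linear independence modulo [u], which may be zero. *)
Definition cons_neq0 u X : seq V := if u == 0 then X else u :: X.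

Definition indep u X : bool := free (cons_neq0 u X).

Lemma span_cons_neq0 u X : <<cons_neq0 u X>>%VS = <<u :: X>>%VS.
Proof.
rewrite /cons_neq0; have [->|//] := eqVneq u 0; rewrite span_cons.
by rewrite -[LHS]add0v; congr (_ + _)%VS.
Qed.

Lemma size_cons_neq0 u X :
  size (cons_neq0 u X) = (size X + (u != 0%R))%N.
Proof. by rewrite /cons_neq0; case: eqVneq; rewrite ?addn0 ?addn1. Qed.

Lemma indep_dim u X : indep u X -> \dim <<u :: X>> = (size X + (u != 0%R))%N.
Proof. by rewrite -size_cons_neq0 -span_cons_neq0 => /eqP. Qed.

Lemma sub_span_cons u X (W : {vspace V}) : u \in W -> {subset X <= W} ->
  (<<u :: X>> <= W)%VS.
Proof.
move=> uW XW; apply/span_subvP => v; rewrite inE => /orP[/eqP -> //|]; exact: XW.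
Qed.

Lemma indep_span u X (W : {vspace V}) : indep u X -> u \in W ->
  {subset X <= W} -> \dim W = (size X + (u != 0%R))%N -> W = <<u :: X>>%VS.
Proof.
move=> iX uW XW dW; apply/esym/eqP.
by rewrite eqEdim sub_span_cons // indep_dim // dW leqnn.
Qed.

Lemma indep_size u X (W : {vspace V}) : indep u X -> u \in W ->
  {subset X <= W} -> (size X + (u != 0%R) <= \dim W)%N.
Proof. by move=> iX uW XW; rewrite -indep_dim // dimvS // sub_span_cons. Qed.

Lemma indep_rcons u X y : indep u X -> y \notin <<u :: X>>%VS ->
  indep u (rcons X y).
Proof.
rewrite -span_cons_neq0 /indep /cons_neq0; case: eqVneq => _ fX yX.
  by rewrite (perm_free (Y := y :: X)) ?perm_rcons // free_cons yX fX.
rewrite (perm_free (Y := y :: u :: X)); first by rewrite free_cons yX fX.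
by rewrite -[u :: rcons X y]/(rcons (u :: X) y) perm_rcons.
Qed.

Lemma indep_extend u X (W : {vspace V}) : indep u X -> u \in W ->
  {subset X <= W} -> (size X + (u != 0%R) < \dim W)%N ->
  exists2 y, y \in W & y \notin <<u :: X>>%VS.
Proof.
move=> iX uW XW dW; apply: NNPP => H.
have /dimvS : (W <= <<u :: X>>)%VS.
  by apply/subvP => y yW; apply/negPn/negP => yX; apply: H; exists y.
by rewrite indep_dim // leqNgt dW.
Qed.

Lemma free_coef X (c : seq k) i : free X ->
  \sum_(i < size X) c`_i *: X`_i = 0 -> (i < size X)%N -> c`_i = 0.
Proof.
move=> fX h iX; have /freeP H : free (in_tuple X) by [].
exact: (H (fun i : 'I_(size X) => c`_i) h (Ordinal iX)).
Qed.

Lemma indep_coef u X l (c : seq k) i : indep u X ->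
  l *: u + \sum_(i < size X) c`_i *: X`_i = 0 -> (i < size X)%N -> c`_i = 0.
Proof.
rewrite /indep /cons_neq0; case: eqVneq => [->|_] fX h iX.
  by apply: free_coef fX _ iX; rewrite -[RHS]h scaler0 add0r.
apply: (free_coef (c := l :: c) (i := i.+1) fX) => //.
by rewrite big_ord_recl.
Qed.

Lemma free_of_coef X : (forall c : nat -> k,
    \sum_(i < size X) c i *: X`_i = 0 -> forall i, (i < size X)%N -> c i = 0) ->
  free X.
Proof.
move=> H; suff : free (in_tuple X) by [].
apply/freeP => c h i; have E (j : 'I_(size X)) : oapp c 0 (insub (val j)) = c j.
  by rewrite valK.
rewrite -E; apply: (H (fun j => oapp c 0 (insub j)) _ _ (ltn_ord i)).
by rewrite -[RHS]h; apply: eq_bigr => j _; rewrite E.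
Qed.

Lemma indep_of_coef u X : (forall (c : nat -> k) l,
    l *: u + \sum_(i < size X) c i *: X`_i = 0 ->
    l *: u = 0 /\ forall i, (i < size X)%N -> c i = 0) -> indep u X.
Proof.
move=> H; rewrite /indep /cons_neq0; case: eqVneq => [u0|u0]; apply: free_of_coef => c.
  move=> h; apply: (H c 0 _).2; by rewrite scale0r add0r.
rewrite big_ord_recl => /(H (fun j => c j.+1)) [] /eqP.
by rewrite scaler_eq0 (negPf u0) orbF => /eqP c0 h [|i]; [rewrite c0 | exact: h].
Qed.

Lemma indep2E u a b l x y : indep u [:: a; b] ->
  l *: u + x *: a + y *: b = 0 -> x = 0 /\ y = 0.
Proof.
move=> i2 h; have H i := indep_coef (c := [:: x; y]) (i := i) (l := l) i2.
have E : l *: u + \sum_(i < 2) [:: x; y]`_i *: [:: a; b]`_i = 0.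
  by rewrite !big_ord_recl big_ord0 /= addr0 addrA.
by split; [apply: (H 0 E) | apply: (H 1 E)].
Qed.

Lemma indep3E u a b c l x y z : indep u [:: a; b; c] ->
  l *: u + x *: a + y *: b + z *: c = 0 -> [/\ x = 0, y = 0 & z = 0].
Proof.
move=> i3 h; have H i := indep_coef (c := [:: x; y; z]) (i := i) (l := l) i3.
have E : l *: u + \sum_(i < 3) [:: x; y; z]`_i *: [:: a; b; c]`_i = 0.
  by rewrite !big_ord_recl big_ord0 /= addr0 !addrA.
by split; [apply: (H 0 E) | apply: (H 1 E) | apply: (H 2 E)].
Qed.

End RelativeIndependence.

Section LocalSpaces.
Variables (k : fieldType) (A : algebra k).
Hypothesis two_neq0 : (2 : k) != 0.
Hypothesis jA : jordan A.
Local Notation "x ** y" := (@amul k A x y) (at level 40, left associativity).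
Implicit Types (x y z v w u : A) (W : {vspace A}).

(* A subalgebra [W] with unit [u] in which everything is nilpotent modulo [u];
   with [u = 0] this is a nil subalgebra. *)
Definition local_space u W (m : nat) : Prop :=
  [/\ u \in W, (forall v w, v \in W -> w \in W -> v ** w \in W),
      (forall v, v \in W -> u ** v = (u != 0)%:R *: v),
      (forall v, v \in W -> exists c, nilpotent (v - c *: u)) &
      \dim W = (m + (u != 0%R))%N].

Lemma minimal_pow z : nilpotent z -> z != 0 -> exists n, pow z n.+1 = 0 /\ pow z n != 0.
Proof.
move=> [n zn] z0; elim: n zn => [|n IH] zn; first by rewrite -[z]/(pow z 0) zn eqxx in z0.
by have [/IH//|h] := eqVneq (pow z n) 0; exists n.
Qed.

Section InLocalSpace.
Variables (u : A) (W : {vspace A}) (m : nat).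
Hypothesis lW : local_space u W m.
Let ε : k := (u != 0)%:R.

Lemma local_u : u \in W. Proof. by case: lW. Qed.
Lemma local_mul v w : v \in W -> w \in W -> v ** w \in W. Proof. by case: lW => _ h _ _ _;
  apply: h. Qed.
Lemma local_ul v : v \in W -> u ** v = ε *: v. Proof. by case: lW => _ _ h _ _; apply: h. Qed.
Lemma local_ur v : v \in W -> v ** u = ε *: v. Proof. by rewrite (amulC jA); apply: local_ul. Qed.
Lemma local_dim : \dim W = (m + (u != 0%R))%N. Proof. by case: lW. Qed.

Lemma local_epsK (c : k) : c * ε = 0 -> c *: u = 0.
Proof.
rewrite /ε; case: eqVneq => [->|_]; first by rewrite scaler0.
by rewrite mulr1 => ->; rewrite scale0r.
Qed.

Lemma local_pow z n : z \in W -> pow z n \in W.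
Proof. by move=> zW; elim: n => //= n IH; apply: local_mul. Qed.

(** Multiplying a relation by the last nonzero power isolates the coefficient of [u]. After that,
    repeated multiplication by z isolates the lowest remaining coefficient. *)
Lemma local_indep_pow z n : z \in W -> pow z n.+1 = 0 -> pow z n != 0 ->
  indep u [seq pow z i | i <- iota 0 n.+1].
Proof.
move=> zW zn1 zn.
have key (c : nat -> k) l : l *: u + \sum_(i < n.+1) c i *: pow z i = 0 ->
    l *: u = 0 /\ forall i, (i < n.+1)%N -> c i = 0.
  move=> h; have lu : l *: u = 0.
    have := congr1 (@amul k A (pow z n)) h; rewrite amul0r amulDr amulZr.
    rewrite local_ur ?local_pow // linear_sumr big1 ?addr0 => [|i _]; last first.
      rewrite /= amulZr pow_mul // -addnS (pow_vanish _ zn1) ?scaler0 //.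
      by rewrite addnS ltnS leq_addr.
    move/eqP; rewrite scalerA scaler_eq0 (negPf zn) orbF => /eqP; exact: local_epsK.
  split=> // i; rewrite lu add0r in h.
  elim/ltn_ind: i => i IH lin; have [d en] : exists d, n = (d + i)%N.
    by exists (n - i)%N; rewrite subnK.
  have := congr1 (iter d (@amul k A z)) h.
  have -> : iter d (@amul k A z) 0 = 0 by elim: (d) => //= d' ->; rewrite amul0r.
  have -> : iter d (@amul k A z) (\sum_(i < n.+1) c i *: pow z i) =
      \sum_(i < n.+1) c i *: pow z (d + i).
    elim: (d) => [|d' /= ->]; first by [].
    by rewrite linear_sumr; apply: eq_bigr => j _; rewrite /= amulZr.
  rewrite (bigD1 (Ordinal lin)) //= -en big1 ?addr0.
    by move=> /eqP; rewrite scaler_eq0 (negPf zn) orbF => /eqP.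
  move=> j ji; have [lji|lij] := ltnP j i; first by rewrite IH ?scale0r.
  have neij : (val j != i)%N by rewrite -(inj_eq val_inj) in ji.
  rewrite (pow_vanish _ zn1) ?scaler0 //.
  by move: neij lij en => /=; move: (val j) => j' /=; lia.
apply: indep_of_coef; rewrite size_map size_iota => c l h.
apply: key; rewrite -[RHS]h; congr (_ + _); apply: eq_bigr => i _.
by rewrite (nth_map 0) ?size_iota // nth_iota.
Qed.

End InLocalSpace.
End LocalSpaces.

Ltac comb_norm :=
  rewrite /comb /q0 /q1 /q2 /q3 /= ?(scale0r, scale1r, addr0, add0r).

(** * Local subalgebras of dimension at most three modulo the unit *)

Section LocalClassification.
Variables (k : closedFieldType) (A : algebra k).
Hypothesis two_neq0 : (2 : k) != 0.
Hypothesis jA : jordan A.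
Local Notation "x ** y" := (@amul k A x y) (at level 40, left associativity).
Implicit Types (x y z v w u : A) (W : {vspace A}).

Section InLocalSpace.
Variables (u : A) (W : {vspace A}) (m : nat).
Hypothesis lW : local_space u W m.
Let ε : k := (u != 0)%:R.
Let uW := local_u lW.
Let mulW := local_mul lW.

Lemma local_pow_eq0 z : z \in W -> nilpotent z -> pow z m = 0.
Proof.
move=> zW zn; have [->|z0] := eqVneq z 0.
  by case: (m) => // n; rewrite powS amul0l.
have [n [zn1 znn]] := minimal_pow zn z0.
apply: (pow_vanish _ zn1).
have := indep_size (local_indep_pow two_neq0 jA lW zW zn1 znn) uW.
rewrite size_map size_iota (local_dim lW) leq_add2r; apply.
by move=> v /mapP [i _ ->]; exact: (local_pow lW _ zW).
Qed.

Lemma local_pow_span z n : m = n.+1 -> z \in W -> nilpotent z -> pow z n != 0 ->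
  W = <<u :: [seq pow z i | i <- iota 0 m]>>%VS.
Proof.
move=> mE zW zn z0; apply: indep_span => //.
- by rewrite mE; apply: (local_indep_pow two_neq0 jA lW) => //; rewrite -mE local_pow_eq0.
- by move=> v /mapP [i _ ->]; exact: (local_pow lW _ zW).
- by rewrite (local_dim lW) size_map size_iota.
Qed.

Lemma indep_nil : indep u [::].
Proof.
rewrite /indep /cons_neq0; case: eqVneq => [_|u0]; first exact: nil_free.
by rewrite seq1_free.
Qed.

Lemma local_extend X : indep u X -> {subset X <= W} -> (size X < m)%N ->
  exists y, [/\ y \in W, nilpotent y & y \notin <<u :: X>>%VS].
Proof.
move=> iX XW sX; have [|y yW yX] := indep_extend iX uW XW.
  by rewrite (local_dim lW) ltn_add2r.
have [c yc] : exists c, nilpotent (y - c *: u) by case: lW => _ _ _ h _; apply: h.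
exists (y - c *: u); split=> //; first by rewrite memvB // memvZ.
apply: contra yX => h; rewrite -(subrK (c *: u) y) memvD //.
by rewrite memvZ // memv_span // mem_head.
Qed.

(** Polarization would need b + c and b - c to be nilpotent, which is only known after subtracting
    multiples of [u]. Adding the two squares and comparing coefficients of b and c shows that the
    multiple subtracted from b + c is zero. *)
Lemma local_square_zero_pair b c :
  (forall z, z \in W -> nilpotent z -> z ** z = 0) ->
  b \in W -> nilpotent b -> c \in W -> nilpotent c -> indep u [:: b; c] -> b ** c = 0.
Proof.
move=> H bW bn cW cn ibc; have bb := H b bW bn; have cc := H c cW cn.
have loc v : v \in W -> exists l, (v - l *: u) ** (v - l *: u) = 0.
  move=> vW; have [l vl] : exists l, nilpotent (v - l *: u) by case: lW => _ _ _ h _; apply: h.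
  by exists l; apply: H => //; rewrite memvB // memvZ.
have [l h1] := loc _ (memvD bW cW); have [n h2] := loc _ (memvB bW cW).
rewrite !amulE !(local_ul lW, local_ur jA lW) // bb cc (amulC jA c b) in h1 h2.
rewrite -/ε in h1 h2.
have e0 : l * ε = 0.
  have h : (- (l ^+ 2 * ε + n ^+ 2 * ε)) *: u + (2 * ε * (l + n)) *: b + (2 * ε * (l - n)) *: c
    = 0.
    by linear_from (eq_scale (-1) (eq_add h1 h2)).
  have [e1 e2] := indep2E ibc h.
  have : (2 * 2) * (l * ε) = 0 by transitivity (2 * ε * (l + n) + 2 * ε * (l - n));
    [ring | rewrite e1 e2 addr0].
  by move/eqP; rewrite mulf_eq0 [2 * 2 == 0]mulf_eq0 (negPf two_neq0) => /eqP.
apply: (scale_neq0_eq0 two_neq0).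
have h3 : l * (l * ε) = 0 by rewrite e0 mulr0.
have h : 2 *: (b ** c) - (2 * (l * ε)) *: (b + c) + (l * (l * ε)) *: u = 0 by linear_from h1.
by rewrite h3 e0 mulr0 !scale0r subr0 addr0 in h.
Qed.

End InLocalSpace.

Lemma nil_subset W : {subset [::] <= W}. Proof. by move=> v. Qed.

Lemma local1 u W : local_space u W 1 -> exists2 b, W = <<[:: u; b]>>%VS & b ** b = 0.
Proof.
move=> lW; have [//|y [yW yn yX]] := local_extend lW (indep_nil u) (@nil_subset W).
exists y; last exact: (local_pow_eq0 lW yW yn).
apply: (indep_span (X := [:: y])) => //; last exact: local_dim lW.
- exact: (indep_rcons (X := [::]) (indep_nil u)).
- exact: local_u lW.
- by move=> v; rewrite inE => /eqP ->.
Qed.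

Lemma local2 u W : local_space u W 2 -> exists b c,
  [/\ W = <<[:: u; b; c]>>%VS, c ** c = 0, b ** c = 0 & b ** b = 0 \/ b ** b = c].
Proof.
move=> lW.
have [[z [zW zn z0]]|H] := classic (exists z, [/\ z \in W, nilpotent z & z ** z != 0]).
  exists z, (z ** z).
  have z2 := local_pow_eq0 lW zW zn; split; last by right.
  - exact: (local_pow_span lW (n := 1) (erefl _) zW zn z0).
  - by rewrite -[z ** z]/(pow z 1) pow_mul // (pow_vanish _ z2).
  - exact: z2.
have {}H z : z \in W -> nilpotent z -> z ** z = 0.
  by move=> zW zn; apply/eqP/negPn/negP => z0; apply: H; exists z.
have [//|b [bW bn bX]] := local_extend lW (indep_nil u) (@nil_subset W).
have i1 : indep u [:: b] := indep_rcons (X := [::]) (indep_nil u) bX.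
have [||c [cW cn cX]] := local_extend lW i1 => //.
  by move=> v; rewrite inE => /eqP ->.
have i2 : indep u [:: b; c] := indep_rcons i1 cX.
exists b, c; split; [| exact: H | | by left; apply: H].
  apply: (indep_span i2) => //; [exact: local_u lW | | exact: local_dim lW].
  by move=> v; rewrite !inE => /orP[] /eqP ->.
exact: (local_square_zero_pair lW H).
Qed.

(* Everything nilpotent has zero cube: the powers [z], [z ** z] of an element
   with nonzero square are completed by a [y] with [z ** y = 0]. *)
Lemma local3_cube_zero u W z : local_space u W 3 ->
  (forall v, v \in W -> nilpotent v -> pow v 2 = 0) ->
  z \in W -> nilpotent z -> z ** z != 0 ->
  exists n c, [/\ W = <<[:: u; z; z ** z; n]>>%VS, z ** n = 0,
    (z ** z) ** n = 0 & n ** n = c *: (z ** z)].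
Proof.
move=> lW H zW zn z10; set ε : k := (u != 0)%:R.
have uW := local_u lW; have mulW := local_mul lW.
have z2 := H z zW zn; pose z1 := z ** z.
have z1W : z1 \in W by apply: mulW.
have zz1 : z ** z1 = 0 by [].
have z1z : z1 ** z = 0 by rewrite (amulC jA).
have z1z1 : z1 ** z1 = 0 by rewrite -[z1]/(pow z 1) pow_mul // (pow_vanish _ z2).
have p3 v : v \in W -> nilpotent v -> pow v 3 = 0 by move=> vW vn;
  apply: (pow_vanish (m := 2)) => //; apply: H.
have zu : z ** u = ε *: z by rewrite (local_ur jA lW).
have z1u : z1 ** u = ε *: z1 by rewrite (local_ur jA lW).
have i2 : indep u [:: z; z1] by apply: (local_indep_pow two_neq0 jA lW (n := 1)).
have XW : {subset [:: z; z1] <= W} by move=> v; rewrite !inE => /orP[] /eqP ->.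
have span n : n \in W -> n \notin <<[:: u; z; z1]>>%VS ->
    indep u [:: z; z1; n] /\ W = <<[:: u; z; z1; n]>>%VS.
  move=> nW nX; have i3 : indep u [:: z; z1; n] := indep_rcons i2 nX; split=> //.
  apply: (indep_span i3) => //; last exact: local_dim lW.
  by move=> v; rewrite !inE => /or3P[] /eqP ->.
have [//|y [yW yn yX]] := local_extend lW i2 XW.
have [i3 WE] := span y yW yX.
have [a [b [c [d zyE]]]] : exists a b c d, z ** y = a *: u + b *: z + c *: z1 + d *: y.
  by apply: span4P; rewrite -WE mulW.
have d0 : d = 0.
  (* An eigenvector of the multiplication by z for the eigenvalue [d], cleared of denominators. Its
     coefficient at y is d^3, so it vanishes only if [d] does. *)
  pose v := d ^+ 2 *: (z ** y) + (d * a * ε) *: z + (d * b + a * ε) *: z1.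
  have [v0|v0] := eqVneq v 0.
    have := v0; rewrite /v zyE => h.
    have {}h : (d ^+ 2 * a) *: u + (d ^+ 2 * b + d * a * ε) *: z +
        (d ^+ 2 * c + (d * b + a * ε)) *: z1 + d ^+ 3 *: y = 0 by linear_from h.
    by have [_ _ /eqP] := indep3E i3 h; rewrite expf_eq0 => /eqP.
  apply: (nil_eigenvalue two_neq0 jA (p3 z zW zn) v0).
  by rewrite /v zyE !(amulE, zu, zz1, zyE) -[z ** z]/z1; module_ring.
rewrite d0 scale0r addr0 in zyE.
have aε : a * ε = 0.
  have := pow_rec two_neq0 jA z 0 y; rewrite z2 amul0l /= -[z ** z]/z1 zyE.
  rewrite !(amulE, zu, zz1, z1u, z1z, z1z1) -?[z ** z]/z1 => h.
  have {}h : (a * ε) *: z1 = 0 by linear_from (eq_scale (-1) h).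
  by move/eqP: h; rewrite scaler_eq0 (negPf z10) orbF => /eqP.
rewrite (local_epsK aε) add0r in zyE.
(* Subtracting c z removes the component along z^2, and subtracting l u makes the vector nilpotent.
   Then z is an eigenvector of n, and the nilpotency of n gives z n = 0. *)
have [n [nW nn nX [e zn_e]]] : exists n, [/\ n \in W, nilpotent n, n \notin <<[:: u; z;
  z1]>>%VS & exists e, z ** n = e *: z].
  have [l hl] : exists l, nilpotent (y - c *: z - l *: u).
    by case: lW => _ _ _ h _; apply: h; by rewrite !(memvB, memvZ).
  exists (y - c *: z - l *: u); split=> //; first by rewrite !(memvB, memvZ).
    apply: contra yX => h; rewrite -(subrK (c *: z) y) -(subrK (l *: u) (y - c *: z)).
    apply: memvD; first apply: memvD; rewrite ?h // memvZ // memv_span // ?inE ?eqxx ?orbT //.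
  by exists (b - l * ε); rewrite !amulE zyE zu -/z1; module_ring.
have {}zn_e : z ** n = 0.
  have z0 : z != 0 by apply: contraNneq z10 => ->; rewrite amul0l.
  suff -> : z ** n = 0 *: z by rewrite scale0r.
  rewrite zn_e; congr (_ *: _); apply: (nil_eigenvalue two_neq0 jA (p3 n nW nn) z0).
  by rewrite (amulC jA).
have {yW yn yX i3 WE zyE b aε} [i3 WE] := span n nW nX.
have z1n0 : z1 ** n = 0.
  have [x0 [x1 [x2 [x3 z1nE]]]] : exists a b c d, z1 ** n = a *: u + b *: z + c *: z1 + d *: n.
    by apply: span4P; rewrite -WE mulW.
  have h := pow_comm two_neq0 jA z 1 n; rewrite zn_e amul0r -[pow z 1]/z1 z1nE in h.
  rewrite !(amulE, zu, zz1, zn_e) -/z1 in h.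
  have {}h : 0 *: u + (x0 * ε) *: z + x1 *: z1 = 0 by linear_from (eq_scale (-1) h).
  have [e1 e2] := indep2E i2 h.
  rewrite (local_epsK e1) e2 scale0r !add0r in z1nE.
  have x30 : x3 = 0.
    have [w0|w0] := eqVneq (x3 *: n + x2 *: z1) 0.
      have {}w0 : 0 *: u + 0 *: z + x2 *: z1 + x3 *: n = 0 by linear_from w0.
      by have [] := indep3E i3 w0.
    apply: (nil_eigenvalue two_neq0 jA (x := z1) _ w0).
      by apply: (pow_vanish (m := 1)).
    by rewrite !amulE z1nE z1z1; module_ring.
  rewrite x30 scale0r addr0 in z1nE.
  rewrite z1nE; suff -> : x2 = 0 by rewrite scale0r.
  apply: (nil_eigenvalue two_neq0 jA (p3 n nW nn) z10).
  by rewrite (amulC jA).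
have nz : n ** z = 0 by rewrite (amulC jA).
have nz1 : n ** z1 = 0 by rewrite (amulC jA).
have [x0 [x1 [x2 [x3 nnE]]]] : exists a b c d, n ** n = a *: u + b *: z + c *: z1 + d *: n.
  by apply: span4P; rewrite -WE mulW.
have e0 : x0 * ε = 0.
  have h := jordan_lin2 two_neq0 jA z n n.
  rewrite zn_e -[z ** z]/z1 nz1 nnE !(amulE, z1u, z1z, z1z1, z1n0) in h.
  have {}h : (x0 * ε) *: z1 = 0 by linear_from (eq_scale (-1) h).
  by move/eqP: h; rewrite scaler_eq0 (negPf z10) orbF => /eqP.
rewrite (local_epsK e0) add0r in nnE.
have e3 : x3 *: (n ** n) = 0.
  have := H n nW nn; rewrite /= [X in n ** X]nnE !(amulE, nz, nz1) => h.
  by linear_from h.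
(* The fourth power of n, computed as (n n)(n n), is x1^2 z^2. *)
have e1 : x1 = 0.
  have := p3 n nW nn; rewrite -[3%N]/((1 + 1).+1) -pow_mul // -[pow n 1]/(n ** n) nnE.
  rewrite !(amulE, nz, nz1, zn_e, z1n0, zz1, z1z, z1z1) -[z ** z]/z1 e3 => h.
  have {}h : (x1 ^+ 2) *: z1 = 0 by linear_from h.
  by move/eqP: h; rewrite scaler_eq0 (negPf z10) orbF expf_eq0 => /eqP.
rewrite e1 scale0r add0r in nnE.
have e4 : x3 = 0.
  have h : 0 *: u + 0 *: z + (x3 * x2) *: z1 + (x3 * x3) *: n = 0.
    by rewrite nnE in e3; linear_from e3.
  by have [_ _ /eqP] := indep3E i3 h; rewrite mulf_eq0 orbb => /eqP.
rewrite e4 scale0r addr0 in nnE.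
by exists n, x2.
Qed.

(** Modulo the unit, the four alternatives are the zero algebra, B_3 + kn, T_3 and T_4. Nilpotency
    index 4 is T_3; index 3 leaves a quadratic form on the vectors orthogonal to a fixed one, and
    index 2 makes all products zero. *)
Lemma local3 u W : local_space u W 3 -> exists b c d,
  [/\ W = <<[:: u; b; c; d]>>%VS, [/\ c ** c = 0, c ** d = 0 & d ** d = 0] &
    [\/ [/\ b ** b = 0, b ** c = 0 & b ** d = 0],
        [/\ b ** b = c, b ** c = 0 & b ** d = 0],
        [/\ b ** b = c, b ** c = d & b ** d = 0] |
        [/\ b ** b = c, b ** c = 0 & b ** d = c]]].
Proof.
move=> lW; have uW := local_u lW; have mulW := local_mul lW.
have [[z [zW zn z0]]|H] := classic (exists z, [/\ z \in W, nilpotent z & pow z 2 != 0]).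
  exists z, (pow z 1), (pow z 2); have z3 := local_pow_eq0 lW zW zn; split.
  - exact: (local_pow_span lW (n := 2) (erefl _) zW zn z0).
  - by rewrite !pow_mul // !(pow_vanish _ z3).
  - by constructor 3; split=> //; apply: z3.
have {}H z : z \in W -> nilpotent z -> pow z 2 = 0.
  by move=> zW zn; apply/eqP/negPn/negP => z0; apply: H; exists z.
have [[z [zW zn z0]]|H'] := classic (exists z, [/\ z \in W, nilpotent z & z ** z != 0]).
  have [n [c [WE zn0 z1n nn]]] := local3_cube_zero lW H zW zn z0.
  have z2 : z ** (z ** z) = 0 := H z zW zn.
  have z3 : (z ** z) ** (z ** z) = 0.
    by rewrite -[z ** z]/(pow z 1) pow_mul // (pow_vanish _ (H z zW zn)).
  have [c0|c0] := eqVneq c 0.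
    exists z, (z ** z), n; split=> //; last by constructor 2.
    by split=> //; rewrite nn c0 scale0r.
  (* With this [s] the vector z + s n has square (1 + s^2 c) z^2 = 0, and its product with z is
     still z^2. *)
  have [s sE] := sqrt_exists (- c^-1).
  have s0 : s != 0.
    by apply: contraNneq c0 => s0; move/eqP: sE; rewrite s0 expr0n eq_sym oppr_eq0 invr_eq0.
  exists z, (z ** z), (z + s *: n); split.
  - rewrite WE; apply/eqP; rewrite eqEsubv; apply/andP; split; apply/span_subvP => v;
      rewrite !inE => /or4P[] /eqP ->; try by rewrite memv_span // ?inE ?eqxx ?orbT.
      rewrite [X in X \in _](_ : n = s^-1 *: (z + s *: n) - s^-1 *: z); last first.
        by rewrite scalerDr scalerA mulVf // scale1r addrAC subrr add0r.
      by rewrite memvB // memvZ // memv_span // ?inE ?eqxx ?orbT.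
    by rewrite memvD // ?memvZ // memv_span // ?inE ?eqxx ?orbT.
  - split=> //.
      by rewrite amulDr amulZr (amulC jA _ z) z2 z1n scaler0 addr0.
    rewrite !amulE nn (amulC jA n) zn0 scaler0 addr0 add0r !scalerA.
    rewrite -[X in X + _]scale1r -scalerDl -expr2 sE mulNr mulVf // subrr.
    by rewrite scale0r.
  - constructor 4; split=> //.
    by rewrite amulDr amulZr zn0 scaler0 addr0.
have {}H' z : z \in W -> nilpotent z -> z ** z = 0.
  by move=> zW zn; apply/eqP/negPn/negP => z0; apply: H'; exists z.
have [//|b [bW bn bX]] := local_extend lW (indep_nil u) (@nil_subset W).
have i1 : indep u [:: b] := indep_rcons (X := [::]) (indep_nil u) bX.
have [||c [cW cn cX]] := local_extend lW i1 => //.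
  by move=> v; rewrite inE => /eqP ->.
have i2 : indep u [:: b; c] := indep_rcons i1 cX.
have [||d [dW dn dX]] := local_extend lW i2 => //.
  by move=> v; rewrite !inE => /orP[] /eqP ->.
have i3 : indep u [:: b; c; d] := indep_rcons i2 dX.
have WE : W = <<[:: u; b; c; d]>>%VS.
  apply: (indep_span i3) => //; last exact: local_dim lW.
  by move=> v; rewrite !inE => /or3P[] /eqP ->.
have perm_i s : perm_eq s [:: b; c; d] -> indep u s.
  move=> ps; move: i3; rewrite /indep /cons_neq0; case: eqVneq => _ f.
    by rewrite (perm_free ps).
  by rewrite (perm_free (Y := [:: u; b; c; d])) // perm_cons.
have pair x y w : perm_eq [:: x; y; w] [:: b; c; d] -> indep u [:: x; y].
  move=> /perm_i; rewrite /indep /cons_neq0; case: eqVneq => _ f.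
    exact: (@catl_free _ _ [:: w] [:: x; y]).
  exact: (@catl_free _ _ [:: w] [:: u; x; y]).
have bd : indep u [:: b; d] by apply: (pair b d c); rewrite perm_cons (perm_catC [:: d] [:: c]).
have cd : indep u [:: c; d].
  by apply: (pair c d b); rewrite (perm_catC [:: c; d] [:: b]).
have z := local_square_zero_pair lW H'.
by exists b, c, d; split=> //; [split; [exact: H' | exact: z | exact: H'] | constructor 1;
  split; [exact: H' | exact: z | exact: z]].
Qed.

End LocalClassification.

(** * Nil algebras of dimension four *)

Section FourVectors.
Variables (k : fieldType) (V : vectType k).

Lemma free4E (b0 b1 b2 b3 : V) a b c d : free [:: b0; b1; b2; b3] ->
  a *: b0 + b *: b1 + c *: b2 + d *: b3 = 0 -> [/\ a = 0, b = 0, c = 0 & d = 0].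
Proof. by move=> f h; have [] := comb_eq0 (v := (a, b, c, d)) f h. Qed.

Lemma free4_span (b0 b1 b2 b3 v : V) : \dim {: V} = 4%N -> free [:: b0; b1; b2; b3] ->
  exists a b c d, v = a *: b0 + b *: b1 + c *: b2 + d *: b3.
Proof.
move=> d4 f; have [[[[a b] c] d] ->] := comb_surj (basis_of_free d4 f) v.
by exists a, b, c, d.
Qed.

Lemma free4_of (b0 b1 b2 b3 : V) : (forall a b c d,
    a *: b0 + b *: b1 + c *: b2 + d *: b3 = 0 -> [/\ a = 0, b = 0, c = 0 & d = 0]) ->
  free [:: b0; b1; b2; b3].
Proof.
move=> h; apply: free_of_comb => [[[[a b] c] d]] hv.
by have [-> -> -> ->] := h a b c d hv.
Qed.

Lemma indep0 (X : seq V) : indep 0 X = free X.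
Proof. by rewrite /indep /cons_neq0 eqxx. Qed.

End FourVectors.

Section NilAlgebras.
Variables (k : closedFieldType) (A : algebra k).
Hypothesis two_neq0 : (2 : k) != 0.
Hypothesis jA : jordan A.
Hypothesis dimA : adim A = 4%N.
Hypothesis nilA : forall x : A, nilpotent x.
Local Notation "x ** y" := (@amul k A x y) (at level 40, left associativity).
Implicit Types (x y z v w : A).

Lemma nil_local_space : local_space (0 : A) fullv 4.
Proof.
split=> [|v w _ _|v _|v _|]; rewrite ?memvf ?amul0l ?eqxx ?scale0r ?addn0 //.
by exists 0; rewrite scale0r subr0; apply: nilA.
Qed.

Lemma nil_extend (X : seq A) : free X -> (size X < 4)%N ->
  exists2 y, y \notin <<X>>%VS & free (rcons X y).
Proof.
move=> fX sX; have iX : indep 0 X by rewrite indep0.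
have [|//|y [_ _ yX]] := local_extend nil_local_space iX; first by move=> v _; rewrite memvf.
by exists y; [rewrite -span_cons_neq0 /cons_neq0 eqxx in yX | rewrite -indep0 indep_rcons].
Qed.

Lemma nil_index_4 z : pow z 3 != 0 -> listed A.
Proof.
move=> z3; have z4 : pow z 4 = 0 by apply: (local_pow_eq0 two_neq0 jA nil_local_space (memvf z)).
have f : free [:: pow z 0; pow z 1; pow z 2; pow z 3].
  by rewrite -indep0; apply: (local_indep_pow two_neq0 jA nil_local_space (memvf z) z4).
apply: listed_nil_4; exists (pow z 0), (pow z 1), (pow z 2), (pow z 3).
have P i j : pow z i ** pow z j = if (i + j < 3)%N then pow z (i + j).+1 else 0.
  by rewrite pow_mul //; case: ltnP => // h; apply: (pow_vanish _ z4).
split; [exact: basis_of_free | split | split | split | exact: amulC];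
  by rewrite P; comb_norm.
Qed.

(** A vector outside the span of the powers of x is corrected until x annihilates it. The
    coefficients that would obstruct this are eigenvalues of nilpotent elements, and the products
    left open are the three parameters of [listed_nil_3]. *)
Lemma nil_index_3 x : (forall z, pow z 3 = 0) -> pow x 2 != 0 -> listed A.
Proof.
move=> H x20; pose x1 := x ** x; pose x2 := x ** x1.
have x2n : x2 != 0 by [].
have xx2 : x ** x2 = 0 := H x.
have x2x : x2 ** x = 0 by rewrite (amulC jA).
have x1x : x1 ** x = x2 by rewrite (amulC jA).
have x1x1 : x1 ** x1 = 0 by rewrite -[x1]/(pow x 1) pow_mul // H.
have x1x2 : x1 ** x2 = 0.
  by rewrite -[x1]/(pow x 1) -[x2]/(pow x 2) pow_mul // (pow_vanish _ (H x)).
have x2x1 : x2 ** x1 = 0 by rewrite (amulC jA).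
have x2x2 : x2 ** x2 = 0.
  by rewrite -[x2]/(pow x 2) pow_mul // (pow_vanish _ (H x)).
have f3 : free [:: x; x1; x2].
  by rewrite -indep0; apply: (local_indep_pow two_neq0 jA nil_local_space (memvf x) (n := 2) (H
    x)).
have [//|y yX f4] := nil_extend f3.
have [a [b [c [d xyE]]]] := free4_span (x ** y) dimA f4.
have d0 : d = 0.
  (* As in dimension three, a multiple of the eigenvector of x for the eigenvalue [d], with
     coefficient d^3 at y. *)
  pose v := d ^+ 3 *: y + (d ^+ 2 * a) *: x + (d ^+ 2 * b + d * a) *: x1 +
    (d ^+ 2 * c + d * b + a) *: x2.
  have [v0|v0] := eqVneq v 0.
    have {}v0 : (d ^+ 2 * a) *: x + (d ^+ 2 * b + d * a) *: x1 +
      (d ^+ 2 * c + d * b + a) *: x2 + d ^+ 3 *: y = 0 by linear_from v0.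
    by have [_ _ _ /eqP] := free4E f4 v0; rewrite expf_eq0 => /eqP.
  apply: (nil_eigenvalue two_neq0 jA (H x) v0).
  by rewrite /v !(amulE, xyE, xx2) -/x1 -/x2; module_ring.
rewrite d0 scale0r addr0 in xyE.
have a0 : a = 0.
  apply: (nil_eigenvalue two_neq0 jA (H y) x2n); rewrite (amulC jA).
  have h := pow_rec two_neq0 jA x 0 y.
  rewrite -[pow x 2]/x2 -[pow x 1]/x1 -[pow x 0]/x xyE in h.
  rewrite !(amulE, x1x, x1x1, x1x2, xx2) -/x1 -/x2 in h.
  by linear_from h.
rewrite a0 scale0r add0r in xyE.
have [n xn nX] : exists2 n, x ** n = 0 & n \notin <<[:: x; x1; x2]>>%VS.
  exists (y - b *: x - c *: x1).
    by rewrite !amulE xyE -/x1 -/x2; module_ring.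
  apply: contra yX => h; rewrite -(subrK (b *: x) y) -(subrK (c *: x1) (y - b *: x)).
  apply: memvD; first apply: memvD; rewrite ?h // memvZ // memv_span // ?inE ?eqxx ?orbT //.
have {f4 yX xyE a b c d d0 a0 y} f4 : free [:: x; x1; x2; n].
  by rewrite -indep0; apply: (indep_rcons (X := [:: x; x1; x2]));
    rewrite ?indep0 // -span_cons_neq0 /cons_neq0 eqxx.
have [a [b [c [d x1nE]]]] := free4_span (x1 ** n) dimA f4.
have h := pow_comm two_neq0 jA x 1 n; rewrite xn amul0r -[pow x 1]/x1 x1nE in h.
rewrite !(amulE, xn, xx2) -/x1 -/x2 in h.
have {}h : 0 *: x + a *: x1 + b *: x2 + 0 *: n = 0 by linear_from (eq_scale (-1) h).
have [_ a0 b0 _] := free4E f4 h; rewrite a0 b0 !scale0r !add0r in x1nE.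
have d0 : d = 0.
  have [w0|w0] := eqVneq (c *: x2 + d *: n) 0.
    have {}w0 : 0 *: x + 0 *: x1 + c *: x2 + d *: n = 0 by linear_from w0.
    by have [] := free4E f4 w0.
  by apply: (nil_eigenvalue two_neq0 jA (H x1) w0); rewrite amulDr !amulZr x1x2 x1nE; module_ring.
rewrite d0 scale0r addr0 in x1nE.
have x2n0 : x2 ** n = 0.
  have h' := pow_rec two_neq0 jA x 0 n.
  by rewrite -[pow x 2]/x2 -[pow x 0]/x xn !amul0r !subr0 scaler0 addr0 in h'.
have nx : n ** x = 0 by rewrite (amulC jA).
have nx1 : n ** x1 = c *: x2 by rewrite (amulC jA).
have nx2 : n ** x2 = 0 by rewrite (amulC jA).
have [a' [b' [d' [g nnE]]]] := free4_span (n ** n) dimA f4.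
have g0 : g = 0.
  have := H n; rewrite /pow /= nnE !(amulE, nx, nx1, nx2) nnE !(amulE, nx, nx1, nx2) nnE => h'.
  have {}h' : (g ^+ 2 * a') *: x + (g ^+ 2 * b') *: x1 +
      (g * b' * c + g ^+ 2 * d') *: x2 + g ^+ 3 *: n = 0 by linear_from h'.
  by have [_ _ _ /eqP] := free4E f4 h'; rewrite expf_eq0 => /eqP.
rewrite g0 scale0r addr0 in nnE.
have a'0 : a' = 0.
  have h' := jordan_lin2 two_neq0 jA x n n.
  rewrite xn -/x1 nx1 nnE !(amulE, nx2, x1x, x1x1, x1x2) in h'.
  have {}h' : a' *: x2 = 0 by linear_from (eq_scale (-1) h').
  by move/eqP: h'; rewrite scaler_eq0 (negPf x2n) orbF => /eqP.
rewrite a'0 scale0r add0r in nnE.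
apply: (@listed_nil_3 k A two_neq0 b' c d'); exists x, x1, x2, n.
by split; [exact: basis_of_free | split | split | split | exact: amulC]; comb_norm.
Qed.

(** The odd part of (x + y)^3 = 0 in y is 2 x(xy) + y x^2 = 0, and it makes the cube of
    multiplication by x zero. If s = x(xy) were nonzero, then x, y, xy, s would be a basis and x^2 =
    d s, so that y would have the eigenvalue -2/d on s. Hence x(xy) = 0 and y x^2 = 0, and
    polarization finishes. *)
Lemma nil_cube_zero : (forall z, pow z 2 = 0) -> forall x y z, x ** (y ** z) = 0.
Proof.
move=> H; have H3 z : pow z 3 = 0 by apply: (pow_vanish (m := 2)).
have C x y : 2 *: (x ** (x ** y)) + y ** (x ** x) = 0.
  have h1 := H (x + y); have h2 := H (x - y).
  have hx := H x; have hy := H y.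
  rewrite /pow /= in h1 h2 hx hy.
  rewrite !amulE !(amulC jA y x) hx hy in h1 h2.
  by apply: (scale_neq0_eq0 two_neq0); linear_from (eq_add h1 (eq_scale (-1) h2)).
have L3 x y : x ** (x ** (x ** y)) = 0.
  have h1 := pow_rec two_neq0 jA x 0 y; have h2 := C x (x ** y).
  rewrite H amul0l -[pow x 0]/x -[pow x 1]/(x ** x) (amulC jA (x ** x)) in h1.
  have h8 : (2 * (2 * 2)) *: (x ** (x ** (x ** y))) = 0.
    by linear_from (eq_add h1 (eq_scale 3 h2)).
  by apply: (scale_neq0_eq0 _ h8); rewrite !mulf_neq0.
have T x y : x ** (x ** y) = 0.
  pose t := x ** y; pose s := x ** t; apply/eqP/negPn/negP => s0.
  have xs : x ** s = 0 := L3 x y; have xx1 : x ** (x ** x) = 0 := H x.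
  have x0 : x != 0 by apply: contraNneq s0 => ->; rewrite amul0l.
  have s0E a : a *: s = 0 -> a = 0.
    by move/eqP; rewrite scaler_eq0 (negPf s0) orbF => /eqP.
  have f4 : free [:: x; y; t; s].
    apply: free4_of => a b c d h.
    have h1 := congr1 (@amul k A x) h; rewrite !(amulE, xs) -/t -/s in h1.
    have h2 := congr1 (@amul k A x) h1; rewrite !(amulE, xs, xx1) -/t -/s in h2.
    have b0 : b = 0 by apply: s0E; linear_from h2.
    (* If [a] is nonzero, the relation says that -(c/a) y - (d/a) t maps x to itself, an eigenvalue
       1 of a nilpotent element. *)
    have a0 : a = 0.
      apply/eqP/negPn/negP => a0; move/negP: (oner_neq0 k); apply; apply/eqP.
      apply: (nil_eigenvalue two_neq0 jA (H3 (- (c / a) *: y - (d / a) *: t)) x0).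
      rewrite amulC // !amulE -/t -/s scale1r.
      by apply: (eq_of_eq (eq_scale (- a^-1) h)); rewrite b0; module_field.
    rewrite a0 b0 in h h1.
    have c0 : c = 0 by apply: s0E; linear_from h1.
    by split=> //; apply: s0E; rewrite c0 in h; linear_from h.
  have [a [b [c [d x1E]]]] := free4_span (x ** x) dimA f4.
  have h1 := xx1; rewrite x1E !(amulE, xs) -/t -/s in h1.
  have h2 := congr1 (@amul k A x) h1; rewrite !(amulE, xs, xx1) -/t -/s in h2.
  have b0 : b = 0 by apply: s0E; linear_from h2.
  rewrite b0 in x1E h1; rewrite x1E in h1.
  have {}h1 : (a * a) *: x + 0 *: y + (a * c) *: t + (a * d + c) *: s = 0 by linear_from h1.
  have [/eqP a0 _ _ c0] := free4E f4 h1; move: a0; rewrite mulf_eq0 orbb => /eqP a0.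
  rewrite a0 mul0r add0r in c0; rewrite a0 c0 !scale0r !add0r in x1E.
  have h := C x y; rewrite x1E amulZr -/t -/s in h.
  have d0 : d != 0.
    apply/eqP => d0; rewrite d0 scale0r addr0 in h.
    by move/eqP: (s0E _ h); exact/negP.
  have : - (2 / d) = 0.
    apply: (nil_eigenvalue two_neq0 jA (H3 y) s0).
    by rewrite -/t -/s; apply: (eq_of_eq (eq_scale d^-1 h)); module_field.
  move/eqP; rewrite oppr_eq0 mulf_eq0 invr_eq0 (negPf d0) orbF; exact/negP.
have S x y : y ** (x ** x) = 0 by have h := C x y; rewrite T scaler0 add0r in h.
move=> x y z; apply: (scale_neq0_eq0 two_neq0).
have h := S (y + z) x; rewrite !amulE (amulC jA z y) !S in h; linear_from h.
Qed.

Lemma nil_listed : listed A.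
Proof.
have [[z z3]|H3] := classic (exists z, pow z 3 != 0); first exact: nil_index_4 z3.
have {}H3 z : pow z 3 = 0 by apply/eqP/negPn/negP => z0; apply: H3; exists z.
have [[z z2]|H2] := classic (exists z, pow z 2 != 0); first exact: nil_index_3 z2.
have {}H2 z : pow z 2 = 0 by apply/eqP/negPn/negP => z0; apply: H2; exists z.
have T := nil_cube_zero H2.
have T' x y z : (x ** y) ** z = 0 by rewrite (amulC jA).
have polar x y : 2 *: (x ** y) = (x + y) ** (x + y) - x ** x - y ** y.
  by rewrite !amulE (amulC jA y x); module_ring.
have [[x x1]|H1] := classic (exists x, x ** x != 0); last first.
  have M x y : x ** y = 0.
    have {}H1 z : z ** z = 0 by apply/eqP/negPn/negP => z0; apply: H1; exists z.
    by apply: (scale_neq0_eq0 two_neq0); rewrite polar !H1 !subr0.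
  have := vbasisP {: A}; have := size_tuple (vbasis {: A}).
  rewrite [X in _ = X]dimA; case: (tval _) => [|b0 [|b1 [|b2 [|b3 [|]]]]] // _ bB.
  apply: listed_nil_zero; exists b0, b1, b2, b3.
  by split; [| split | split | split | exact: amulC]; comb_norm; rewrite ?scale0r ?addr0.
pose z0 := x ** x; have sE a : a *: z0 = 0 -> a = 0.
  by move/eqP; rewrite scaler_eq0 (negPf x1) orbF => /eqP.
have [[y yy]|H1] := classic (exists y, y ** y \notin <[z0]>%VS).
  (* If [b] is nonzero, the first relation makes x y a multiple of x^2 and the second then does the
     same for y^2, contrary to the choice of y. *)
  have K a b : a *: z0 + b *: (x ** y) = 0 -> a *: (x ** y) + b *: (y ** y) = 0 ->
      a = 0 /\ b = 0.
    move=> h1 h2; have b0 : b = 0.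
      apply/eqP/negPn/negP => b0; move/negP: yy; apply; apply/vlineP.
      exists ((a / b) ^+ 2).
      apply: (eq_of_eq (eq_add (eq_scale (- (a / b ^+ 2)) h1) (eq_scale b^-1 h2))).
      by module_field.
    by split=> //; apply: sE; rewrite b0 in h1; linear_from h1.
  have f4 : free [:: x; y; z0; y ** y].
    apply: free4_of => a b c d h.
    have h1 := congr1 (@amul k A x) h; rewrite !(amulE, T) -/z0 in h1.
    have h2 := congr1 (@amul k A y) h; rewrite !(amulE, T) (amulC jA y x) in h2.
    have [a0 b0] : a = 0 /\ b = 0 by apply: K; [linear_from h1 | linear_from h2].
    rewrite a0 b0 in h; have d0 : d = 0.
      apply/eqP/negPn/negP => d0; move/negP: yy; apply; apply/vlineP; exists (- (c / d)).
      by apply: (eq_of_eq (eq_scale d^-1 h)); module_field.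
    by split=> //; apply: sE; rewrite d0 in h; linear_from h.
  have [a [b [c [d xyE]]]] := free4_span (x ** y) dimA f4.
  have h1 := T x x y; rewrite xyE !(amulE, T) -/z0 in h1.
  have h2 := T y x y; rewrite xyE !(amulE, T) (amulC jA y x) in h2.
  have [a0 b0] : a = 0 /\ b = 0 by apply: K; [linear_from h1 | linear_from h2].
  rewrite a0 b0 !scale0r !add0r in xyE.
  apply: (@listed_nil_22 k A two_neq0 c d); exists x, y, z0, (y ** y).
  by split; [exact: basis_of_free | split | split | split | exact: amulC]; comb_norm;
    rewrite ?T ?T' ?scale0r ?addr0.
have {}H1 y : exists a, y ** y = a *: z0.
  by apply/vlineP/negPn/negP => h; apply: H1; exists y.
have M v w : exists a, v ** w = a *: z0.
  have [a ha] := H1 (v + w); have [b hb] := H1 v; have [c hc] := H1 w.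
  have h := polar v w; rewrite ha hb hc in h; exists (2^-1 * (a - b - c)).
  by apply: (eq_of_eq (eq_scale 2^-1 h)); module_field.
have f2 : free [:: x; z0].
  rewrite -indep0; apply: (local_indep_pow two_neq0 jA nil_local_space (memvf x) (n := 1) (H2
    x) x1).
have step X : free X -> (size X < 4)%N -> x \in X -> exists b, x ** b = 0 /\ free (rcons X b).
  move=> fX sX xX; have [b bX fXb] := nil_extend fX sX; have [a ab] := M x b.
  exists (b - a *: x); split; first by rewrite amulBr ab amulZr subrr.
  rewrite -indep0; apply: indep_rcons; rewrite ?indep0 // -span_cons_neq0 /cons_neq0 eqxx.
  by apply: contra bX => h; rewrite -(subrK (a *: x) b) memvD // memvZ // memv_span.
have [b [xb f3]] := step _ f2 isT (mem_head _ _).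
have [c [xc f4]] := step _ f3 isT (mem_head _ _).
have [a1 h1] := M b b; have [a2 h2] := M b c; have [a3 h3] := M c c.
apply: (@listed_nil_31 k A two_neq0 a1 a2 a3); exists x, z0, b, c.
by split; [exact: basis_of_free | split | split | split | exact: amulC]; comb_norm;
    rewrite ?T ?T' ?scale0r ?addr0.
Qed.

End NilAlgebras.

(** * Joint Peirce bases *)

Section PeirceBases.
Variables (k : closedFieldType) (A : algebra k).
Hypothesis two_neq0 : (2 : k) != 0.
Hypothesis jA : jordan A.
Local Notation "x ** y" := (@amul k A x y) (at level 40, left associativity).
Implicit Types (x y z v e f : A).

(* The Peirce eigenvalues 0, 1/2 and 1 are encoded by 0, 1 and 2. *)
Definition wt (n : nat) : k := n%:R / 2.

Lemma wt0 : wt 0 = 0. Proof. by rewrite /wt mul0r. Qed.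
Lemma wt1 : wt 1 = 2^-1. Proof. by rewrite /wt mul1r. Qed.
Lemma wt2 : wt 2 = 1. Proof. by rewrite /wt divff. Qed.

Lemma wtD n m : wt (n + m) = wt n + wt m.
Proof. by rewrite /wt natrD mulrDl. Qed.

Lemma wt_inj n m : (n < 3)%N -> (m < 3)%N -> wt n = wt m -> n = m.
Proof.
have i0 : (2^-1 : k) != 0 by rewrite invr_eq0.
have i1 : (2^-1 : k) != 1 by rewrite invr_eq1; apply: contraNneq (oner_neq0 k) => h;
  rewrite -[X in X == _](addrK 1) -[1 + 1]/(2%:R) h subrr.
have o1 := oner_neq0 k.
case: n m => [|[|[|n]]] [|[|[|m]]] // _ _; rewrite ?wt0 ?wt1 ?wt2 => h; exfalso.
- by rewrite -h eqxx in i0.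
- by rewrite -h eqxx in o1.
- by rewrite h eqxx in i0.
- by rewrite h eqxx in i1.
- by rewrite h eqxx in o1.
- by rewrite -h eqxx in i1.
Qed.

Definition eig e (n : nat) v : Prop := e ** v = wt n *: v.

Lemma eig0E e v : eig e 0 v <-> e ** v = 0.
Proof. by rewrite /eig wt0 scale0r. Qed.
Lemma eig1E e v : eig e 1 v <-> e ** v = 2^-1 *: v.
Proof. by rewrite /eig wt1. Qed.
Lemma eig2E e v : eig e 2 v <-> e ** v = v.
Proof. by rewrite /eig wt2 scale1r. Qed.

Definition eigv e (n : nat) : {vspace A} :=
  lker (linfun (@amul k A e) - wt n *: \1)%VF.

Lemma mem_eigvP e n v : reflect (eig e n v) (v \in eigv e n).
Proof.
rewrite memv_ker add_lfunE opp_lfunE scale_lfunE id_lfunE lfunE /= subr_eq0.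
exact: eqP.
Qed.

Definition weighted e (w : seq nat) (X : seq A) : Prop :=
  [/\ e ** e = e, size w = size X &
      forall i, (i < size X)%N -> (nth 0 w i < 3)%N /\ eig e (nth 0%N w i) X`_i].

Lemma weighted_coef e (w : seq nat) (X : seq A) (c : seq k) (n i : nat) : free X -> weighted e
  w X ->
  (n < 3)%N -> eig e n (\sum_(i < size X) c`_i *: X`_i) -> (i < size X)%N ->
  c`_i != 0 -> nth 0%N w i = n.
Proof.
move=> fX [_ _ wX] n3 h iX ci; have [wi3 _] := wX i iX.
apply: wt_inj => //; apply/eqP; rewrite -subr_eq0.
have E : \sum_(i < size X) [seq (wt (nth 0%N w j) - wt n) * c`_j | j <- iota 0 (size X)]`_i *:
  X`_i = 0.
  move/eqP: h; rewrite /eig -subr_eq0 linear_sumr scaler_sumr -sumrB /= => /eqP h.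
  rewrite -[RHS]h; apply: eq_bigr => j _.
  rewrite (nth_map 0%N) ?size_iota // nth_iota // add0n linearZr_LR /=.
  by rewrite (wX j (ltn_ord j)).2 !scalerA -scalerBl mulrBl (mulrC c`_j).
have := free_coef fX E iX; rewrite (nth_map 0%N) ?size_iota // nth_iota // add0n.
by move=> /eqP; rewrite mulf_eq0 (negPf ci) orbF.
Qed.

(** The Peirce multiplication rules: weight [c] may occur in a product of weights [a] and [b]. For
    weights 0 and 2 the two conditions contradict each other, which expresses that such products
    vanish. *)
Definition compat (a b c : nat) : bool :=
  if (a == 1%N) && (b == 1%N) then c != 1%N
  else ((a != 1%N) ==> (c == b)) && ((b != 1%N) ==> (c == a)).

Lemma eig_mul e x y a b : e ** e = e -> (a < 3)%N -> a != 1%N ->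
  eig e a x -> eig e b y -> eig e b (x ** y).
Proof.
move=> ee; case: a => [|[|[|]]] // _ _ hx hy.
  by apply: peirce_0 => //; apply/eig0E.
by apply: peirce_1 => //; apply/eig2E.
Qed.

Lemma compat_coef e (w : seq nat) (X : seq A) (c : seq k) x y (a b i : nat) : free X ->
  weighted e w X ->
  (a < 3)%N -> (b < 3)%N -> eig e a x -> eig e b y ->
  x ** y = \sum_(i < size X) c`_i *: X`_i -> (i < size X)%N -> c`_i != 0 ->
  compat a b (nth 0%N w i).
Proof.
move=> fX wX a3 b3 hx hy hxy iX ci; have [ee _ wX'] := wX.
rewrite /compat; case: andP => [[/eqP a1 /eqP b1]|_].
  subst a b; have := peirce_half two_neq0 jA ee (proj1 (eig1E _ _) hx) (proj1 (eig1E _ _) hy).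
  rewrite hxy => h; apply/eqP => wi1.
  have E : \sum_(i < size X) [seq (wt (nth 0%N w j) * wt (nth 0%N w j) - wt (nth 0%N w j)) *
    c`_j | j <- iota 0 (size X)]`_i *: X`_i = 0.
    move/eqP: h; rewrite -subr_eq0 !linear_sumr -sumrB /= => /eqP h.
    rewrite -[RHS]h; apply: eq_bigr => j _.
    rewrite (nth_map 0%N) ?size_iota // nth_iota // add0n.
    rewrite !linearZr_LR /= (wX' j (ltn_ord j)).2 linearZr_LR /= (wX' j (ltn_ord j)).2.
    by rewrite !scalerA -scalerBl; congr (_ *: _); ring.
  have := free_coef fX E iX; rewrite (nth_map 0%N) ?size_iota // nth_iota // add0n.
  move=> /eqP; rewrite mulf_eq0 (negPf ci) orbF wi1 wt1 -[X in _ - X]mulr1 -mulrBr.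
  rewrite mulf_eq0 invr_eq0 (negPf two_neq0) /= subr_eq0 -wt1 -wt2.
  by move/eqP/wt_inj => /(_ isT isT).
apply/andP; split; apply/implyP => n1; apply/eqP.
  by apply: (weighted_coef fX wX _ _ iX ci); rewrite // -hxy; apply: eig_mul n1 hx hy.
apply: (weighted_coef fX wX _ _ iX ci); rewrite // -hxy (amulC jA).
exact: eig_mul n1 hy hx.
Qed.

(** A coefficient forbidden by the weights of some idempotent becomes a literal 0, so that products
    reduce to the parametrized tables already treated. *)
Definition wmask (ws : seq (seq nat)) (i j : nat) (q : quad k) : quad k :=
  let ok l := all (fun w => compat (nth 0 w i) (nth 0 w j) (nth 0 w l))%N ws in
  (if ok 0%N then q0 q else 0, if ok 1%N then q1 q else 0,
   if ok 2%N then q2 q else 0, if ok 3%N then q3 q else 0).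

Lemma masked (b0 b1 b2 b3 : A) (ps : seq (A * seq nat)) :
  let X := [:: b0; b1; b2; b3] in
  basis_of fullv X -> {in ps, forall p, weighted p.1 p.2 X} ->
  forall i j, (i < 4)%N -> (j < 4)%N ->
  exists q, X`_i ** X`_j = comb b0 b1 b2 b3 (wmask [seq p.2 | p <- ps] i j q).
Proof.
move=> X bX wX i j i4 j4; have fX := basis_free bX.
have [q qE] := comb_surj bX (X`_i ** X`_j); exists q; rewrite qE.
pose c := [:: q0 q; q1 q; q2 q; q3 q].
have H l : (l < 4)%N -> c`_l =
    if all (fun w => compat (nth 0 w i) (nth 0 w j) (nth 0 w l))%N [seq p.2 | p <- ps]
    then c`_l else 0.
  move=> l4; case: ifP => // /negbT /allPn [w /mapP [p pps ->] nc].
  apply/eqP/negPn/negP => cl; move/negP: nc; apply.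
  have wp := wX p pps; have [_ _ wp'] := wp.
  have [i3 hi] := wp' i i4; have [j3 hj] := wp' j j4.
  by apply: (compat_coef (c := c) fX wp i3 j3 hi hj _ l4 cl); rewrite qE comb_big.
congr comb; apply: quad_eq; [exact: (H 0%N) | exact: (H 1%N) | exact: (H 2%N) | exact: (H 3%N)].
Qed.

Lemma eigv_span e (w : seq nat) (X : seq A) (n : nat) : basis_of fullv X -> weighted e w X ->
  (n < 3)%N ->
  let Y := [seq X`_i | i <- iota 0 (size X) & nth 0%N w i == n] in
  eigv e n = <<Y>>%VS /\ \dim (eigv e n) = size Y.
Proof.
move=> bX wX n3 Y; have fX := basis_free bX; have [_ _ wX'] := wX.
have E : eigv e n = <<Y>>%VS.
  apply/eqP; rewrite eqEsubv; apply/andP; split; last first.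
    apply/span_subvP => v /mapP [i]; rewrite mem_filter mem_iota => /andP [/eqP wi iX] ->.
    by apply/mem_eigvP; rewrite -wi; case: (wX' i iX).
  apply/subvP => v /mem_eigvP hv.
  have vX : v \in <<in_tuple X>>%VS by rewrite (span_basis bX) memvf.
  pose c := [seq coord (in_tuple X) i v | i <- enum 'I_(size X)].
  have cE (i : 'I_(size X)) : c`_i = coord (in_tuple X) i v.
    by rewrite (nth_map i) ?size_enum_ord // nth_ord_enum.
  have vE : v = \sum_(i < size X) c`_i *: X`_i.
    by rewrite [LHS](coord_span vX); apply: eq_bigr => i _; rewrite cE.
  rewrite vE; apply: memv_suml => i _; have [->|ci] := eqVneq c`_i 0.
    by rewrite scale0r mem0v.
  apply: memvZ; apply: memv_span; apply: map_f.
  rewrite mem_filter mem_iota ltn_ord !andbT; apply/eqP.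
  by rewrite vE in hv; apply: weighted_coef fX wX n3 hv (ltn_ord i) ci.
split=> //; rewrite E; suff : free Y by move/eqP.
have sub : subseq Y X.
  by rewrite -[X in subseq _ X](mkseq_nth 0); apply: map_subseq; exact: filter_subseq.
by have /(subseq_uniqP (free_uniq fX)) -> := sub; apply: filter_free.
Qed.

Definition orthogonal_idempotents (es : seq A) : Prop :=
  [/\ uniq es, {in es, forall e, e ** e = e /\ e != 0} &
      {in es &, forall e f, e != f -> e ** f = 0}].

Lemma orthogonal_free es : orthogonal_idempotents es -> free es.
Proof.
move=> [u idem orth]; apply: free_of_coef => c h i ies.
have [ee e0] := idem _ (mem_nth 0 ies).
have := congr1 (@amul k A es`_i) h; rewrite amul0r linear_sumr.
rewrite (bigD1 (Ordinal ies)) //= linearZr_LR /= ee big1 ?addr0.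
  by move/eqP; rewrite scaler_eq0 (negPf e0) orbF => /eqP.
move=> j ji; rewrite linearZr_LR /= orth ?scaler0 ?mem_nth // nth_uniq //.
by rewrite eq_sym -(inj_eq val_inj) in ji.
Qed.

(** An idempotent e orthogonal to f lies in the 0-space of f, so multiplication by e preserves the
    eigenspaces of f, and so do the Peirce projections of e. Of the three components of a vector
    outside [U], at least one lies outside [U]. *)
Lemma joint_eigenvector (es : seq A) (U : {vspace A}) v :
  {in es, forall e, e ** e = e} -> {in es &, forall e f, e != f -> e ** f = 0} ->
  v \notin U ->
  exists2 p, p \notin U & {in es, forall e, exists2 n, (n < 3)%N & eig e n p}.
Proof.
elim: es v => [|e es IH] v idem orth vU; first by exists v.
have [||p pU hp] := IH v _ _ vU.
- by move=> f fs; apply: idem; rewrite inE fs orbT.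
- by move=> f g fs gs; apply: orth; rewrite inE ?fs ?gs orbT.
have ee : e ** e = e by apply: idem; rewrite mem_head.
have [p1 [ph [p0 [[pE h1 hh h0] [E1 Eh E0]]]]] := peirce_decomp two_neq0 jA ee p.
have inv f n v' : f \in es -> (n < 3)%N -> eig f n v' -> eig f n (e ** v').
  move=> fs n3 hf; have ff : f ** f = f by apply: idem; rewrite inE fs orbT.
  have [fe|fe] := eqVneq f e.
    by subst f; rewrite {1}/eig hf amulZr hf.
  apply: (eig_mul (a := 0)) => //; apply/eig0E; apply: orth fe; rewrite inE ?eqxx ?fs ?orbT //.
have fin p' : p' = p1 \/ p' = ph \/ p' = p0 ->
    {in es, forall f, exists2 n, (n < 3)%N & eig f n p'}.
  move=> hp' f fs; have [n n3 hn] := hp f fs; exists n => //.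
  have hn1 := inv f n p fs n3 hn; have hn2 := inv f n _ fs n3 hn1.
  by case: hp' => [->|[->|->]]; rewrite ?E1 ?Eh ?E0 /eig !amulE ?hn ?hn1 ?hn2; module_ring.
have [q [hq qU [n n3 hn]]] : exists q, [/\ q = p1 \/ q = ph \/ q = p0, q \notin U &
    exists2 n, (n < 3)%N & eig e n q].
  have [p1U|p1U] := boolP (p1 \in U); last first.
    by exists p1; split; [left | | exists 2%N => //; apply/eig2E].
  have [phU|phU] := boolP (ph \in U); last first.
    by exists ph; split; [right; left | | exists 1%N => //; apply/eig1E].
  exists p0; split; [by right; right | | by exists 0%N => //; apply/eig0E].
  by apply: contra pU => p0U; rewrite pE !memvD.
by exists q => // f; rewrite inE => /orP[/eqP ->|/(fin q hq)//]; exists n.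
Qed.

Section Maximal.
Variables (es : seq A) (r : nat).
Hypotheses (oes : orthogonal_idempotents es) (sr : size es = r).
Hypothesis max_es : forall fs, orthogonal_idempotents fs -> (size fs <= r)%N.
Let f0 := \sum_(e <- es) e.

Lemma sum_mul e : e \in es -> e ** f0 = e.
Proof.
move=> ees; case: oes => u idem orth; rewrite /f0 linear_sumr.
rewrite (bigD1_seq e) //= big_seq_cond big1 ?addr0; first by case: (idem e ees).
by move=> f /andP [fs fe]; apply: orth => //; rewrite eq_sym.
Qed.

Lemma sum_idem : f0 ** f0 = f0.
Proof.
rewrite {2 3}/f0 linear_sumr big_seq [RHS]big_seq; apply: eq_bigr => e ees /=.
by rewrite (amulC jA) sum_mul.
Qed.

Lemma eigv_act e n x q : e ** e = e -> n = 0%N \/ n = 2%N ->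
  x \in eigv e n -> act x x q \in eigv e n.
Proof.
move=> ee hn /mem_eigvP hx; have pw i : pow x i \in eigv e n.
  apply/mem_eigvP; elim: i => [//|i IH]; rewrite powS.
  by apply: (eig_mul (a := n)) => //; case: hn => ->.
by rewrite act_powE; apply: memv_suml => i _; apply: memvZ.
Qed.

(** A nonzero idempotent in the 0-space of the sum would be orthogonal to every member and could be
    added to the family. *)
Lemma null_local_space : local_space (0 : A) (eigv f0 0) (\dim (eigv f0 0)).
Proof.
have ff := sum_idem.
split=> [|v w /mem_eigvP hv /mem_eigvP hw|v _|v vW|].
- exact: mem0v.
- by apply/mem_eigvP; apply: (eig_mul (a := 0)).
- by rewrite eqxx scale0r amul0l.
- exists 0; rewrite scale0r subr0.
  have [//|[q [gg g0]]] := idempotent_or_nil two_neq0 jA v; exfalso.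
  set g := act v v q in gg g0; case: (oes) => u idem orth.
  have hg : f0 ** g = 0 by apply/eig0E/mem_eigvP; apply: eigv_act => //; left.
  have ge e : e \in es -> e ** g = 0.
    move=> ees; apply: (peirce_10 two_neq0 jA ff) => //.
    by rewrite (amulC jA) sum_mul.
  have gnes : g \notin es.
    by apply/negP => ges; move/negP: g0; apply; rewrite -gg ge.
  suff /max_es : orthogonal_idempotents (g :: es) by rewrite /= sr ltnn.
  split=> [|e|e e']; rewrite ?inE /= ?gnes //.
    by case/orP=> [/eqP ->|/idem].
  move=> /orP[/eqP -> |ees] /orP[/eqP ->|ees'] ne; rewrite ?eqxx // in ne *.
  + by rewrite (amulC jA) ge.
  + by rewrite ge.
  + exact: orth.
- by rewrite eqxx addn0.
Qed.

(** A further idempotent g would split e into g and e - g, both orthogonal to the other members;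
    replacing e by these two would enlarge the family. *)
Lemma unit_local_space e m : e \in es -> \dim (eigv e 2) = m.+1 ->
  local_space e (eigv e 2) m.
Proof.
move=> ees dm; case: (oes) => u idem orth; have [ee e0] := idem e ees.
split=> [|v w /mem_eigvP hv /mem_eigvP hw|v /mem_eigvP hv|v /mem_eigvP hv|].
- by apply/mem_eigvP/eig2E.
- by apply/mem_eigvP; apply: (eig_mul (a := 2)).
- by rewrite e0 scale1r; apply/eig2E.
- apply: (local_nil two_neq0 jA ee e0) => [q sq||g eg gg].
  + by apply/closed_rootP; rewrite neq_ltn sq orbT.
  + exact/eig2E.
  have [->|g0] := eqVneq g 0; first by left.
  right; apply/eqP/negPn/negP => ge; set g' := e - g.
  have ge1 : g ** e = g by rewrite (amulC jA).
  have g'0 : g' != 0 by rewrite subr_eq0 eq_sym.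
  have g'g' : g' ** g' = g' by rewrite /g' !amulE ee eg ge1 gg; module_ring.
  have gg' : g ** g' = 0 by rewrite /g' amulBr ge1 gg subrr.
  have eg' : e ** g' = g' by rewrite /g' amulBr ee eg.
  have kill f : f \in es -> f != e -> g ** f = 0 /\ g' ** f = 0.
    by move=> fs fe; have ef : e ** f = 0 by [apply: orth => //; rewrite eq_sym];
      split; apply: (peirce_10 two_neq0 jA ee).
  have nin h : h != 0 -> h ** h = h -> e ** h = h -> h != e -> h \notin es.
    by move=> h0 hh eh he; apply/negP => hs; move/negP: h0; apply; rewrite -eh orth // eq_sym.
  have g'e : g' != e by rewrite /g' -subr_eq0 addrAC subrr add0r oppr_eq0.
  suff /max_es : orthogonal_idempotents [:: g, g' & rem e es].
    have r0 : (0 < r)%N by rewrite -sr; case: (es) ees.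
    by rewrite /= size_rem // sr prednK // ltnn.
  have gg'n : g != g' by apply/eqP => E; move/negP: g0; apply; rewrite -gg {2}E gg'.
  have mr f : f \in rem e es -> f \in es /\ f != e.
    by rewrite mem_rem_uniq // !inE => /andP [].
  split=> [|f|f f'].
  + rewrite /= inE negb_or gg'n rem_uniq // andbT /=.
    by apply/andP; split; apply/negP => /mr [h _]; move: h; apply/negP; apply: nin.
  + by rewrite !inE => /or3P[/eqP ->|/eqP ->|/mr [/idem]].
  rewrite !inE => /or3P[/eqP ->|/eqP ->|/mr [fs fe]] /or3P[/eqP ->|/eqP ->|/mr [fs' fe']] ne;
    rewrite ?eqxx // in ne *.
  + by case: (kill f' fs' fe').
  + by rewrite (amulC jA).
  + by case: (kill f' fs' fe').
  + by rewrite (amulC jA); case: (kill f fs fe).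
  + by rewrite (amulC jA); case: (kill f fs fe).
  + exact: orth.
- by rewrite dm e0 addn1.
Qed.

End Maximal.
End PeirceBases.

Ltac span_mem := rewrite memv_span // ?inE ?eqxx ?orbT //.

(* Solves [<<X>> <= <<Y>>] when every member of [X] is zero or occurs in [Y]. *)
Ltac sub_spans :=
  apply/span_subvP => ?; rewrite !inE; repeat (case/orP); move/eqP=> ->;
  solve [exact: mem0v | span_mem].

Ltac present b0 b1 b2 b3 :=
  exists b0, b1, b2, b3;
  split; [assumption | split | split | split | exact: amulC];
  first [assumption | comb_norm; assumption].

(** * Algebras with one idempotent, by Peirce dimensions *)

Section OneIdempotent.
Variables (k : closedFieldType) (A : algebra k).
Hypothesis two_neq0 : (2 : k) != 0.
Hypothesis jA : jordan A.
Hypothesis dimA : adim A = 4%N.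
Local Notation "x ** y" := (@amul k A x y) (at level 40, left associativity).
Local Notation half := (2^-1 : k).
Implicit Types (x y z v u b c d h : A).

Lemma basis_of_span4 (Y : seq A) : (fullv <= <<Y>>)%VS -> size Y = 4%N ->
  basis_of fullv Y.
Proof. by move=> sY s4; rewrite basisEdim sY s4 [X in (_ <= X)%N]dimA. Qed.

Lemma span_of_dim (W : {vspace A}) : exists2 X : seq A, size X = \dim W & W = <<X>>%VS.
Proof.
by exists (vbasis W); rewrite ?size_tuple // (span_basis (vbasisP W)).
Qed.

(** From b(bh) = b^2 h/2 = 0 and bh = c h follows c^2 h = 0. *)
Lemma act_half_zero e (n : nat) b h (c : k) : e ** e = e -> n = 0%N \/ n = 2%N ->
  eig e n b -> eig e 1 h -> (b ** b) ** h = 0 -> b ** h = c *: h -> b ** h = 0.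
Proof.
move=> ee hn hb hh bbh bh.
have H (ε : bool) : e ** b = ε%:R *: b -> b ** h = 0.
  move=> eb; have := half_action two_neq0 jA ee eb (proj1 (eig1E _ _) hh).
  rewrite bbh scaler0 bh amulZr bh scalerA => /eqP; rewrite scaler_eq0 mulf_eq0 orbb.
  by case/orP=> /eqP ->; rewrite ?scale0r ?scaler0.
case: hn hb => -> hb; [apply: (H false) | apply: (H true)].
  by rewrite scale0r; apply/eig0E.
by rewrite scale1r; apply/(eig2E two_neq0).
Qed.

Lemma extend_joint (es X : seq A) : {in es, forall f, f ** f = f} ->
  {in es &, forall f g, f != g -> f ** g = 0} -> free X -> (size X < 4)%N ->
  exists2 x, free (rcons X x) & {in es, forall f, exists2 n, (n < 3)%N & eig f n x}.
Proof.
move=> idem orth fX sX; have iX : indep 0 X by rewrite indep0.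
have XW : {subset X <= fullv} by move=> v _; rewrite memvf.
have sX' : (size X + ((0%R : A) != 0%R) < \dim {: A})%N.
  by rewrite eqxx addn0 [X in (_ < X)%N]dimA.
have [v _ vX] := indep_extend iX (mem0v _) XW sX'.
have [x xX hx] := joint_eigenvector two_neq0 jA idem orth vX.
by exists x => //; rewrite -indep0; apply: indep_rcons; rewrite ?indep0.
Qed.

Section Fixed.
Variable e : A.
Hypothesis oe : orthogonal_idempotents [:: e].
Hypothesis max_e : forall fs : seq A, orthogonal_idempotents fs -> (size fs <= 1)%N.
Local Notation W n := (eigv e n).

Let ee : e ** e = e. Proof. by case: oe => _ /(_ e (mem_head _ _)) []. Qed.
Let e0 : e != 0. Proof. by case: oe => _ /(_ e (mem_head _ _)) []. Qed.

Let L0 : local_space (0 : A) (W 0) (\dim (W 0)).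
Proof.
have := null_local_space two_neq0 jA oe (erefl _) max_e.
by rewrite big_seq1.
Qed.

Let L2 m : \dim (W 2) = m.+1 -> local_space e (W 2) m.
Proof. by apply: (unit_local_space two_neq0 jA oe (erefl _) max_e); rewrite mem_head. Qed.

Let eW2 : e \in W 2. Proof. by apply/mem_eigvP/(eig2E two_neq0). Qed.

Let W2_line : \dim (W 2) = 1%N -> W 2 = <<[:: e]>>%VS.
Proof.
move=> d1; apply/esym/eqP; rewrite eqEdim d1 span_seq1 dim_vline e0 andbT.
by rewrite -memvE.
Qed.

Let in2 b : b \in W 2 -> e ** b = b. Proof. by move/mem_eigvP/(eig2E two_neq0). Qed.
Let in1 b : b \in W 1 -> e ** b = half *: b. Proof. by move/mem_eigvP/eig1E. Qed.
Let in0 b : b \in W 0 -> e ** b = 0. Proof. by move/mem_eigvP/eig0E. Qed.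

Let p20 b c : b \in W 2 -> c \in W 0 -> b ** c = 0.
Proof. by move=> /in2 hb /in0 hc; exact: (peirce_10 two_neq0 jA ee hb hc). Qed.

Let kill n b h : n = 0%N \/ n = 2%N -> W 1 = <<[:: h]>>%VS -> b \in W n ->
  (b ** b) ** h = 0 -> b ** h = 0 /\ h ** b = 0.
Proof.
move=> hn W1 /mem_eigvP hb bbh; rewrite (amulC jA h).
have hh : eig e 1 h by apply/mem_eigvP; rewrite W1; span_mem.
suff [s bh] : exists s, b ** h = s *: h.
  by rewrite (act_half_zero ee hn hb hh bbh bh).
apply: span1P; rewrite -W1; apply/mem_eigvP; apply: (eig_mul two_neq0 jA (a := n)) => //;
  by case: hn => ->.
Qed.

Let peirce_basis (Y : seq A) : (W 2 <= <<Y>>)%VS -> (W 1 <= <<Y>>)%VS ->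
  (W 0 <= <<Y>>)%VS -> size Y = 4%N -> basis_of fullv Y.
Proof.
move=> s2 s1 s0; apply: basis_of_span4; apply/subvP => v _.
have [v1 [vh [v0 [[-> h1 hh h0] _]]]] := peirce_decomp two_neq0 jA ee v.
rewrite !memvD //.
- by apply: (subvP s2); apply/mem_eigvP/(eig2E two_neq0).
- by apply: (subvP s1); apply/mem_eigvP/eig1E.
- by apply: (subvP s0); apply/mem_eigvP/eig0E.
Qed.

Let products (b0 b1 b2 b3 : A) (w0 w1 w2 w3 : nat) :
  basis_of fullv [:: b0; b1; b2; b3] ->
  [/\ b0 \in W w0, b1 \in W w1, b2 \in W w2 & b3 \in W w3] ->
  all (fun i => i < 3)%N [:: w0; w1; w2; w3] ->
  forall i j, (i < 4)%N -> (j < 4)%N ->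
  exists q, [:: b0; b1; b2; b3]`_i ** [:: b0; b1; b2; b3]`_j =
    comb b0 b1 b2 b3 (wmask [:: [:: w0; w1; w2; w3]] i j q).
Proof.
move=> bX [/mem_eigvP h0 /mem_eigvP h1 /mem_eigvP h2 /mem_eigvP h3] /and5P [l0 l1 l2 l3 _].
apply: (masked two_neq0 jA (ps := [:: (e, [:: w0; w1; w2; w3])]) bX).
move=> p; rewrite inE => /eqP ->; split=> // i.
by case: i => [|[|[|[|i]]]] // _; split.
Qed.

(** The digits in these names are the dimensions of A_11 modulo e, of the half-space and of A_00. *)
Lemma one_300 : \dim (W 2) = 4%N -> \dim (W 1) = 0%N -> \dim (W 0) = 0%N -> listed A.
Proof.
move=> /L2 /(local3 two_neq0 jA) [b [c [d [E2 [cc cd dd] H]]]] d1 d0.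
have bX : basis_of fullv [:: e; b; c; d].
  apply: peirce_basis; rewrite // ?E2; first by sub_spans.
    by move/eqP: d1; rewrite dimv_eq0 => /eqP ->; apply: sub0v.
  by move/eqP: d0; rewrite dimv_eq0 => /eqP ->; apply: sub0v.
have eb : e ** b = b by apply: in2; rewrite E2; span_mem.
have ec : e ** c = c by apply: in2; rewrite E2; span_mem.
have ed : e ** d = d by apply: in2; rewrite E2; span_mem.
case: H => [[bb bc bd]|[bb bc bd]|[bb bc bd]|[bb bc bd]].
- by apply: listed_one_111_0; present e b c d.
- by apply: listed_one_111_1; present e b c d.
- by apply: listed_one_111_2; present e b c d.
- by apply: listed_one_111_3; present e b c d.
Qed.

Lemma one_003 : \dim (W 2) = 1%N -> \dim (W 1) = 0%N -> \dim (W 0) = 3%N -> listed A.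
Proof.
move=> /W2_line E2 d1 d0; have := L0; rewrite d0.
move=> /(local3 two_neq0 jA) [b [c [d [E0 [cc cd dd] H]]]].
have bX : basis_of fullv [:: e; b; c; d].
  apply: peirce_basis; rewrite // ?E2 ?E0; first by sub_spans.
    by move/eqP: d1; rewrite dimv_eq0 => /eqP ->; apply: sub0v.
  by sub_spans.
have eb : e ** b = 0 by apply: in0; rewrite E0; span_mem.
have ec : e ** c = 0 by apply: in0; rewrite E0; span_mem.
have ed : e ** d = 0 by apply: in0; rewrite E0; span_mem.
case: H => [[bb bc bd]|[bb bc bd]|[bb bc bd]|[bb bc bd]].
- by apply: listed_one_000_0; present e b c d.
- by apply: listed_one_000_1; present e b c d.
- by apply: listed_one_000_2; present e b c d.
- by apply: listed_one_000_3; present e b c d.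
Qed.

Lemma one_012 : \dim (W 2) = 1%N -> \dim (W 1) = 1%N -> \dim (W 0) = 2%N -> listed A.
Proof.
move=> /W2_line E2 d1 d0; have := L0; rewrite d0.
move=> /(local2 two_neq0 jA) [b [c [E0 cc bc H]]].
have [[|h [|]] //] := span_of_dim (W 1); rewrite d1 // => _ E1.
have bX : basis_of fullv [:: e; h; b; c].
  by apply: peirce_basis; rewrite // ?E2 ?E1 ?E0; sub_spans.
have eh : e ** h = half *: h by apply: in1; rewrite E1; span_mem.
have b0 : b \in W 0 by rewrite E0; span_mem.
have c0 : c \in W 0 by rewrite E0; span_mem.
have eb := in0 b0; have ec := in0 c0.
have [ch hc] : c ** h = 0 /\ h ** c = 0.
  by apply: kill (or_introl (erefl _)) E1 c0 _; rewrite cc amul0l.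
have [bh hb] : b ** h = 0 /\ h ** b = 0.
  by apply: kill (or_introl (erefl _)) E1 b0 _; case: H => ->; rewrite ?amul0l.
have m4 : [/\ e \in W 2, h \in W 1, b \in W 0 & c \in W 0].
  by split=> //; rewrite E1; span_mem.
have M := products bX m4 isT.
have [q hh] := M 1%N 1%N isT isT; rewrite /wmask /compat /= in hh.
case: H => bb.
- by apply: (listed_one_h00_0 two_neq0 jA (a := q0 q) (b := q2 q) (c := q3 q)); present e h b c.
- by apply: (listed_one_h00_1 two_neq0 jA (a := q0 q) (b := q2 q) (c := q3 q)); present e h b c.
Qed.

Lemma one_102 : \dim (W 2) = 2%N -> \dim (W 1) = 0%N -> \dim (W 0) = 2%N -> listed A.
Proof.
move=> /L2 /(local1 two_neq0 jA) [n E2 nn] d1 d0; have := L0; rewrite d0.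
move=> /(local2 two_neq0 jA) [b [c [E0 cc bc H]]].
have bX : basis_of fullv [:: e; n; b; c].
  apply: peirce_basis; rewrite // ?E2 ?E0; first by sub_spans.
    by move/eqP: d1; rewrite dimv_eq0 => /eqP ->; apply: sub0v.
  by sub_spans.
have n2 : n \in W 2 by rewrite E2; span_mem.
have b0 : b \in W 0 by rewrite E0; span_mem.
have c0 : c \in W 0 by rewrite E0; span_mem.
have en := in2 n2; have eb := in0 b0; have ec := in0 c0.
have nb := p20 n2 b0; have nc := p20 n2 c0.
case: H => bb.
- by apply: listed_one_100_0; present e n b c.
- by apply: listed_one_100_1; present e n b c.
Qed.

Lemma one_201 : \dim (W 2) = 3%N -> \dim (W 1) = 0%N -> \dim (W 0) = 1%N -> listed A.
Proof.
move=> /L2 /(local2 two_neq0 jA) [b [c [E2 cc bc H]]] d1 d0; have := L0; rewrite d0.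
move=> /(local1 two_neq0 jA) [a E0 aa].
have bX : basis_of fullv [:: e; b; c; a].
  apply: peirce_basis; rewrite // ?E2 ?E0; first by sub_spans.
    by move/eqP: d1; rewrite dimv_eq0 => /eqP ->; apply: sub0v.
  by sub_spans.
have b2 : b \in W 2 by rewrite E2; span_mem.
have c2 : c \in W 2 by rewrite E2; span_mem.
have a0 : a \in W 0 by rewrite E0; span_mem.
have eb := in2 b2; have ec := in2 c2; have ea := in0 a0.
have ba := p20 b2 a0; have ca := p20 c2 a0.
case: H => bb.
- by apply: listed_one_110_0; present e b c a.
- by apply: listed_one_110_1; present e b c a.
Qed.

Lemma one_210 : \dim (W 2) = 3%N -> \dim (W 1) = 1%N -> \dim (W 0) = 0%N -> listed A.
Proof.
move=> /L2 /(local2 two_neq0 jA) [b [c [E2 cc bc H]]] d1 d0.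
have [[|h [|]] //] := span_of_dim (W 1); rewrite d1 // => _ E1.
have bX : basis_of fullv [:: e; b; c; h].
  apply: peirce_basis; rewrite // ?E2 ?E1; [by sub_spans | by sub_spans |].
  by move/eqP: d0; rewrite dimv_eq0 => /eqP ->; apply: sub0v.
have eh : e ** h = half *: h by apply: in1; rewrite E1; span_mem.
have b2 : b \in W 2 by rewrite E2; span_mem.
have c2 : c \in W 2 by rewrite E2; span_mem.
have eb := in2 b2; have ec := in2 c2.
have [ch hc] : c ** h = 0 /\ h ** c = 0.
  by apply: kill (or_intror (erefl _)) E1 c2 _; rewrite cc amul0l.
have [bh hb] : b ** h = 0 /\ h ** b = 0.
  by apply: kill (or_intror (erefl _)) E1 b2 _; case: H => ->; rewrite ?amul0l.
have m4 : [/\ e \in W 2, b \in W 2, c \in W 2 & h \in W 1].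
  by split=> //; rewrite E1; span_mem.
have M := products bX m4 isT.
have [q hh] := M 3%N 3%N isT isT; rewrite /wmask /compat /= in hh.
case: H => bb.
- by apply: (listed_one_11h_0 two_neq0 jA (a := q0 q) (b := q1 q) (c := q2 q)); present e b c h.
- by apply: (listed_one_11h_1 two_neq0 jA (a := q0 q) (b := q1 q) (c := q2 q)); present e b c h.
Qed.

Lemma one_111 : \dim (W 2) = 2%N -> \dim (W 1) = 1%N -> \dim (W 0) = 1%N -> listed A.
Proof.
move=> /L2 /(local1 two_neq0 jA) [n E2 nn] d1 d0; have := L0; rewrite d0.
move=> /(local1 two_neq0 jA) [b E0 bb].
have [[|h [|]] //] := span_of_dim (W 1); rewrite d1 // => _ E1.
have bX : basis_of fullv [:: e; n; h; b].
  by apply: peirce_basis; rewrite // ?E2 ?E1 ?E0; sub_spans.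
have eh : e ** h = half *: h by apply: in1; rewrite E1; span_mem.
have n2 : n \in W 2 by rewrite E2; span_mem.
have b0 : b \in W 0 by rewrite E0; span_mem.
have en := in2 n2; have eb := in0 b0; have nb := p20 n2 b0.
have [nh hn] : n ** h = 0 /\ h ** n = 0.
  by apply: kill (or_intror (erefl _)) E1 n2 _; rewrite nn amul0l.
have [bh hb] : b ** h = 0 /\ h ** b = 0.
  by apply: kill (or_introl (erefl _)) E1 b0 _; rewrite bb amul0l.
have m4 : [/\ e \in W 2, n \in W 2, h \in W 1 & b \in W 0].
  by split=> //; rewrite E1; span_mem.
have M := products bX m4 isT.
have [q hh] := M 2%N 2%N isT isT; rewrite /wmask /compat /= in hh.
by apply: (listed_one_1h0 two_neq0 jA (a := q0 q) (b := q1 q) (c := q3 q)); present e n h b.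
Qed.

Lemma one_030 : \dim (W 2) = 1%N -> \dim (W 1) = 3%N -> \dim (W 0) = 0%N -> listed A.
Proof.
move=> /W2_line E2 d1 d0.
have [[|u [|v [|z [|]]]] //] := span_of_dim (W 1); rewrite d1 // => _ E1.
have bX : basis_of fullv [:: e; u; v; z].
  apply: peirce_basis; rewrite // ?E2 ?E1; [by sub_spans | by sub_spans |].
  by move/eqP: d0; rewrite dimv_eq0 => /eqP ->; apply: sub0v.
have u1 : u \in W 1 by rewrite E1; span_mem.
have v1 : v \in W 1 by rewrite E1; span_mem.
have z1 : z \in W 1 by rewrite E1; span_mem.
have eu := in1 u1; have ev := in1 v1; have ez := in1 z1.
have M := products bX (And4 eW2 u1 v1 z1) isT.
have [q11 h11] := M 1%N 1%N isT isT; have [q12 h12] := M 1%N 2%N isT isT.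
have [q13 h13] := M 1%N 3%N isT isT; have [q22 h22] := M 2%N 2%N isT isT.
have [q23 h23] := M 2%N 3%N isT isT; have [q33 h33] := M 3%N 3%N isT isT.
rewrite /wmask /compat /= in h11 h12 h13 h22 h23 h33.
apply: (listed_one_hhh two_neq0 jA (a := q0 q11) (b := q0 q22) (c := q0 q33)
  (x := q0 q12) (y := q0 q13) (z := q0 q23)).
by present e u v z.
Qed.

(** By b(bh) = b^2 h/2, an element w of square zero acts on the half-space as an operator of square
    zero, whose Jordan form in dimension two is zero or one block. *)
Let half_plane n w : n = 0%N \/ n = 2%N -> w \in W n -> w ** w = 0 ->
  \dim (W 1) = 2%N -> exists u v, [/\ W 1 = <<[:: u; v]>>%VS, w ** v = 0 &
    w ** u = 0 \/ w ** u = v].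
Proof.
move=> hn /mem_eigvP hw ww d1.
have wW x : x \in W 1 -> w ** x \in W 1.
  move=> /mem_eigvP hx; apply/mem_eigvP.
  by apply: (eig_mul two_neq0 jA (a := n)) => //; case: hn => ->.
have w2 x : x \in W 1 -> w ** (w ** x) = 0.
  move=> x1; have H (ε : bool) : e ** w = ε%:R *: w -> w ** (w ** x) = 0.
    move=> ew; rewrite (half_action two_neq0 jA ee ew (in1 x1)).
    by rewrite ww amul0l scaler0.
  case: hn hw => -> hw; [apply: (H false) | apply: (H true)].
    by rewrite scale0r; apply/eig0E.
  by rewrite scale1r; apply/(eig2E two_neq0).
have [[u [u1 wu]]|H] := classic (exists u, u \in W 1 /\ w ** u != 0).
  exists u, (w ** u); split; [|exact: w2 | by right].
  apply/esym/eqP; rewrite eqEdim; apply/andP; split.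
    by apply/span_subvP => x; rewrite !inE => /orP[] /eqP ->; rewrite ?wW.
  suff : free [:: u; w ** u] by move/eqP => ->; rewrite d1.
  rewrite free_cons seq1_free wu andbT; apply/negP => /span1P [c uE].
  by move/negP: wu; apply; rewrite uE amulZr w2 // scaler0.
have {}H x : x \in W 1 -> w ** x = 0.
  by move=> x1; apply/eqP/negPn/negP => wx; apply: H; exists x.
have [[|u [|v [|]]] //] := span_of_dim (W 1); rewrite d1 // => _ E1.
by exists u, v; split=> //; [|left]; apply: H; rewrite E1; span_mem.
Qed.

Lemma one_021 : \dim (W 2) = 1%N -> \dim (W 1) = 2%N -> \dim (W 0) = 1%N -> listed A.
Proof.
move=> /W2_line E2 d1 d0; have := L0; rewrite d0.
move=> /(local1 two_neq0 jA) [w E0 ww].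
have w0 : w \in W 0 by rewrite E0; span_mem.
have [u [v [E1 wv H]]] := half_plane (or_introl (erefl _)) w0 ww d1.
have bX : basis_of fullv [:: e; u; v; w].
  by apply: peirce_basis; rewrite // ?E2 ?E1 ?E0; sub_spans.
have u1 : u \in W 1 by rewrite E1; span_mem.
have v1 : v \in W 1 by rewrite E1; span_mem.
have eu := in1 u1; have ev := in1 v1; have ew := in0 w0.
rewrite (amulC jA) in wv; rewrite (amulC jA) in H.
have M := products bX (And4 eW2 u1 v1 w0) isT.
have [q11 h11] := M 1%N 1%N isT isT; have [q12 h12] := M 1%N 2%N isT isT.
have [q22 h22] := M 2%N 2%N isT isT.
rewrite /wmask /compat /= in h11 h12 h22.
case: H => uw.
- apply: (listed_one_hh0 two_neq0 jA (a := q0 q11) (b := q0 q12) (c := q0 q22)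
    (x := q3 q11) (y := q3 q12) (z := q3 q22)); by present e u v w.
- apply: (listed_one_hh0_action two_neq0 jA (a := q0 q11) (b := q0 q12) (c := q0 q22)
    (x := q3 q11) (y := q3 q12) (z := q3 q22)); by present e u v w.
Qed.

Lemma one_120 : \dim (W 2) = 2%N -> \dim (W 1) = 2%N -> \dim (W 0) = 0%N -> listed A.
Proof.
move=> /L2 /(local1 two_neq0 jA) [w E2 ww] d1 d0.
have w2 : w \in W 2 by rewrite E2; span_mem.
have [u [v [E1 wv H]]] := half_plane (or_intror (erefl _)) w2 ww d1.
have bX : basis_of fullv [:: e; u; v; w].
  apply: peirce_basis; rewrite // ?E2 ?E1; [by sub_spans | by sub_spans |].
  by move/eqP: d0; rewrite dimv_eq0 => /eqP ->; apply: sub0v.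
have u1 : u \in W 1 by rewrite E1; span_mem.
have v1 : v \in W 1 by rewrite E1; span_mem.
have eu := in1 u1; have ev := in1 v1; have ew := in2 w2.
rewrite (amulC jA) in wv; rewrite (amulC jA) in H.
have M := products bX (And4 eW2 u1 v1 w2) isT.
have [q11 h11] := M 1%N 1%N isT isT; have [q12 h12] := M 1%N 2%N isT isT.
have [q22 h22] := M 2%N 2%N isT isT.
rewrite /wmask /compat /= in h11 h12 h22.
case: H => uw.
- apply: (listed_one_1hh two_neq0 jA (a := q0 q11) (b := q0 q12) (c := q0 q22)
    (x := q3 q11) (y := q3 q12) (z := q3 q22)); by present e u v w.
- apply: (listed_one_1hh_action two_neq0 jA (a := q0 q11) (b := q0 q12) (c := q0 q22)
    (x := q3 q11) (y := q3 q12) (z := q3 q22)); by present e u v w.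
Qed.

Lemma listed_one : listed A.
Proof.
have idem : {in [:: e], forall f, f ** f = f} by move=> f; rewrite inE => /eqP ->.
have orth : {in [:: e] &, forall f g, f != g -> f ** g = 0}.
  by move=> f g; rewrite !inE => /eqP -> /eqP ->; rewrite eqxx.
have f1 : free [:: e] by rewrite seq1_free.
have [x f2 /(_ e (mem_head _ _)) [n n3 hx]] := extend_joint idem orth f1 isT.
have [y f3 /(_ e (mem_head _ _)) [m m3 hy]] := extend_joint idem orth f2 isT.
have [z f4 /(_ e (mem_head _ _)) [l l3 hz]] := extend_joint idem orth f3 isT.
have bX := basis_of_free dimA f4.
have wX : weighted e [:: 2; n; m; l] [:: e; x; y; z].
  by split=> // [[|[|[|[|i]]]]] // _; split=> //; apply/mem_eigvP.
have [_ d2] := eigv_span two_neq0 bX wX (n := 2) isT;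
  have [_ d1] := eigv_span two_neq0 bX wX (n := 1) isT.
have [_ d0] := eigv_span two_neq0 bX wX (n := 0) isT.
(* The 27 choices of weights lead to ten triples of Peirce dimensions. *)
case: n n3 m m3 l l3 {hx hy hz wX} d2 d1 d0 => [|[|[|]]] // _ [|[|[|]]] // _ [|[|[|]]] // _ /=
  d2 d1 d0;
  first [exact: one_300 | exact: one_003 | exact: one_030 | exact: one_012 | exact: one_021
   | exact: one_102 | exact: one_201 | exact: one_120 | exact: one_210 | exact: one_111].
Qed.

End Fixed.
End OneIdempotent.

(** * Algebras with two orthogonal idempotents *)

Section TwoIdempotents.
Variables (k : closedFieldType) (A : algebra k).
Hypothesis two_neq0 : (2 : k) != 0.
Hypothesis jA : jordan A.
Hypothesis dimA : adim A = 4%N.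
Local Notation "x ** y" := (@amul k A x y) (at level 40, left associativity).
Implicit Types (x y z v b c : A).

Definition maximal_idempotents (es : seq A) : Prop :=
  orthogonal_idempotents es /\
  forall fs : seq A, orthogonal_idempotents fs -> (size fs <= size es)%N.

Lemma maximal_perm es fs : perm_eq es fs -> maximal_idempotents es ->
  maximal_idempotents fs.
Proof.
move=> p [[u idem orth] m]; split; last by rewrite -(perm_size p).
split; first by rewrite -(perm_uniq p).
  by move=> e; rewrite -(perm_mem p); apply: idem.
by move=> e f; rewrite -!(perm_mem p); apply: orth.
Qed.

Lemma basis_perm (X Y : seq A) : perm_eq X Y -> basis_of fullv X -> basis_of fullv Y.
Proof. by move=> p; rewrite (perm_basis _ p). Qed.

(** The pairs of weights (2,0), (1,0), (1,1), (0,1), (0,2) and (0,0) are the Peirce spaces A_11,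
    A_10, A_12, A_20, A_22 and A_00. *)
Definition typed2 e1 e2 (n m : nat) x : Prop := eig e1 n x /\ eig e2 m x.

Definition frame2 e1 e2 x y : Prop :=
  maximal_idempotents [:: e1; e2] /\ basis_of fullv [:: e1; e2; x; y].

Lemma frame2_swap_e e1 e2 x y : frame2 e1 e2 x y -> frame2 e2 e1 x y.
Proof.
case=> m bX; split; first by apply: maximal_perm m; rewrite (perm_catC [:: e1] [:: e2]).
apply: basis_perm bX; rewrite -[[:: e1, e2 & _]]/([:: e1; e2] ++ [:: x; y]).
by rewrite -[[:: e2, e1 & _]]/([:: e2; e1] ++ [:: x; y]) perm_cat2r (perm_catC [:: e1] [:: e2]).
Qed.

Lemma frame2_swap_x e1 e2 x y : frame2 e1 e2 x y -> frame2 e1 e2 y x.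
Proof.
by case=> m bX; split=> //; apply: basis_perm bX; rewrite !perm_cons (perm_catC [:: x] [:: y]).
Qed.

Lemma typed2_swap e1 e2 n m x : typed2 e1 e2 n m x -> typed2 e2 e1 m n x.
Proof. by case. Qed.

Section Frame.
Variables (e1 e2 x y : A) (n m n' m' : nat).
Hypothesis F : frame2 e1 e2 x y.
Hypotheses (tx : typed2 e1 e2 n m x) (ty : typed2 e1 e2 n' m' y).
Hypothesis small : [&& n < 3, m < 3, n' < 3, m' < 3, n + m < 3 & n' + m' < 3]%N.

Lemma frame2_idem : [/\ e1 ** e1 = e1, e2 ** e2 = e2, e1 ** e2 = 0 & e2 ** e1 = 0].
Proof.
have [[[u idem orth] _] _] := F.
have ne : e1 != e2 by move: u => /=; rewrite inE andbT.
split; [by case: (idem e1 _) => //; rewrite mem_head | | |].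
- by case: (idem e2 _) => //; rewrite !inE eqxx orbT.
- by apply: orth; rewrite ?inE ?eqxx ?orbT.
- by apply: orth; rewrite ?inE ?eqxx ?orbT // eq_sym.
Qed.

(** The sum e_1 + e_2 is included because it excludes products that the two idempotents allow
    separately, such as an A_00 component in the square of an element of A_12. *)
Lemma frame2_weighted : forall p, p \in [:: (e1, [:: 2; 0; n; n']); (e2, [:: 0; 2; m; m']);
    (e1 + e2, [:: 2; 2; (n + m)%N; (n' + m')%N])] ->
  weighted p.1 p.2 [:: e1; e2; x; y].
Proof.
have [e11 e22 e12 e21] := frame2_idem; have [hx1 hx2] := tx; have [hy1 hy2] := ty.
case/and5P: small => n3 m3 n3' m3' /andP [s s'].
move=> p; rewrite !inE => /or3P[] /eqP -> /=; split=> //=.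
- case=> [|[|[|[|i]]]] //= _; split=> //.
  + by apply/(eig2E two_neq0).
  + by apply/eig0E.
- case=> [|[|[|[|i]]]] //= _; split=> //.
  + by apply/eig0E.
  + by apply/(eig2E two_neq0).
- by rewrite !amulE e11 e12 e21 e22 addr0 add0r.
- case=> [|[|[|[|i]]]] //= _; split=> //; rewrite /eig amulDl.
  + by rewrite e11 e21 addr0 wt2 // scale1r.
  + by rewrite e12 e22 add0r wt2 // scale1r.
  + by rewrite hx1 hx2 -scalerDl -wtD.
  + by rewrite hy1 hy2 -scalerDl -wtD.
Qed.

Lemma frame2_weighted_sum :
  weighted (e1 + e2) [:: 2; 2; (n + m)%N; (n' + m')%N] [:: e1; e2; x; y].
Proof. by have := frame2_weighted (mem_last _ _). Qed.

Lemma frame2_weighted_1 : weighted e1 [:: 2; 0; n; n'] [:: e1; e2; x; y].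
Proof. by have := frame2_weighted (mem_head _ _). Qed.

Lemma frame2_products i j : (i < 4)%N -> (j < 4)%N ->
  exists q, [:: e1; e2; x; y]`_i ** [:: e1; e2; x; y]`_j =
    comb e1 e2 x y (wmask [:: [:: 2; 0; n; n']; [:: 0; 2; m; m'];
      [:: 2; 2; (n + m)%N; (n' + m')%N]] i j q).
Proof.
have [_ bX] := F.
exact: (masked two_neq0 jA (ps := [:: (e1, [:: 2; 0; n; n']); (e2, [:: 0; 2; m; m']);
    (e1 + e2, [:: 2; 2; (n + m)%N; (n' + m')%N])]) bX frame2_weighted).
Qed.

Lemma frame2_null : local_space (0 : A) (eigv (e1 + e2) 0) (\dim (eigv (e1 + e2) 0)).
Proof.
have [[o mx] _] := F; have := null_local_space two_neq0 jA o (erefl _) mx.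
by rewrite !big_cons big_nil addr0.
Qed.

Lemma frame2_unit d : \dim (eigv e1 2) = d.+1 -> local_space e1 (eigv e1 2) d.
Proof.
have [[o mx] _] := F; apply: (unit_local_space two_neq0 jA o (erefl _) mx).
exact: mem_head.
Qed.

Lemma frame2_respan b c : x \in <<[:: e1; e2; b; c]>>%VS ->
  y \in <<[:: e1; e2; b; c]>>%VS -> frame2 e1 e2 b c.
Proof.
move=> hx hy; have [m0 bX] := F; split=> //; apply: basis_of_span4 => //.
rewrite -(span_basis bX); apply/span_subvP => v.
by rewrite !inE => /or4P[] /eqP -> //; span_mem.
Qed.

Lemma frame2_nonzero : x != 0 /\ y != 0.
Proof.
have [_ /basis_free f] := F.
by split; apply: (free_not0 f); rewrite !inE eqxx ?orbT.
Qed.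

End Frame.

Lemma typed2_span e1 e2 n m (X : seq A) b : {in X, forall x, typed2 e1 e2 n m x} ->
  b \in <<X>>%VS -> typed2 e1 e2 n m b.
Proof.
move=> hX; suff s : (<<X>> <= eigv e1 n :&: eigv e2 m)%VS.
  by move/(subvP s); rewrite memv_cap => /andP [/mem_eigvP h1 /mem_eigvP h2].
apply/span_subvP => x /hX [h1 h2]; rewrite memv_cap.
by apply/andP; split; apply/mem_eigvP.
Qed.

(** The bound [0 < n + m] keeps y out of A_00, which is then a line; being nil, it has zero
    product. *)
Lemma frame2_square_zero_00 e1 e2 x y n m : frame2 e1 e2 x y ->
  typed2 e1 e2 0 0 x -> typed2 e1 e2 n m y -> (0 < n + m < 3)%N ->
  exists b, [/\ frame2 e1 e2 b y, typed2 e1 e2 0 0 b & b ** b = 0].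
Proof.
move=> F tx ty /andP [s0 s3].
have sm : [&& 0 < 3, 0 < 3, n < 3, m < 3, 0 + 0 < 3 & n + m < 3]%N by lia.
have wX := frame2_weighted_sum F tx ty sm; have [_ bX] := F.
have [E dE] := eigv_span two_neq0 bX wX (n := 0) isT.
have nm : (n + m == 0)%N = false by lia.
rewrite /= nm /= in E dE; have := frame2_null F; rewrite dE.
move=> /(local1 two_neq0 jA) [b Eb bb]; exists b; split=> //.
  apply: (frame2_respan F); last by span_mem.
  suff /subvP : (eigv (e1 + e2) 0 <= <<[:: e1; e2; b; y]>>)%VS.
    by apply; rewrite E; span_mem.
  by rewrite Eb; sub_spans.
apply: (typed2_span (X := [:: x])); first by move=> v; rewrite inE => /eqP ->.
by rewrite -E Eb; span_mem.
Qed.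

(** As [n] is not 2, A_11 is spanned by e_1 and x, and x can be replaced by a nilpotent element of
    that plane. *)
Lemma frame2_square_zero_11 e1 e2 x y n m : frame2 e1 e2 x y ->
  typed2 e1 e2 2 0 x -> typed2 e1 e2 n m y -> (n != 2)%N -> (n + m < 3)%N ->
  exists b, [/\ frame2 e1 e2 b y, typed2 e1 e2 2 0 b & b ** b = 0].
Proof.
move=> F tx ty n2 s3.
have sm : [&& 2 < 3, 0 < 3, n < 3, m < 3, 2 + 0 < 3 & n + m < 3]%N by lia.
have wX := frame2_weighted_1 F tx ty sm; have [_ bX] := F.
have [E dE] := eigv_span two_neq0 bX wX (n := 2) isT.
rewrite /= (negPf n2) /= in E dE; have := frame2_unit F dE.
move=> /(local1 two_neq0 jA) [b Eb bb]; exists b; split=> //.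
  apply: (frame2_respan F); last by span_mem.
  suff /subvP : (eigv e1 2 <= <<[:: e1; e2; b; y]>>)%VS.
    by apply; rewrite E; span_mem.
  by rewrite Eb; sub_spans.
have [e11 e22 e12 e21] := frame2_idem F.
apply: (typed2_span (X := [:: e1; x])).
  by move=> v; rewrite !inE => /orP[] /eqP -> //; split; [apply/(eig2E two_neq0) | apply/eig0E].
by rewrite -E Eb; span_mem.
Qed.

Lemma frame2_kill e1 e2 x y n m p : frame2 e1 e2 x y -> n = 0%N \/ n = 2%N ->
  typed2 e1 e2 n m x -> typed2 e1 e2 1 p y -> x ** x = 0 ->
  (exists s, x ** y = s *: y) -> x ** y = 0 /\ y ** x = 0.
Proof.
move=> F hn [hx _] [hy _] xx [s xy]; rewrite (amulC jA y).
have [e11 _ _ _] := frame2_idem F.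
by rewrite (act_half_zero two_neq0 jA e11 hn hx hy _ xy) // xx amul0l.
Qed.

Ltac frame2_start F := have [_ bX] := F; have [e11 e22 e12 e21] := frame2_idem F.

Lemma two_00_00 e1 e2 x y : frame2 e1 e2 x y -> typed2 e1 e2 0 0 x ->
  typed2 e1 e2 0 0 y -> listed A.
Proof.
move=> F tx ty.
have wX := frame2_weighted_sum F tx ty isT; have [_ bX0] := F.
have [E dE] := eigv_span two_neq0 bX0 wX (n := 0) isT.
rewrite /= in E dE; have := frame2_null F; rewrite dE.
move=> /(local2 two_neq0 jA) [b [c [Eb cc bc H]]].
have sub : (eigv (e1 + e2) 0 <= <<[:: e1; e2; b; c]>>)%VS by rewrite Eb; sub_spans.
have F' : frame2 e1 e2 b c.
  by apply: (frame2_respan F); apply: (subvP sub); rewrite E; span_mem.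
have tX v : v \in eigv (e1 + e2) 0 -> typed2 e1 e2 0 0 v.
  by rewrite E; apply: typed2_span => w; rewrite !inE => /orP[] /eqP ->.
have [/eig0E e1b /eig0E e2b] : typed2 e1 e2 0 0 b by apply: tX; rewrite Eb; span_mem.
have [/eig0E e1c /eig0E e2c] : typed2 e1 e2 0 0 c by apply: tX; rewrite Eb; span_mem.
frame2_start F'; case: H => bb.
- by apply: listed_two_00_00_zero; present e1 e2 b c.
- by apply: listed_two_00_00; present e1 e2 b c.
Qed.

Lemma two_11_11 e1 e2 x y : frame2 e1 e2 x y -> typed2 e1 e2 2 0 x ->
  typed2 e1 e2 2 0 y -> listed A.
Proof.
move=> F tx ty; have [e11 e22 e12 e21] := frame2_idem F.
have wX := frame2_weighted_1 F tx ty isT; have [_ bX0] := F.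
have [E dE] := eigv_span two_neq0 bX0 wX (n := 2) isT.
rewrite /= in E dE; have := frame2_unit F dE.
move=> /(local2 two_neq0 jA) [b [c [Eb cc bc H]]].
have sub : (eigv e1 2 <= <<[:: e1; e2; b; c]>>)%VS by rewrite Eb; sub_spans.
have F' : frame2 e1 e2 b c.
  by apply: (frame2_respan F); apply: (subvP sub); rewrite E; span_mem.
have tX v : v \in eigv e1 2 -> typed2 e1 e2 2 0 v.
  rewrite E; apply: typed2_span => w; rewrite !inE => /or3P[] /eqP -> //.
  by split; [apply/(eig2E two_neq0) | apply/eig0E].
have [/(eig2E two_neq0) e1b /eig0E e2b] : typed2 e1 e2 2 0 b by apply: tX; rewrite Eb; span_mem.
have [/(eig2E two_neq0) e1c /eig0E e2c] : typed2 e1 e2 2 0 c by apply: tX; rewrite Eb; span_mem.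
have [_ bX] := F'; case: H => bb.
- by apply: listed_two_11_11_zero; present e1 e2 b c.
- by apply: listed_two_11_11; present e1 e2 b c.
Qed.

Lemma two_00_11 e1 e2 x y : frame2 e1 e2 x y -> typed2 e1 e2 0 0 x ->
  typed2 e1 e2 2 0 y -> listed A.
Proof.
move=> F tx ty; have [b [{}F {}tx xx]] := frame2_square_zero_00 F tx ty isT.
move: b x F tx xx => x _ F tx xx.
have [b [{}F {}ty yy]] := frame2_square_zero_11 (frame2_swap_x F) ty tx isT isT.
move: b y F ty yy => y _ /frame2_swap_x F ty yy; frame2_start F.
have [q xy] := frame2_products F tx ty isT (i := 2) (j := 3) isT isT.
rewrite /wmask /compat /= in xy.
have [/eig0E e1x /eig0E e2x] := tx; have [/(eig2E two_neq0) e1y /eig0E e2y] := ty.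
by apply: listed_two_00_11; present e1 e2 x y.
Qed.

Lemma two_11_22 e1 e2 x y : frame2 e1 e2 x y -> typed2 e1 e2 2 0 x ->
  typed2 e1 e2 0 2 y -> listed A.
Proof.
move=> F tx ty; have [b [{}F {}tx xx]] := frame2_square_zero_11 F tx ty isT isT.
move: b x F tx xx => x _ F tx xx.
have [b [{}F {}ty yy]] := frame2_square_zero_11 (frame2_swap_e (frame2_swap_x F))
  (typed2_swap ty) (typed2_swap tx) isT isT.
move: b y F ty yy => y _ /frame2_swap_e/frame2_swap_x F /typed2_swap ty yy; frame2_start F.
have [q xy] := frame2_products F tx ty isT (i := 2) (j := 3) isT isT.
rewrite /wmask /compat /= in xy.
have [/(eig2E two_neq0) e1x /eig0E e2x] := tx; have [/eig0E e1y /(eig2E two_neq0) e2y] := ty.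
by apply: listed_two_11_22; present e1 e2 x y.
Qed.

Lemma two_00_10 e1 e2 x y : frame2 e1 e2 x y -> typed2 e1 e2 0 0 x ->
  typed2 e1 e2 1 0 y -> listed A.
Proof.
move=> F tx ty; have [b [{}F {}tx xx]] := frame2_square_zero_00 F tx ty isT.
move: b x F tx xx => x _ F tx xx; frame2_start F.
have [q hq] := frame2_products F tx ty isT (i := 2) (j := 3) isT isT.
have [r yy] := frame2_products F tx ty isT (i := 3) (j := 3) isT isT.
rewrite /wmask /compat /= in hq yy.
have [xy yx] : x ** y = 0 /\ y ** x = 0.
  apply: (frame2_kill F (or_introl (erefl _)) tx ty xx).
  by exists (q3 q); rewrite hq; comb_norm.
have [/eig0E e1x /eig0E e2x] := tx; have [/eig1E e1y /eig0E e2y] := ty.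
by apply: (listed_two_00_10 two_neq0 jA (a := q0 r) (g := q2 r)); present e1 e2 x y.
Qed.

Lemma two_00_12 e1 e2 x y : frame2 e1 e2 x y -> typed2 e1 e2 0 0 x ->
  typed2 e1 e2 1 1 y -> listed A.
Proof.
move=> F tx ty; have [b [{}F {}tx xx]] := frame2_square_zero_00 F tx ty isT.
move: b x F tx xx => x _ F tx xx; frame2_start F.
have [q xy] := frame2_products F tx ty isT (i := 2) (j := 3) isT isT.
have [r yy] := frame2_products F tx ty isT (i := 3) (j := 3) isT isT.
rewrite /wmask /compat /= in xy yy.
have [/eig0E e1x /eig0E e2x] := tx; have [/eig1E e1y /eig1E e2y] := ty.
by apply: (listed_two_00_12 two_neq0 jA (a := q0 r) (b := q1 r)); present e1 e2 x y.
Qed.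

Lemma two_11_10 e1 e2 x y : frame2 e1 e2 x y -> typed2 e1 e2 2 0 x ->
  typed2 e1 e2 1 0 y -> listed A.
Proof.
move=> F tx ty; have [b [{}F {}tx xx]] := frame2_square_zero_11 F tx ty isT isT.
move: b x F tx xx => x _ F tx xx; frame2_start F.
have [q hq] := frame2_products F tx ty isT (i := 2) (j := 3) isT isT.
have [r yy] := frame2_products F tx ty isT (i := 3) (j := 3) isT isT.
rewrite /wmask /compat /= in hq yy.
have [xy yx] : x ** y = 0 /\ y ** x = 0.
  apply: (frame2_kill F (or_intror (erefl _)) tx ty xx).
  by exists (q3 q); rewrite hq; comb_norm.
have [/(eig2E two_neq0) e1x /eig0E e2x] := tx; have [/eig1E e1y /eig0E e2y] := ty.
by apply: (listed_two_11_10 two_neq0 jA (a := q0 r) (b := q2 r)); present e1 e2 x y.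
Qed.

Lemma two_11_20 e1 e2 x y : frame2 e1 e2 x y -> typed2 e1 e2 2 0 x ->
  typed2 e1 e2 0 1 y -> listed A.
Proof.
move=> F tx ty; have [b [{}F {}tx xx]] := frame2_square_zero_11 F tx ty isT isT.
move: b x F tx xx => x _ F tx xx; frame2_start F.
have [q xy] := frame2_products F tx ty isT (i := 2) (j := 3) isT isT.
have [r yy] := frame2_products F tx ty isT (i := 3) (j := 3) isT isT.
rewrite /wmask /compat /= in xy yy.
have [/(eig2E two_neq0) e1x /eig0E e2x] := tx; have [/eig0E e1y /eig1E e2y] := ty.
by apply: (listed_two_11_20 two_neq0 jA (b := q1 r)); present e1 e2 x y.
Qed.

Lemma two_11_12 e1 e2 x y : frame2 e1 e2 x y -> typed2 e1 e2 2 0 x ->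
  typed2 e1 e2 1 1 y -> listed A.
Proof.
move=> F tx ty; have [b [{}F {}tx xx]] := frame2_square_zero_11 F tx ty isT isT.
move: b x F tx xx => x _ F tx xx; frame2_start F.
have [q hq] := frame2_products F tx ty isT (i := 2) (j := 3) isT isT.
have [r yy] := frame2_products F tx ty isT (i := 3) (j := 3) isT isT.
rewrite /wmask /compat /= in hq yy.
have [xy yx] : x ** y = 0 /\ y ** x = 0.
  apply: (frame2_kill F (or_intror (erefl _)) tx ty xx).
  by exists (q3 q); rewrite hq; comb_norm.
have [/(eig2E two_neq0) e1x /eig0E e2x] := tx; have [/eig1E e1y /eig1E e2y] := ty.
by apply: (listed_two_11_12 two_neq0 jA (a := q0 r) (a' := q1 r) (b := q2 r)); present e1 e2 x y.
Qed.

Ltac half_products F tx ty xx xy yy :=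
  frame2_start F;
  have [p xx] := frame2_products F tx ty isT (i := 2) (j := 2) isT isT;
  have [q xy] := frame2_products F tx ty isT (i := 2) (j := 3) isT isT;
  have [r yy] := frame2_products F tx ty isT (i := 3) (j := 3) isT isT;
  rewrite /wmask /compat /= in xx xy yy.

Lemma two_10_10 e1 e2 x y : frame2 e1 e2 x y -> typed2 e1 e2 1 0 x ->
  typed2 e1 e2 1 0 y -> listed A.
Proof.
move=> F tx ty; half_products F tx ty xx xy yy.
have [/eig1E e1x /eig0E e2x] := tx; have [/eig1E e1y /eig0E e2y] := ty.
by apply: (listed_two_10_10 two_neq0 jA (a := q0 p) (b := q0 q) (c := q0 r)); present e1 e2 x y.
Qed.

Lemma two_10_20 e1 e2 x y : frame2 e1 e2 x y -> typed2 e1 e2 1 0 x ->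
  typed2 e1 e2 0 1 y -> listed A.
Proof.
move=> F tx ty; half_products F tx ty xx xy yy.
have [/eig1E e1x /eig0E e2x] := tx; have [/eig0E e1y /eig1E e2y] := ty.
by apply: (listed_two_10_20 two_neq0 jA (a := q0 p) (b := q1 r)); present e1 e2 x y.
Qed.

Lemma two_10_12 e1 e2 x y : frame2 e1 e2 x y -> typed2 e1 e2 1 0 x ->
  typed2 e1 e2 1 1 y -> listed A.
Proof.
move=> F tx ty; half_products F tx ty xx xy yy.
have [/eig1E e1x /eig0E e2x] := tx; have [/eig1E e1y /eig1E e2y] := ty.
by apply: (listed_two_10_12 two_neq0 jA (a := q0 p) (b := q0 r) (c := q1 r)); present e1 e2 x y.
Qed.

Lemma two_12_12 e1 e2 x y : frame2 e1 e2 x y -> typed2 e1 e2 1 1 x ->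
  typed2 e1 e2 1 1 y -> listed A.
Proof.
move=> F tx ty; half_products F tx ty xx xy yy.
have [/eig1E e1x /eig1E e2x] := tx; have [/eig1E e1y /eig1E e2y] := ty.
by apply: (listed_two_12_12 two_neq0 jA (a := q0 p) (a' := q1 p) (b := q0 q) (b' := q1 q)
  (c := q0 r) (c' := q1 r)); present e1 e2 x y.
Qed.

(** Only weights with a 2 next to a nonzero weight must be excluded: if e x = x, then f lies in the
    0-space of e and annihilates x. *)
Lemma orthogonal_eig_bound e f x n m : e ** e = e -> f ** f = f -> e ** f = 0 ->
  x != 0 -> (n < 3)%N -> (m < 3)%N -> eig e n x -> eig f m x -> (n + m < 3)%N.
Proof.
have key e' f' n' m' : e' ** e' = e' -> e' ** f' = 0 -> x != 0 -> (n' < 3)%N -> (m' < 3)%N ->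
    eig e' n' x -> eig f' m' x -> n' = 2%N -> m' = 0%N.
  move=> ee ef x0 n3 m3 hx hy n2; subst n'; apply: (wt_inj two_neq0 (m := 0) m3 isT).
  have h := peirce_10 two_neq0 jA ee (proj1 (eig2E two_neq0 _ _) hx) ef.
  move: hy; rewrite /eig (amulC jA) h => /esym/eqP.
  by rewrite scaler_eq0 (negPf x0) orbF wt0 => /eqP.
move=> ee ff ef x0 n3 m3 hn hm; have fe : f ** e = 0 by rewrite (amulC jA).
have k1 := key e f n m ee ef x0 n3 m3 hn hm; have k2 := key f e m n ff fe x0 m3 n3 hm hn.
by move: n m n3 m3 {hn hm} k1 k2 => [|[|[|]]] // [|[|[|]]] // _ _ k1 k2;
  first [by have := k1 erefl | by have := k2 erefl].
Qed.

Lemma listed_two e1 e2 : maximal_idempotents [:: e1; e2] -> listed A.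
Proof.
move=> M; have [[u idem orth] _] := M.
have idem' : {in [:: e1; e2], forall f, f ** f = f} by move=> f /idem [].
have [x f3 hx] := extend_joint two_neq0 jA dimA idem' orth (orthogonal_free (proj1 M)) isT.
have [y f4 hy] := extend_joint two_neq0 jA dimA idem' orth f3 isT.
have F : frame2 e1 e2 x y by split=> //; apply: basis_of_free.
have [e11 e22 e12 e21] := frame2_idem F; have [x0 y0] := frame2_nonzero F.
have m1 : e1 \in [:: e1; e2] by rewrite mem_head.
have m2 : e2 \in [:: e1; e2] by rewrite !inE eqxx orbT.
have [n1 n13 h1] := hx _ m1; have [n2 n23 h2] := hx _ m2.
have [l1 l13 k1] := hy _ m1; have [l2 l23 k2] := hy _ m2.
have sx := orthogonal_eig_bound e11 e22 e12 x0 n13 n23 h1 h2.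
have sy := orthogonal_eig_bound e11 e22 e12 y0 l13 l23 k1 k2.
have tx : typed2 e1 e2 n1 n2 x by []; have ty : typed2 e1 e2 l1 l2 y by [].
have Fx := frame2_swap_x F; have Fe := frame2_swap_e F; have Fex := frame2_swap_x Fe.
have sx' := typed2_swap tx; have sy' := typed2_swap ty.
clear - jA dimA two_neq0 F Fx Fe Fex sx sy tx ty sx' sy'.
(* The six Peirce types give 21 unordered pairs, hence 13 cases up to the exchange of e_1 and
   e_2. *)
move: n1 n2 l1 l2 sx sy tx ty sx' sy' => [|[|[|]]] // [|[|[|]]] // [|[|[|]]] // [|[|[|]]] // _
  _ tx ty tx' ty';
first [exact: two_00_00 F tx ty | exact: two_11_11 F tx ty | exact: two_11_11 Fe tx' ty'
 | exact: two_00_11 F tx ty | exact: two_00_11 Fx ty tx | exact: two_00_11 Fe tx' ty' | exact: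
   two_00_11 Fex ty' tx'
 | exact: two_11_22 F tx ty | exact: two_11_22 Fx ty tx
 | exact: two_00_10 F tx ty | exact: two_00_10 Fx ty tx | exact: two_00_10 Fe tx' ty' | exact:
   two_00_10 Fex ty' tx'
 | exact: two_00_12 F tx ty | exact: two_00_12 Fx ty tx
 | exact: two_11_10 F tx ty | exact: two_11_10 Fx ty tx | exact: two_11_10 Fe tx' ty' | exact:
   two_11_10 Fex ty' tx'
 | exact: two_11_20 F tx ty | exact: two_11_20 Fx ty tx | exact: two_11_20 Fe tx' ty' | exact:
   two_11_20 Fex ty' tx'
 | exact: two_11_12 F tx ty | exact: two_11_12 Fx ty tx | exact: two_11_12 Fe tx' ty' | exact:
   two_11_12 Fex ty' tx'
 | exact: two_10_10 F tx ty | exact: two_10_10 Fe tx' ty'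
 | exact: two_10_20 F tx ty | exact: two_10_20 Fx ty tx
 | exact: two_10_12 F tx ty | exact: two_10_12 Fx ty tx | exact: two_10_12 Fe tx' ty' | exact:
   two_10_12 Fex ty' tx'
 | exact: two_12_12 F tx ty].
Qed.

End TwoIdempotents.

(** * Three and four idempotents, and the whole classification *)

Section Classification.
Variables (k : closedFieldType) (A : algebra k).
Hypothesis two_neq0 : (2 : k) != 0.
Hypothesis jA : jordan A.
Hypothesis dimA : adim A = 4%N.
Local Notation "x ** y" := (@amul k A x y) (at level 40, left associativity).
Implicit Types (x y v b : A).

Definition typed3 e1 e2 e3 (n m l : nat) x : Prop :=
  [/\ eig e1 n x, eig e2 m x & eig e3 l x].

Definition frame3 e1 e2 e3 x : Prop :=
  maximal_idempotents [:: e1; e2; e3] /\ basis_of fullv [:: e1; e2; e3; x].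

Lemma frame3_products e1 e2 e3 x : frame3 e1 e2 e3 x ->
  [/\ e1 ** e1 = e1, e2 ** e2 = e2 & e3 ** e3 = e3] /\
  [/\ e1 ** e2 = 0, e1 ** e3 = 0, e2 ** e3 = 0 &
      [/\ e2 ** e1 = 0, e3 ** e1 = 0 & e3 ** e2 = 0]].
Proof.
move=> [[[/= u idem orth] _] _].
move: u; rewrite !inE negb_or andbT => /andP [/andP [n12 n13] n23].
have i e : e \in [:: e1; e2; e3] -> e ** e = e by move=> /idem [].
split; first by split; apply: i; rewrite !inE eqxx ?orbT.
by split; [| | |split]; apply: orth; rewrite ?inE ?eqxx ?orbT // eq_sym.
Qed.

Lemma frame3_respan e1 e2 e3 x b : frame3 e1 e2 e3 x ->
  x \in <<[:: e1; e2; e3; b]>>%VS -> frame3 e1 e2 e3 b.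
Proof.
move=> [m0 bX] hx; split=> //; apply: basis_of_span4 => //.
rewrite -(span_basis bX); apply/span_subvP => v.
by rewrite !inE => /or4P[] /eqP -> //; span_mem.
Qed.

Lemma frame3_weighted e1 e2 e3 x n m l : frame3 e1 e2 e3 x ->
  typed3 e1 e2 e3 n m l x -> [&& n < 3, m < 3 & l < 3]%N ->
  forall p, p \in [:: (e1, [:: 2; 0; 0; n]); (e2, [:: 0; 2; 0; m]);
    (e3, [:: 0; 0; 2; l])] -> weighted p.1 p.2 [:: e1; e2; e3; x].
Proof.
move=> F [h1 h2 h3] /and3P [n3 m3 l3].
have [[i1 i2 i3] [e12 e13 e23 [e21 e31 e32]]] := frame3_products F.
by move=> p; rewrite !inE => /or3P[] /eqP -> /=; split=> //=;
  case=> [|[|[|[|i]]]] //= _; split=> //; first [by apply/(eig2E two_neq0) | by apply/eig0E].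
Qed.

Lemma frame3_square e1 e2 e3 x n m l : frame3 e1 e2 e3 x ->
  typed3 e1 e2 e3 n m l x -> [&& n < 3, m < 3 & l < 3]%N ->
  exists q, x ** x = comb e1 e2 e3 x (wmask [:: [:: 2; 0; 0; n]; [:: 0; 2; 0; m];
    [:: 0; 0; 2; l]] 3 3 q).
Proof.
move=> F tx s; have [_ bX] := F.
exact: (masked two_neq0 jA (ps := [:: (e1, [:: 2; 0; 0; n]); (e2, [:: 0; 2; 0; m]);
    (e3, [:: 0; 0; 2; l])]) bX (frame3_weighted F tx s) (i := 3) (j := 3) isT isT).
Qed.

Ltac frame3_start F := have [_ bX] := F;
  have [[i1 i2 i3] [e12 e13 e23 [e21 e31 e32]]] := frame3_products F.

Lemma three_000 e1 e2 e3 x : frame3 e1 e2 e3 x -> typed3 e1 e2 e3 0 0 0 x -> listed A.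
Proof.
move=> F tx; have [h1 h2 h3] := tx; frame3_start F.
pose f := e1 + (e2 + e3); have [[o mx] _] := F.
have wX : weighted f [:: 2; 2; 2; 0] [:: e1; e2; e3; x].
  have fm v : f ** v = e1 ** v + (e2 ** v + e3 ** v) by rewrite !amulDl.
  have f1 : f ** e1 = e1 by rewrite fm i1 e21 e31 !addr0.
  have f2 : f ** e2 = e2 by rewrite fm i2 e12 e32 !addr0 add0r.
  have f3 : f ** e3 = e3 by rewrite fm i3 e13 e23 !add0r.
  split=> //; first by rewrite {2}/f !amulDr f1 f2 f3.
  case=> [|[|[|[|i]]]] //= _; split=> //; try exact/(eig2E two_neq0).
  by apply/eig0E; rewrite fm; move: h1 h2 h3 => /eig0E -> /eig0E -> /eig0E ->; rewrite !addr0.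
have [E dE] := eigv_span two_neq0 bX wX (n := 0) isT.
rewrite /= in E dE; have := null_local_space two_neq0 jA o (erefl _) mx.
rewrite !big_cons big_nil addr0 -/f dE => /(local1 two_neq0 jA) [b Eb bb].
have F' : frame3 e1 e2 e3 b.
  apply: (frame3_respan F); suff s : (eigv f 0 <= <<[:: e1; e2; e3; b]>>)%VS.
    by apply: (subvP s); rewrite E; span_mem.
  by rewrite Eb; sub_spans.
have [c bE] : exists c, b = c *: x by apply: span1P; rewrite -E Eb; span_mem.
have z e : eig e 0 x -> e ** b = 0.
  by move=> /eig0E h; rewrite bE amulZr h scaler0.
have z1 := z _ h1; have z2 := z _ h2; have z3 := z _ h3; have [_ bX'] := F'.
by apply: listed_three_00; present e1 e2 e3 b.
Qed.

Lemma three_200 e1 e2 e3 x : frame3 e1 e2 e3 x -> typed3 e1 e2 e3 2 0 0 x -> listed A.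
Proof.
move=> F tx; have [h1 h2 h3] := tx; frame3_start F; have [[o mx] _] := F.
have wX := frame3_weighted F tx isT (mem_head _ _).
have [E dE] := eigv_span two_neq0 bX wX (n := 2) isT; rewrite /= in E dE.
have := unit_local_space two_neq0 jA o (erefl _) mx (mem_head _ _) dE.
move=> /(local1 two_neq0 jA) [b Eb bb].
have F' : frame3 e1 e2 e3 b.
  apply: (frame3_respan F); suff s : (eigv e1 2 <= <<[:: e1; e2; e3; b]>>)%VS.
    by apply: (subvP s); rewrite E; span_mem.
  by rewrite Eb; sub_spans.
have e1b : e1 ** b = b.
  by apply/(eig2E two_neq0)/mem_eigvP; rewrite Eb; span_mem.
have [c [d bE]] : exists c d, b = c *: e1 + d *: x.
  by apply: span2P; rewrite -E Eb; span_mem.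
have e2b : e2 ** b = 0.
  by rewrite bE amulDr !amulZr e21 (proj1 (eig0E _ _) h2) !scaler0 addr0.
have e3b : e3 ** b = 0.
  by rewrite bE amulDr !amulZr e31 (proj1 (eig0E _ _) h3) !scaler0 addr0.
have [_ bX'] := F'; by apply: listed_three_11; present e1 e2 e3 b.
Qed.

Lemma three_100 e1 e2 e3 x : frame3 e1 e2 e3 x -> typed3 e1 e2 e3 1 0 0 x -> listed A.
Proof.
move=> F tx; frame3_start F; have [q xx] := frame3_square F tx isT.
rewrite /wmask /compat /= in xx; have [/eig1E e1x /eig0E e2x /eig0E e3x] := tx.
by apply: (listed_three_10 two_neq0 jA (a := q0 q)); present e1 e2 e3 x.
Qed.

Lemma three_110 e1 e2 e3 x : frame3 e1 e2 e3 x -> typed3 e1 e2 e3 1 1 0 x -> listed A.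
Proof.
move=> F tx; frame3_start F; have [q xx] := frame3_square F tx isT.
rewrite /wmask /compat /= in xx; have [/eig1E e1x /eig1E e2x /eig0E e3x] := tx.
by apply: (listed_three_12 two_neq0 jA (a := q0 q) (b := q1 q)); present e1 e2 e3 x.
Qed.

Lemma frame3_perm e1 e2 e3 f1 f2 f3 x : perm_eq [:: e1; e2; e3] [:: f1; f2; f3] ->
  frame3 e1 e2 e3 x -> frame3 f1 f2 f3 x.
Proof.
move=> p [m bX]; split; first exact: maximal_perm m.
by apply: basis_perm bX; rewrite (perm_cat2r [:: x] [:: e1; e2; e3] [:: f1; f2; f3]).
Qed.

Lemma listed_three (e1 e2 e3 : A) : maximal_idempotents [:: e1; e2; e3] -> listed A.
Proof.
move=> M; have [[u idem orth] _] := M.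
have idem' : {in [:: e1; e2; e3], forall f, f ** f = f} by move=> f /idem [].
have [x f4 hx] := extend_joint two_neq0 jA dimA idem' orth (orthogonal_free (proj1 M)) isT.
have F : frame3 e1 e2 e3 x by split=> //; apply: basis_of_free.
have [[i1 i2 i3] [e12 e13 e23 [e21 e31 e32]]] := frame3_products F.
have x0 : x != 0 by apply: (free_not0 f4); rewrite !inE eqxx !orbT.
have [n n3 h1] : exists2 n, (n < 3)%N & eig e1 n x by apply: hx; rewrite mem_head.
have [m m3 h2] : exists2 n, (n < 3)%N & eig e2 n x by apply: hx; rewrite !inE eqxx orbT.
have [l l3 h3] : exists2 n, (n < 3)%N & eig e3 n x by apply: hx; rewrite !inE eqxx !orbT.
have nm := orthogonal_eig_bound two_neq0 jA i1 i2 e12 x0 n3 m3 h1 h2.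
(* The bound for two orthogonal idempotents, applied to e_1 + e_2 and e_3. It leaves A_00, A_ii,
   A_i0 and A_ij for the last vector. *)
have s : ((n + m) + l < 3)%N.
  apply: (orthogonal_eig_bound two_neq0 jA (e := e1 + e2) (f := e3) _ i3 _ x0 nm l3 _ h3).
  - by rewrite !amulE i1 i2 e12 e21 addr0 add0r.
  - by rewrite amulDl e13 e23 addr0.
  - by rewrite /eig amulDl h1 h2 wtD scalerDl.
have F213 : frame3 e2 e1 e3 x by apply: frame3_perm F; apply/permP => p /=; lia.
have F312 : frame3 e3 e1 e2 x by apply: frame3_perm F; apply/permP => p /=; lia.
have F132 : frame3 e1 e3 e2 x by apply: frame3_perm F; apply/permP => p /=; lia.
have F231 : frame3 e2 e3 e1 x by apply: frame3_perm F; apply/permP => p /=; lia.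
have t123 : typed3 e1 e2 e3 n m l x by [].
have t213 : typed3 e2 e1 e3 m n l x by [].
have t312 : typed3 e3 e1 e2 l n m x by [].
have t132 : typed3 e1 e3 e2 n l m x by [].
have t231 : typed3 e2 e3 e1 m l n x by [].
clear - jA dimA two_neq0 F F213 F312 F132 F231 s t123 t213 t312 t132 t231.
move: n m l s t123 t213 t312 t132 t231 => [|[|[|n]]] // [|[|[|m]]] // [|[|[|l]]] // _;
  move=> t123 t213 t312 t132 t231.
all: first [exact: three_000 F t123 | exact: three_100 F t123 | exact: three_100 F213 t213
 | exact: three_100 F312 t312 | exact: three_200 F t123 | exact: three_200 F213 t213
 | exact: three_200 F312 t312 | exact: three_110 F t123 | exact: three_110 F132 t132
 | exact: three_110 F231 t231].
Qed.

Lemma listed_of_four (e1 e2 e3 e4 : A) : orthogonal_idempotents [:: e1; e2; e3; e4] -> listed A.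
Proof.
move=> o; have bX := basis_of_free dimA (orthogonal_free o); have [u idem orth] := o.
move: u => /=; rewrite !inE !negb_or !andbT => /and3P [/and3P [n12 n13 n14] /andP [n23 n24] n34].
have i e : e \in [:: e1; e2; e3; e4] -> e ** e = e by move=> /idem [].
have i1 : e1 ** e1 = e1 by apply: i; rewrite !inE eqxx ?orbT.
have i2 : e2 ** e2 = e2 by apply: i; rewrite !inE eqxx ?orbT.
have i3 : e3 ** e3 = e3 by apply: i; rewrite !inE eqxx ?orbT.
have i4 : e4 ** e4 = e4 by apply: i; rewrite !inE eqxx ?orbT.
have e12 : e1 ** e2 = 0 by apply: orth; rewrite ?inE ?eqxx ?orbT.
have e13 : e1 ** e3 = 0 by apply: orth; rewrite ?inE ?eqxx ?orbT.
have e14 : e1 ** e4 = 0 by apply: orth; rewrite ?inE ?eqxx ?orbT.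
have e23 : e2 ** e3 = 0 by apply: orth; rewrite ?inE ?eqxx ?orbT.
have e24 : e2 ** e4 = 0 by apply: orth; rewrite ?inE ?eqxx ?orbT.
have e34 : e3 ** e4 = 0 by apply: orth; rewrite ?inE ?eqxx ?orbT.
by apply: listed_four; present e1 e2 e3 e4.
Qed.

(** Orthogonal idempotents are linearly independent, so a family has at most four members. *)
Lemma exists_maximal : exists es : seq A, maximal_idempotents es.
Proof.
have bound (es : seq A) : orthogonal_idempotents es -> (size es <= 4)%N.
  move=> /orthogonal_free /eqP <-; rewrite -[X in (_ <= X)%N]dimA.
  by rewrite /adim dimvS ?subvf.
have : orthogonal_idempotents ([::] : seq A) by split.
move: [::] => es; move: {2}(4 - size es)%N (leqnn (4 - size es)) => d.
elim: d es => [|d IH] es hd o.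
  by exists es; split=> // fs /bound; move: hd; lia.
have [m|] := classic (forall fs : seq A, orthogonal_idempotents fs -> (size fs <= size es)%N).
  by exists es.
move=> /not_all_ex_not [fs hfs]; have [ofs /negP] := imply_to_and _ _ hfs.
rewrite -ltnNge => sfs.
by apply: (IH fs) => //; have := bound fs ofs; lia.
Qed.

Theorem jordan_listed : listed A.
Proof.
have [es M] := exists_maximal; have [o mx] := M.
have s4 : (size es <= 4)%N.
  have := orthogonal_free o => /eqP <-; rewrite -[X in (_ <= X)%N]dimA.
  by rewrite /adim dimvS ?subvf.
case: es M o mx s4 => [|e1 [|e2 [|e3 [|e4 [|]]]]] // M o mx _.
- apply: (nil_listed two_neq0 jA dimA) => x.
  have [//|[q [gg g0]]] := idempotent_or_nil two_neq0 jA x; exfalso.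
  have /mx : orthogonal_idempotents [:: act x x q]; last by [].
  split=> //; first by move=> e; rewrite inE => /eqP ->.
  by move=> e f; rewrite !inE => /eqP -> /eqP ->; rewrite eqxx.
- exact: (listed_one two_neq0 jA dimA o mx).
- exact: (listed_two two_neq0 jA dimA M).
- exact: listed_three M.
- exact: listed_of_four o.
Qed.

End Classification.

(** * Pairs of tables with equal profiles *)

Section Twins.
Variable k : closedFieldType.
Hypothesis two_neq0 : (2 : k) != 0.
Implicit Types (A B : algebra k) (S : tab k).

Lemma J_jordan (i : 'I_73) : jordan (J k i).
Proof.
have [b bB bM] := J_has_constants k i.
apply: (jordan_of_check two_neq0 bB bM).
by apply: (allP Jtables_jordan); rewrite mem_nth // ltn_ord.
Qed.

Lemma J_presents (i : 'I_73) :
  presents (J k i) (half_tab k (upper_products (nth [::] Jtables i))).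
Proof.
have [b bB bM] := J_has_constants k i.
have [b0 [b1 [b2 [b3 bE]]]] : exists b0 b1 b2 b3 : J k i, b = [:: b0; b1; b2; b3] :> seq _.
  by case: b {bB bM} => [[|b0 [|b1 [|b2 [|b3 [|]]]]] //= _]; exists b0, b1, b2, b3.
exists b0, b1, b2, b3; split; last by case: (J_jordan i).
- by rewrite -bE.
- split; [have := bM (@Ordinal 4 0 isT) (@Ordinal 4 0 isT)
    | have := bM (@Ordinal 4 0 isT) (@Ordinal 4 1 isT)
    | have := bM (@Ordinal 4 0 isT) (@Ordinal 4 2 isT)
    | have := bM (@Ordinal 4 0 isT) (@Ordinal 4 3 isT)];
    by rewrite bE => ->; rewrite comb_big; apply: eq_bigr => -[[|[|[|[|l]]]]].
- split; [have := bM (@Ordinal 4 1 isT) (@Ordinal 4 1 isT)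
    | have := bM (@Ordinal 4 1 isT) (@Ordinal 4 2 isT)
    | have := bM (@Ordinal 4 1 isT) (@Ordinal 4 3 isT)];
    by rewrite bE => ->; rewrite comb_big; apply: eq_bigr => -[[|[|[|[|l]]]]].
- split; [have := bM (@Ordinal 4 2 isT) (@Ordinal 4 2 isT)
    | have := bM (@Ordinal 4 2 isT) (@Ordinal 4 3 isT)
    | have := bM (@Ordinal 4 3 isT) (@Ordinal 4 3 isT)];
    by rewrite bE => ->; rewrite comb_big; apply: eq_bigr => -[[|[|[|[|l]]]]].
Qed.

(** In terms of exponents, x^(m+1) is nonzero and x^(m+2) is zero. *)
Definition has_nil_index A (m : nat) : Prop :=
  exists x : A, pow x m != 0 /\ pow x m.+1 = 0.

Definition tab_pow S (v : quad k) n := iter n (tab_mul S v) v.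

Lemma presents_nil_index A S m : presents A S ->
  has_nil_index A m <-> exists v, tab_pow S v m <> (0, 0, 0, 0) /\ tab_pow S v m.+1 = (0, 0, 0,
    0).
Proof.
move=> [b0 [b1 [b2 [b3 [bB e0 e1 e2 mC]]]]].
have M := amul_comb e0 e1 e2 mC; pose c := comb b0 b1 b2 b3.
have c0 : c (0, 0, 0, 0) = 0 by rewrite /c /comb /= !scale0r !addr0.
have P v n : pow (c v) n = c (tab_pow S v n).
  by elim: n => // n IH; rewrite powS IH M.
have cE v : (c v == 0) = (v == (0, 0, 0, 0)).
  by rewrite -c0 (inj_eq (comb_inj (basis_free bB))).
split=> [[x]|[v [v0 v1]]].
  have [v ->] := comb_surj bB x; rewrite !P cE => -[/eqP v0 /eqP]; rewrite cE => /eqP v1.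
  by exists v.
by exists (c v); rewrite !P cE v1; split=> //; apply/eqP.
Qed.

Lemma iso_nil_index A B m : alg_iso A B -> has_nil_index A m -> has_nil_index B m.
Proof.
move=> [f [[g fK gK] fM]] [x [x0 x1]]; exists (f x).
have P n : pow (f x) n = f (pow x n) by elim: n => // n IH; rewrite !powS IH fM.
rewrite !P x1 linear0; split=> //.
by apply: contra x0 => /eqP h; rewrite -(fK (pow x m)) h -(linear0 f) fK.
Qed.

Lemma J_nil_index (n m : nat) (v : quad k) (n73 : (n < 73)%N) :
  let S := half_tab k (upper_products (nth [::] Jtables n)) in
  tab_pow S v m <> (0, 0, 0, 0) -> tab_pow S v m.+1 = (0, 0, 0, 0) ->
  has_nil_index (J k (Ordinal n73)) m.
Proof.
by move=> S h0 h1; apply/(presents_nil_index m (J_presents (Ordinal n73))); exists v.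
Qed.

Lemma J_no_nil_index (n m : nat) (n73 : (n < 73)%N) :
  let S := half_tab k (upper_products (nth [::] Jtables n)) in
  (forall a b c d, tab_pow S (a, b, c, d) m.+1 = (0, 0, 0, 0) ->
     tab_pow S (a, b, c, d) m = (0, 0, 0, 0)) ->
  ~ has_nil_index (J k (Ordinal n73)) m.
Proof.
move=> S h /(presents_nil_index m (J_presents (Ordinal n73))) [[[[a b] c] d]].
by case=> v0 v1; apply/v0/h.
Qed.

Ltac table_of n :=
  let L := eval vm_compute in (upper_products (nth [::] Jtables n)) in
  rewrite (_ : upper_products (nth [::] Jtables n) = L) //.

Lemma quad_component (v : quad k) (f : quad k -> k) : v = (0, 0, 0, 0) ->
  f v = f (0, 0, 0, 0).
Proof. by move=> ->. Qed.

Ltac unfold_pow := rewrite /tab_pow /iter; unfold_quads.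

Ltac kill_coord h f a n :=
  let e := fresh in
  have e : a ^+ n = 0 by [
    transitivity (f (0, 0, 0, 0) : k) => //; rewrite -(quad_component f h);
    unfold_pow; by_field];
  move/eqP: e; rewrite expf_eq0 => /eqP e; rewrite {}e.

Lemma quad_neq0 (v : quad k) (f : quad k -> k) :
  f (0, 0, 0, 0) = 0 -> f v = 1 -> v <> (0, 0, 0, 0).
Proof. by move=> f0 fv v0; move: (oner_neq0 k); rewrite -fv v0 f0 eqxx. Qed.

Tactic Notation "nil_index" constr(n) constr(m) uconstr(v) constr(f) :=
  refine (@J_nil_index n m v _ _ _); table_of n;
  [apply: (@quad_neq0 _ f) => //; unfold_pow; by_field
  | apply: quad_eq; unfold_pow; by_field].

Lemma nil_index_27 (n73 : (26 < 73)%N) : has_nil_index (J k (Ordinal n73)) 1.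
Proof. nil_index 26%N 1%N (0, 1, 0, 0) (@q2 k). Qed.

Lemma nil_index_43 (n73 : (42 < 73)%N) : has_nil_index (J k (Ordinal n73)) 1.
Proof. nil_index 42%N 1%N (0, 1, 0, 0) (@q2 k). Qed.

Lemma nil_index_57 (n73 : (56 < 73)%N) : has_nil_index (J k (Ordinal n73)) 1.
Proof. nil_index 56%N 1%N (0, 1, 0, 0) (@q2 k). Qed.

Lemma nil_index_38 (n73 : (37 < 73)%N) : has_nil_index (J k (Ordinal n73)) 2.
Proof. nil_index 37%N 2%N (1, 0, 0, 0) (@q2 k). Qed.

Lemma nil_index_39 (n73 : (38 < 73)%N) : has_nil_index (J k (Ordinal n73)) 2.
Proof. nil_index 38%N 2%N (0, 1, 0, 0) (@q3 k). Qed.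

(** In a nilpotent vector the coordinate along each idempotent of the table has a vanishing power,
    hence is zero; what remains lies in the span of the n_i, where squares are zero. The other
    exclusions below have the same form, with cubes in place of squares for index 2. *)
Lemma no_nil_index_22 (n73 : (21 < 73)%N) : ~ has_nil_index (J k (Ordinal n73)) 1.
Proof.
apply: J_no_nil_index; table_of 21%N => a b c d h.
kill_coord h (@q0 k) a 3%N; kill_coord h (@q2 k) c 3%N.
by apply: quad_eq; unfold_pow; by_field.
Qed.

Lemma no_nil_index_21 (n73 : (20 < 73)%N) : ~ has_nil_index (J k (Ordinal n73)) 1.
Proof.
apply: J_no_nil_index; table_of 20%N => a b c d h.
kill_coord h (@q0 k) a 3%N; kill_coord h (@q3 k) d 3%N.
by apply: quad_eq; unfold_pow; by_field.
Qed.

Lemma no_nil_index_14 (n73 : (13 < 73)%N) : ~ has_nil_index (J k (Ordinal n73)) 1.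
Proof.
apply: J_no_nil_index; table_of 13%N => a b c d h.
kill_coord h (@q0 k) a 3%N; kill_coord h (@q3 k) d 3%N.
by apply: quad_eq; unfold_pow; by_field.
Qed.

Lemma no_nil_index_47 (n73 : (46 < 73)%N) : ~ has_nil_index (J k (Ordinal n73)) 2.
Proof.
apply: J_no_nil_index; table_of 46%N => a b c d h.
kill_coord h (@q0 k) a 4%N.
by apply: quad_eq; unfold_pow; by_field.
Qed.

Lemma no_nil_index_27 (n73 : (26 < 73)%N) : ~ has_nil_index (J k (Ordinal n73)) 2.
Proof.
apply: J_no_nil_index; table_of 26%N => a b c d h.
kill_coord h (@q0 k) a 4%N; kill_coord h (@q3 k) d 4%N.
by apply: quad_eq; unfold_pow; by_field.
Qed.

Lemma J_injective (i j : 'I_73) : alg_iso (J k i) (J k j) -> i = j.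
Proof.
have H (i' j' : 'I_73) : (i' < j')%N -> ~ alg_iso (J k i') (J k j').
  move=> ij iij; have := alg_iso_twins two_neq0 ij iij.
  have back := alg_iso_sym iij.
  case: i' j' ij iij back => n n73 [l l73] /= _ iij back.
  rewrite !inE => /or4P[|||/or3P[]] /eqP [E1 E2]; subst n l.
  - exact: no_nil_index_22 (iso_nil_index back (nil_index_27 _)).
  - exact: no_nil_index_21 (iso_nil_index back (nil_index_43 _)).
  - exact: no_nil_index_47 (iso_nil_index iij (nil_index_38 _)).
  - exact: no_nil_index_27 (iso_nil_index back (nil_index_39 _)).
  - apply: (J55_J56_not_iso two_neq0).
    have e n (h : (n < 73)%N) : inord n = Ordinal h by apply: val_inj; rewrite /= inordK.
    by rewrite (e _ n73) (e _ l73).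
  - exact: no_nil_index_14 (iso_nil_index back (nil_index_57 _)).
move=> iij; apply: val_inj; case: (ltngtP (val i) (val j)) => // ij; exfalso.
  exact: H ij iij.
exact: H ij (alg_iso_sym iij).
Qed.

End Twins.

Theorem mainTheorem1 (k : closedFieldType) (char_neq2 : 2%N \notin [pchar k]) :
  (forall i : 'I_73, adim (J k i) = 4%N /\ jordan (J k i)) /\
  (forall i j : 'I_73,
     alg_iso (J k i) (J k j) -> i = j) /\
  (forall A : algebra k, adim A = 4%N -> jordan A ->
     exists i : 'I_73, alg_iso A (J k i)).
Proof.
have two_neq0 : (2 : k) != 0 by move: char_neq2; rewrite inE.
split; first by move=> i; split; [exact: has_constants_dim (J_has_constants k i) | exact:
  J_jordan].
split; first exact: J_injective.
by move=> A dA jA; apply: jordan_listed.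
Qed.
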